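(* Fix $v\in\mathbb R$, $a\in(0,2]$, $p\in\mathbb N$ and real numbers $q_1^0,\dots,q_p^0$, all nonzero. For $t>1$ let $J_t$ be the operator $J$ with perturbation $q_j=tq_j^0$ ($1\le j\le p$), $q_j=0$ ($j>p$). Then every state of $J_t$ whose projection stays bounded converges to $(-1)^pv$ as $t\to\infty$: precisely, for every $R>0$ and $\varepsilon>0$ there is $t_0$ such that for all $t>t_0$ every state $\lambda$ of $J_t$ with $|\pi(\lambda)|\le R$ satisfies $|\pi(\lambda)-(-1)^pv|<\varepsilon$. (Consequently the same holds for the states of the half-nanotube Hamiltonian $H^b$, which is unitarily equivalent to a direct sum of such operators with $a=2|\cos(b+\pi k/N)|$, $k\in\mathbb Z_N$, all nonzero.)
   Context: Put $a_n=a$ for even $n\ge0$, $a_n=1$ for odd $n\ge1$; $v_n=v$ for odd $n$, $v_n=-v$ for even $n$; $\tilde v_n=v_n+q_n$. $J$ is the Jacobi operator on $\ell^2(\mathbb N)$: $(Jy)_1=a_1y_2+\tilde v_1y_1$, $(Jy)_n=a_{n-1}y_{n-1}+a_ny_{n+1}+\tilde v_ny_n$ ($n\ge2$). Band edges $\lambda_0^\pm=\mp\sqrt{v^2+(a+1)^2}$, $\lambda_1^\pm=\pm\sqrt{v^2+(a-1)^2}$; $\sigma_{ac}=[\lambda_0^+,\lambda_1^-]\cup[\lambda_1^+,\lambda_0^-]$. $\Lambda$ is the two-sheeted Riemann surface obtained by gluing two copies $\Lambda_+$ (physical sheet) and $\Lambda_-$ of $\mathbb C\setminus\sigma_{ac}$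 crosswise along the bands, $\pi:\Lambda\to\mathbb C$ the projection. For $\lambda\in\Lambda_+$, $R(\lambda)=(J-\lambda)^{-1}$; for finitely supported $f,g$, $\langle R(\lambda)f,g\rangle$ extends meromorphically to $\Lambda$. A state is: an eigenvalue of $J$ (bound state), or a point of $\Lambda_-$ where $\langle Rf,g\rangle$ has a pole for some finitely supported $f,g$ (resonance), or a band edge where $\langle Rf,g\rangle$ is singular for some finitely supported $f,g$ (virtual state). *)

(* Defs.v *)
From Stdlib Require Import Reals Lra List.
Open Scope R_scope.

Definition Cx : Type := (R * R)%type.
Definition RtoC (x : R) : Cx := (x, 0).
Definition Cadd (z w : Cx) : Cx := (fst z + fst w, snd z + snd w).
Definition Csub (z w : Cx) : Cx := (fst z - fst w, snd z - snd w).
Definition Cmul (z w : Cx) : Cx :=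
  (fst z * fst w - snd z * snd w, fst z * snd w + snd z * fst w).
Definition Cconj (z : Cx) : Cx := (fst z, - snd z).
Definition Cmod (z : Cx) : R := sqrt (fst z ^ 2 + snd z ^ 2).

Definition Cdiff (F : Cx -> Cx) (z : Cx) : Prop :=
  exists L : Cx, forall eps, 0 < eps -> exists delta, 0 < delta /\
    forall h : Cx, 0 < Cmod h < delta ->
      Cmod (Csub (Csub (F (Cadd z h)) (F z)) (Cmul L h)) <= eps * Cmod h.

Definition locfin (D S : Cx -> Prop) : Prop :=
  (forall s, S s -> D s) /\
  forall z, D z -> exists r, 0 < r /\ exists l : list Cx,
    forall s, S s -> Cmod (Csub s z) < r -> In s l.

Definition merom_on (D : Cx -> Prop) (F : Cx -> Cx) (S : Cx -> Prop) : Prop :=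
  locfin D S /\ forall z, D z -> ~ S z -> Cdiff F z.

Definition acoef (a : R) (n : nat) : R := if Nat.even n then a else 1.
Definition vcoef (v : R) (n : nat) : R := if Nat.even n then - v else v.

(* The Jacobi operator with perturbation q, acting on sequences indexed by n >= 1
   (the value at index 0 is never used). *)
Definition Jop (a v : R) (q : nat -> R) (y : nat -> Cx) (n : nat) : Cx :=
  match n with
  | 0 => (0, 0)
  | 1 => Cadd (Cmul (RtoC (acoef a 1)) (y 2%nat))
              (Cmul (RtoC (vcoef v 1 + q 1%nat)) (y 1%nat))
  | S m => Cadd (Cadd (Cmul (RtoC (acoef a m)) (y m))
                      (Cmul (RtoC (acoef a n)) (y (S n))))
                (Cmul (RtoC (vcoef v n + q n)) (y n))
  end.

Definition l2 (y : nat -> Cx) : Prop :=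
  exists l, Un_cv (fun N => sum_f_R0 (fun k => (Cmod (y (S k))) ^ 2) N) l.

Definition fin_supp (y : nat -> Cx) : Prop :=
  exists N, forall n, (N < n)%nat -> y n = (0, 0).

Definition Cseries (u : nat -> Cx) (w : Cx) : Prop :=
  Un_cv (fun N => sum_f_R0 (fun k => fst (u (S k))) N) (fst w) /\
  Un_cv (fun N => sum_f_R0 (fun k => snd (u (S k))) N) (snd w).

Definition eigenvalue (a v : R) (q : nat -> R) (z : Cx) : Prop :=
  exists y, l2 y /\ (exists n, (1 <= n)%nat /\ y n <> (0, 0)) /\
    forall n, (1 <= n)%nat -> Jop a v q y n = Cmul z (y n).

Definition res_set (a v : R) (q : nat -> R) (z : Cx) : Prop :=
  forall h, l2 h ->
    (exists u, l2 u /\ forall n, (1 <= n)%nat -> Csub (Jop a v q u n) (Cmul z (u n)) = h n) /\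
    (forall u1 u2, l2 u1 -> l2 u2 ->
       (forall n, (1 <= n)%nat -> Csub (Jop a v q u1 n) (Cmul z (u1 n)) = h n) ->
       (forall n, (1 <= n)%nat -> Csub (Jop a v q u2 n) (Cmul z (u2 n)) = h n) ->
       forall n, (1 <= n)%nat -> u1 n = u2 n).

Definition resolv_val (a v : R) (q : nat -> R) (f g : nat -> Cx) (z w : Cx) : Prop :=
  res_set a v q z /\
  exists u, l2 u /\
    (forall n, (1 <= n)%nat -> Csub (Jop a v q u n) (Cmul z (u n)) = f n) /\
    Cseries (fun n => Cmul (u n) (Cconj (g n))) w.

Definition lam0p (a v : R) : R := - sqrt (v ^ 2 + (a + 1) ^ 2).
Definition lam0m (a v : R) : R := sqrt (v ^ 2 + (a + 1) ^ 2).
Definition lam1m (a v : R) : R := - sqrt (v ^ 2 + (a - 1) ^ 2).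
Definition lam1p (a v : R) : R := sqrt (v ^ 2 + (a - 1) ^ 2).

Definition sigma_ac (a v : R) (z : Cx) : Prop :=
  snd z = 0 /\
  ((lam0p a v <= fst z <= lam1m a v) \/ (lam1p a v <= fst z <= lam0m a v)).

Definition band_interior (a v : R) (x : R) : Prop :=
  (lam0p a v < x < lam1m a v) \/ (lam1p a v < x < lam0m a v).

Definition band_edge (a v : R) (e : R) : Prop :=
  e = lam0p a v \/ e = lam1m a v \/ e = lam1p a v \/ e = lam0m a v.

Definition nonac (a v : R) (z : Cx) : Prop := ~ sigma_ac a v z.
Definition disc (c : Cx) (r : R) (z : Cx) : Prop := Cmod (Csub z c) < r.

(* (Fp, Fm) is the meromorphic continuation of <R(.) f, g> to the two-sheeted
   surface Lambda: Fp lives on the physical sheet Lambda_+, Fm on Lambda_-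
   (both copies of Cx \ sigma_ac), and across every interior band point the
   upper rim of one sheet continues analytically into the lower rim of the
   other sheet (crosswise gluing). *)
Definition ext_Lambda (a v : R) (q : nat -> R) (f g : nat -> Cx) (Fp Fm : Cx -> Cx) : Prop :=
  exists Sp Sm,
    merom_on (nonac a v) Fp Sp /\ merom_on (nonac a v) Fm Sm /\
    (forall z w, nonac a v z -> resolv_val a v q f g z w -> Fp z = w) /\
    (forall x, band_interior a v x -> exists r, 0 < r /\
       (exists H S1, merom_on (disc (x, 0) r) H S1 /\
          forall z, disc (x, 0) r z -> ~ S1 z ->
            (0 < snd z -> ~ Sp z -> H z = Fp z) /\
            (snd z < 0 -> ~ Sm z -> H z = Fm z)) /\
       (exists H S1, merom_on (disc (x, 0) r) H S1 /\
          forall z, disc (x, 0) r z -> ~ S1 z ->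
            (0 < snd z -> ~ Sm z -> H z = Fm z) /\
            (snd z < 0 -> ~ Sp z -> H z = Fp z))).

Definition resonance (a v : R) (q : nat -> R) (z0 : Cx) : Prop :=
  nonac a v z0 /\
  exists f g Fp Fm, fin_supp f /\ fin_supp g /\ ext_Lambda a v q f g Fp Fm /\
    forall M, exists delta, 0 < delta /\
      forall z, 0 < Cmod (Csub z z0) < delta -> M < Cmod (Fm z).

Definition virtual_state (a v : R) (q : nat -> R) (e : R) : Prop :=
  band_edge a v e /\
  exists f g, fin_supp f /\ fin_supp g /\
    forall M delta, 0 < delta -> exists z w,
      nonac a v z /\ Cmod (Csub z (e, 0)) < delta /\
      resolv_val a v q f g z w /\ M < Cmod w.

Definition state_proj (a v : R) (q : nat -> R) (z : Cx) : Prop :=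
  eigenvalue a v q z \/ resonance a v q z \/
  (snd z = 0 /\ virtual_state a v q (fst z)).

Definition qt (t : R) (p : nat) (q0 : nat -> R) (n : nat) : R :=
  if andb (Nat.leb 1 n) (Nat.leb n p) then t * q0 n else 0.

(* Main.v *)
(** For [n > p] the recurrence is periodic, so at a point [z] every solution that is square summable
    is, from site [p] on, a multiple of the Floquet solution with multiplier [m], where
    [a (m + 1/m) = z^2 - v^2 - 1 - a^2] and [|m| < 1]; the other root [1/m] describes the second
    sheet.  Continue this solution backwards to the value [psi_0] at site 0.  Every matrix element of
    the resolvent is a quotient [num / psi_0] of polynomials in [z] and [m], so a state [z] forces
    [psi_0 = 0], or at least that [psi_0] is not bounded away from 0 near [z].  The Floquet solution satisfies
    [(z - z_lim) psi_{p+1} = (a_p + a_{p+1} m) psi_p], with [z_lim = (-1)^p v] the diagonal coefficient at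
    site [p + 1]; away from [z_lim] this bounds [psi_{p+1}] by [psi_p], and the huge diagonal at the
    sites [1..p] then makes [|psi_j|] decrease in [j], so [|psi_0| >= |psi_p|] stays away from 0.

    A resonance is defined through an arbitrary continuation of the resolvent to the second sheet, so it
    has to be identified with [num / psi_0] by the identity theorem for complex differentiable
    functions.  Goursat's theorem on rectangles gives a Cauchy estimate; applied to
    [f(z) / (z - c)^n] for [f] vanishing near [c], it spreads the zeros of [f], and hence along
    segments. *)

(* Resonances and virtual states only assert that something is large near [z], so [psi_0] has to be
   bounded below on a neighbourhood of [z]. The bound must also hold on both sheets: the backward
   estimate asks of [m] only that it be bounded for bounded [z], which is true of both roots, so a
   single threshold for [t] serves every kind of state.

   [ext_Lambda] ties the continuation to the operator only at points of the resolvent set; a Neumann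
   series provides such points at large [|z|]. What is continued from there is not a quotient but
   the relation [psi_0 F = num], which has no singularities besides those of [F]. It has to pass
   through the cut once, and there the root of modulus below 1 must turn into the other root along a
   holomorphic branch; over a band that branch is singled out by the sign of its imaginary part
   instead of its modulus.

   The exceptional sets are merely locally finite and the functions are arbitrary on them. Zeros are
   therefore led around exceptional points, and the relation on the second sheet is obtained at
   points arbitrarily close to a resonance, not at the resonance itself. *)
Require Import Defs.
From Stdlib Require Import Reals Lra Lia List ClassicalEpsilon.
From Coquelicot Require Import Coquelicot.
Open Scope R_scope.

(** * Complex differentiability *)

Notation C := Complex.C.
Notation holo F z := (@ex_derive C_AbsRing (AbsRing_NormedModule C_AbsRing) F z).

Lemma Cminus_eq0 (x y : C) : (x - y)%C = 0 -> x = y.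
Proof. intros H. replace x with ((x - y) + y)%C by ring. rewrite H. ring. Qed.

(** Gives access to the sum, product and composition rules for [ex_derive]; the balls of the normed
    module used in [holo] are those of [Cmod]. *)
Lemma Cdiff_holo (F : C -> C) (z : C) : Cdiff F z <-> holo F z.
Proof.
  unfold Cdiff.
  change Defs.Cmod with Cmod; change Csub with Cminus; change Cadd with Cplus;
    change Cmul with Cmult.
  split.
  - intros [L HL]. exists L. split.
    + apply is_linear_scal_l.
    + intros x Hx.
      apply (@is_filter_lim_locally_unique C_AbsRing (AbsRing_NormedModule C_AbsRing)) in Hx.
      subst x.
      intros eps. destruct (HL eps (cond_pos eps)) as [d [Hd H]].
      exists (mkposreal d Hd). intros y Hy.
      change (Cmod (Cminus y z) < d) in Hy.
      change (Cmod (F y - F z - (y - z) * L)%C <= eps * Cmod (y - z)%C).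
      revert y Hy. change (forall y : C, Cmod (y - z) < d ->
        Cmod (F y - F z - (y - z) * L)%C <= eps * Cmod (y - z)%C). intros y Hy.
      destruct (Req_dec (Cmod (y - z)) 0) as [E|E].
      * apply Cmod_eq_0, Cminus_eq0 in E. subst y.
        replace (F z - F z - (z - z) * L)%C with (RtoC 0) by ring.
        replace (z - z)%C with (RtoC 0) by ring. rewrite Cmod_0. lra.
      * assert (H0 := Cmod_ge_0 (y - z)).
        specialize (H (y - z)%C). replace (z + (y - z))%C with y in H by ring.
        rewrite (Cmult_comm (y - z)). apply H. split; [lra|exact Hy].
  - intros [L [_ HL]]. exists L. intros eps He.
    destruct (HL z (fun P H => H) (mkposreal eps He)) as [d H].
    exists d. split; [apply cond_pos|]. refine (fun (h : C) Hh => _). destruct Hh as [Hh1 Hh2].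
    specialize (H (z + h)%C).
    change (Cmod (z + h - z)%C < d ->
      Cmod (F (z + h) - F z - (z + h - z) * L)%C <= eps * Cmod (z + h - z)%C) in H.
    replace (z + h - z)%C with h in H by ring.
    rewrite (Cmult_comm L). apply H, Hh2.
Qed.

Lemma holo_plus (f g : C -> C) z : holo f z -> holo g z -> holo (fun x => f x + g x)%C z.
Proof. intros [a Ha] [b Hb]. exists (a + b)%C. exact (is_derive_plus (K := C_AbsRing) (V := AbsRing_NormedModule C_AbsRing) f g z a b Ha Hb). Qed.
Lemma holo_mult (f g : C -> C) z : holo f z -> holo g z -> holo (fun x => f x * g x)%C z.
Proof. intros [a Ha] [b Hb]. eexists. exact (is_derive_mult (K := C_AbsRing) f g z a b Ha Hb Cmult_comm). Qed.
Lemma holo_const c z : holo (fun _ => c) z.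
Proof. eexists. exact (is_derive_const (K := C_AbsRing) (V := AbsRing_NormedModule C_AbsRing) c z). Qed.
Lemma holo_id z : holo (fun x => x) z.
Proof. eexists. exact (is_derive_id (K := C_AbsRing) z). Qed.

Lemma holo_ext_near (f g : C -> C) z d : 0 < d ->
  (forall w, Cmod (w - z) < d -> f w = g w) -> holo f z -> holo g z.
Proof.
  intros Hd H. apply ex_derive_ext_loc. exists (mkposreal d Hd). intros y Hy. apply H, Hy.
Qed.

Definition cont (f : C -> C) (z : C) : Prop :=
  forall eps, 0 < eps -> exists d, 0 < d /\
    forall w, Cmod (w - z) < d -> Cmod (f w - f z) < eps.

Lemma holo_cont f z : holo f z -> cont f z.
Proof.
  intros H eps He. apply ex_derive_continuous in H.
  specialize (H (fun y : C => Cmod (y - f z) < eps)).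
  destruct H as [d Hd].
  - exists (mkposreal eps He). intros y Hy. exact Hy.
  - exists d. split; [apply cond_pos|]. intros w Hw. apply Hd, Hw.
Qed.

Lemma cont_plus f g z : cont f z -> cont g z -> cont (fun x => f x + g x)%C z.
Proof.
  intros Hf Hg e He. destruct (Hf (e/2)) as [d1 [P1 H1]]; [lra|].
  destruct (Hg (e/2)) as [d2 [P2 H2]]; [lra|].
  exists (Rmin d1 d2). split; [now apply Rmin_pos|]. intros w Hw.
  specialize (H1 w (Rlt_le_trans _ _ _ Hw (Rmin_l _ _))).
  specialize (H2 w (Rlt_le_trans _ _ _ Hw (Rmin_r _ _))).
  replace (f w + g w - (f z + g z))%C with ((f w - f z) + (g w - g z))%C by ring.
  eapply Rle_lt_trans; [apply Cmod_triangle|lra].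
Qed.

Lemma holo_inv (z : C) : z <> 0 -> holo (fun x => / x)%C z.
Proof.
  intros Hz. apply Cdiff_holo. exists (- / (z * z))%C.
  change Defs.Cmod with Cmod; change Csub with Cminus; change Cadd with Cplus;
    change Cmul with Cmult.
  assert (Hm : 0 < Cmod z) by now apply Cmod_gt_0.
  intros eps He. set (m := Cmod z) in *.
  (* The remainder of the inverse is [h^2 / (z^2 (z + h))]. The first bound gives [|z + h| >= m/2],
     the second then makes [|h| / (m^2 |z + h|)] at most [eps]. *)
  exists (Rmin (m/2) (eps * (m * m * m) / 2)).
  assert (0 < m*m*m) by (repeat apply Rmult_lt_0_compat; lra).
  split. { apply Rmin_pos; [lra|]. assert (0 < eps * (m*m*m)) by now apply Rmult_lt_0_compat. lra. }
  refine (fun (h : C) Hh => _). destruct Hh as [Hh1 Hh2].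
  assert (Ha : Cmod h < m/2) by (eapply Rlt_le_trans; [exact Hh2|apply Rmin_l]).
  assert (Hb : Cmod h < eps * (m*m*m)/2) by (eapply Rlt_le_trans; [exact Hh2|apply Rmin_r]).
  assert (Hs : m/2 <= Cmod (z + h)).
  { assert (T := Cmod_triangle (z + h) (- h)).
    replace (z + h + - h)%C with z in T by ring. rewrite Cmod_opp in T. fold m in T. lra. }
  assert (Hn : (z + h)%C <> 0) by (apply Cmod_gt_0; lra).
  replace (/ (z + h) - / z - - / (z * z) * h)%C with (h * h / (z * z * (z + h)))%C
    by (field; auto).
  rewrite Cmod_div. 2:{ repeat apply Cmult_neq_0; auto. }
  rewrite !Cmod_mult. fold m.
  apply Rle_div_l. { repeat apply Rmult_lt_0_compat; lra. }
  apply Rle_trans with (Cmod h * (eps * (m*m*m)/2)).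
  { apply Rmult_le_compat_l; lra. }
  replace (eps * Cmod h * (m * m * Cmod (z + h))) with (Cmod h * (eps * (m * m * Cmod (z+h)))) by ring.
  apply Rmult_le_compat_l; [lra|].
  replace (eps * (m*m*m)/2) with (eps * (m * m * (m/2))) by field.
  apply Rmult_le_compat_l; [lra|]. apply Rmult_le_compat_l; [nra|lra].
Qed.

(** * Integrals over the boundary of a rectangle *)

Definition cint (g : R -> C) (a b : R) : C :=
  (RInt (fun x => fst (g x)) a b, RInt (fun x => snd (g x)) a b).

Definition integrable (g : R -> C) (a b : R) : Prop :=
  ex_RInt (fun x => fst (g x)) a b /\ ex_RInt (fun x => snd (g x)) a b.

Lemma Cext (x y : C) : fst x = fst y -> snd x = snd y -> x = y.
Proof. destruct x, y; simpl; congruence. Qed.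

Lemma cint_plus g h a b : integrable g a b -> integrable h a b ->
  cint (fun x => g x + h x)%C a b = (cint g a b + cint h a b)%C.
Proof.
  intros [G1 G2] [H1 H2]. apply Cext.
  - exact (RInt_plus (fun x => fst (g x)) (fun x => fst (h x)) a b G1 H1).
  - exact (RInt_plus (fun x => snd (g x)) (fun x => snd (h x)) a b G2 H2).
Qed.

Lemma cint_ext g h a b : a <= b -> (forall x, a <= x <= b -> g x = h x) -> cint g a b = cint h a b.
Proof.
  intros Hab H. unfold cint. f_equal; apply RInt_ext; rewrite Rmin_left, Rmax_right by lra;
  intros x Hx; rewrite H; auto; lra.
Qed.

Lemma cint_const c a b : cint (fun _ => c) a b = (RtoC (b - a) * c)%C.
Proof.
  unfold cint. rewrite !RInt_const. apply Cext; simpl; unfold scal; simpl; unfold mult; simpl; ring.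
Qed.

Lemma cint_Chasles g a b c : integrable g a b -> integrable g b c ->
  cint g a c = (cint g a b + cint g b c)%C.
Proof.
  intros [G1 G2] [H1 H2]. symmetry. apply Cext.
  - exact (RInt_Chasles _ a b c G1 H1).
  - exact (RInt_Chasles _ a b c G2 H2).
Qed.

Lemma Cmod_le_sum (z : C) : Cmod z <= Rabs (fst z) + Rabs (snd z).
Proof.
  assert (H1 := Rabs_pos (fst z)). assert (H2 := Rabs_pos (snd z)).
  unfold Cmod. rewrite <- (sqrt_Rsqr (Rabs (fst z) + Rabs (snd z))) by lra.
  apply sqrt_le_1_alt. unfold Rsqr. rewrite <- (pow2_abs (fst z)), <- (pow2_abs (snd z)). nra.
Qed.

Lemma fst_le_Cmod (z : C) : Rabs (fst z) <= Cmod z.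
Proof. eapply Rle_trans; [apply Rmax_l|apply Rmax_Cmod]. Qed.
Lemma snd_le_Cmod (z : C) : Rabs (snd z) <= Cmod z.
Proof. eapply Rle_trans; [apply Rmax_r|apply Rmax_Cmod]. Qed.

(** The factor 2 comes from estimating real and imaginary parts separately. It is harmless:
    Goursat's argument has an arbitrary [eps] to absorb it, and the Cauchy estimate may have any
    constant. *)
Lemma cint_bound g a b M : a <= b -> integrable g a b ->
  (forall x, a <= x <= b -> Cmod (g x) <= M) -> Cmod (cint g a b) <= 2 * (b - a) * M.
Proof.
  intros Hab [G1 G2] H.
  assert (A1 : Rabs (RInt (fun x => fst (g x)) a b) <= (b - a) * M).
  { apply abs_RInt_le_const; auto. intros x Hx.
    eapply Rle_trans; [apply fst_le_Cmod|auto]. }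
  assert (A2 : Rabs (RInt (fun x => snd (g x)) a b) <= (b - a) * M).
  { apply abs_RInt_le_const; auto. intros x Hx.
    eapply Rle_trans; [apply snd_le_Cmod|auto]. }
  eapply Rle_trans; [apply Cmod_le_sum|]. unfold cint; simpl. lra.
Qed.

Definition rcont (g : R -> C) (x : R) : Prop :=
  forall eps, 0 < eps -> exists d, 0 < d /\
    forall y, Rabs (y - x) < d -> Cmod (g y - g x) < eps.

Lemma rcont_integrable g a b : a <= b -> (forall x, a <= x <= b -> rcont g x) -> integrable g a b.
Proof.
  intros Hab H.
  split; apply (@ex_RInt_continuous R_CompleteNormedModule);
    rewrite Rmin_left, Rmax_right by lra; intros x Hx P [e He];
    destruct (H x Hx e (cond_pos e)) as [d [Hd Hw]];
    exists (mkposreal d Hd); intros y Hy; apply He; specialize (Hw y Hy).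
  - eapply Rle_lt_trans; [apply (fst_le_Cmod (g y - g x))|exact Hw].
  - eapply Rle_lt_trans; [apply (snd_le_Cmod (g y - g x))|exact Hw].
Qed.

Lemma Cmod_horizontal x x' y : Cmod ((x', y) - (x, y)) = Rabs (x' - x).
Proof.
  replace ((x', y) - (x, y))%C with (RtoC (x' - x)) by (apply Cext; simpl; ring).
  apply Cmod_R.
Qed.
Lemma Cmod_vertical x y y' : Cmod ((x, y') - (x, y)) = Rabs (y' - y).
Proof.
  replace ((x, y') - (x, y))%C with (Ci * RtoC (y' - y))%C by (apply Cext; simpl; ring).
  rewrite Cmod_mult, Cmod_Ci, Cmod_R. ring.
Qed.

Lemma rcont_h c f x y : cont f (x, y) -> rcont (fun t => c * f (t, y))%C x.
Proof.
  intros H e He. assert (Hc := Cmod_ge_0 c).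
  destruct (H (e / (Cmod c + 1))) as [d [Hd Hw]]; [apply Rdiv_lt_0_compat; lra|].
  exists d. split; auto. intros t Ht. replace (c * f (t, y) - c * f (x, y))%C with (c * (f (t,y) - f (x,y)))%C by ring.
  rewrite Cmod_mult. rewrite <- (Cmod_horizontal x t y) in Ht. apply Hw in Ht.
  apply Rlt_div_r in Ht; [|lra]. assert (T := Cmod_ge_0 (f (t,y) - f (x,y))). nra.
Qed.
Lemma rcont_v c f x y : cont f (x, y) -> rcont (fun t => c * f (x, t))%C y.
Proof.
  intros H e He. assert (Hc := Cmod_ge_0 c).
  destruct (H (e / (Cmod c + 1))) as [d [Hd Hw]]; [apply Rdiv_lt_0_compat; lra|].
  exists d. split; auto. intros t Ht. replace (c * f (x, t) - c * f (x, y))%C with (c * (f (x,t) - f (x,y)))%C by ring.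
  rewrite Cmod_mult. rewrite <- (Cmod_vertical x y t) in Ht. apply Hw in Ht.
  apply Rlt_div_r in Ht; [|lra]. assert (T := Cmod_ge_0 (f (x,t) - f (x,y))). nra.
Qed.

(** On a horizontal side [dz] is [1 dx], on a vertical one [Ci dy]; writing the factor 1 gives both
    kinds of side the same form. *)
Definition hint (f : C -> C) (y x1 x2 : R) : C := cint (fun x => 1 * f (x, y))%C x1 x2.
Definition vint (f : C -> C) (x y1 y2 : R) : C := cint (fun y => Ci * f (x, y))%C y1 y2.

Definition rint (f : C -> C) (x1 x2 y1 y2 : R) : C :=
  (hint f y1 x1 x2 + vint f x2 y1 y2 - hint f y2 x1 x2 - vint f x1 y1 y2)%C.

Definition rcl (x1 x2 y1 y2 : R) (z : C) : Prop := x1 <= fst z <= x2 /\ y1 <= snd z <= y2.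

Definition rbd (x1 x2 y1 y2 : R) (z : C) : Prop :=
  rcl x1 x2 y1 y2 z /\ (fst z = x1 \/ fst z = x2 \/ snd z = y1 \/ snd z = y2).

Ltac in_rect := (split; [split; simpl; lra|simpl; tauto]) || (split; simpl; lra).

Lemma hint_ok f y x1 x2 : x1 <= x2 -> (forall x, x1 <= x <= x2 -> cont f (x, y)) ->
  integrable (fun x => 1 * f (x, y))%C x1 x2.
Proof. intros H1 H. apply rcont_integrable; auto. intros. now apply rcont_h, H. Qed.
Lemma vint_ok f x y1 y2 : y1 <= y2 -> (forall y, y1 <= y <= y2 -> cont f (x, y)) ->
  integrable (fun y => Ci * f (x, y))%C y1 y2.
Proof. intros H1 H. apply rcont_integrable; auto. intros. now apply rcont_v, H. Qed.

Lemma rint_split_x f x1 x x2 y1 y2 : x1 <= x <= x2 -> y1 <= y2 ->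
  (forall z, rcl x1 x2 y1 y2 z -> cont f z) ->
  rint f x1 x2 y1 y2 = (rint f x1 x y1 y2 + rint f x x2 y1 y2)%C.
Proof.
  intros Hx Hy Hc. unfold rint, hint.
  rewrite (cint_Chasles (fun t => 1 * f (t, y1))%C x1 x x2), (cint_Chasles (fun t => 1 * f (t, y2))%C x1 x x2).
  - ring.
  - apply hint_ok; [lra|]; intros; apply Hc; split; simpl; lra.
  - apply hint_ok; [lra|]; intros; apply Hc; split; simpl; lra.
  - apply hint_ok; [lra|]; intros; apply Hc; split; simpl; lra.
  - apply hint_ok; [lra|]; intros; apply Hc; split; simpl; lra.
Qed.

Lemma rint_split_y f x1 x2 y1 y y2 : x1 <= x2 -> y1 <= y <= y2 ->
  (forall z, rcl x1 x2 y1 y2 z -> cont f z) ->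
  rint f x1 x2 y1 y2 = (rint f x1 x2 y1 y + rint f x1 x2 y y2)%C.
Proof.
  intros Hx Hy Hc. unfold rint, vint.
  rewrite (cint_Chasles (fun t => Ci * f (x1, t))%C y1 y y2), (cint_Chasles (fun t => Ci * f (x2, t))%C y1 y y2).
  - ring.
  - apply vint_ok; [lra|]; intros; apply Hc; split; simpl; lra.
  - apply vint_ok; [lra|]; intros; apply Hc; split; simpl; lra.
  - apply vint_ok; [lra|]; intros; apply Hc; split; simpl; lra.
  - apply vint_ok; [lra|]; intros; apply Hc; split; simpl; lra.
Qed.

Lemma rint_bound f x1 x2 y1 y2 M : x1 <= x2 -> y1 <= y2 ->
  (forall z, rbd x1 x2 y1 y2 z -> cont f z) ->
  (forall z, rbd x1 x2 y1 y2 z -> Cmod (f z) <= M) ->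
  Cmod (rint f x1 x2 y1 y2) <= 4 * (x2 - x1 + (y2 - y1)) * M.
Proof.
  intros Hx Hy Hc HM.
  assert (Hh : forall y, y = y1 \/ y = y2 -> Cmod (hint f y x1 x2) <= 2 * (x2 - x1) * M).
  { intros y Hyy. apply cint_bound; auto.
    - apply hint_ok; auto. intros; apply Hc; in_rect.
    - intros x Hxx. rewrite Cmult_1_l. apply HM; in_rect. }
  assert (Hv : forall x, x = x1 \/ x = x2 -> Cmod (vint f x y1 y2) <= 2 * (y2 - y1) * M).
  { intros x Hxx. apply cint_bound; auto.
    - apply vint_ok; auto. intros; apply Hc; in_rect.
    - intros y Hyy. rewrite Cmod_mult, Cmod_Ci, Rmult_1_l. apply HM; in_rect. }
  assert (A1 := Hh y1 (or_introl eq_refl)). assert (A2 := Hh y2 (or_intror eq_refl)).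
  assert (A3 := Hv x1 (or_introl eq_refl)). assert (A4 := Hv x2 (or_intror eq_refl)).
  unfold rint, Cminus.
  eapply Rle_trans; [apply Cmod_triangle|]. rewrite Cmod_opp.
  assert (T1 := Cmod_triangle (hint f y1 x1 x2 + vint f x2 y1 y2) (- hint f y2 x1 x2)).
  rewrite Cmod_opp in T1.
  assert (T2 := Cmod_triangle (hint f y1 x1 x2) (vint f x2 y1 y2)). lra.
Qed.

Lemma rint_plus f g x1 x2 y1 y2 : x1 <= x2 -> y1 <= y2 ->
  (forall z, rbd x1 x2 y1 y2 z -> cont f z) -> (forall z, rbd x1 x2 y1 y2 z -> cont g z) ->
  rint (fun z => f z + g z)%C x1 x2 y1 y2 = (rint f x1 x2 y1 y2 + rint g x1 x2 y1 y2)%C.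
Proof.
  intros Hx Hy Hf Hg.
  assert (Hh : forall y, y = y1 \/ y = y2 -> hint (fun z => f z + g z)%C y x1 x2 = (hint f y x1 x2 + hint g y x1 x2)%C).
  { intros y Hyy. unfold hint. rewrite <- cint_plus.
    - apply cint_ext; auto. intros. ring.
    - apply hint_ok; auto. intros; apply Hf; in_rect.
    - apply hint_ok; auto. intros; apply Hg; in_rect. }
  assert (Hv : forall x, x = x1 \/ x = x2 -> vint (fun z => f z + g z)%C x y1 y2 = (vint f x y1 y2 + vint g x y1 y2)%C).
  { intros x Hxx. unfold vint. rewrite <- cint_plus.
    - apply cint_ext; auto. intros. ring.
    - apply vint_ok; auto. intros; apply Hf; in_rect.
    - apply vint_ok; auto. intros; apply Hg; in_rect. }
  unfold rint. rewrite !Hh, !Hv by auto. ring.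
Qed.

Lemma holo_affine al be z : holo (fun z => al + be * z)%C z.
Proof. apply holo_plus; [apply holo_const|apply holo_mult; [apply holo_const|apply holo_id]]. Qed.

(** On two opposite sides an affine function differs by a constant, so each pair of sides
    contributes [be * Ci] times the area, with opposite signs. *)
Lemma rint_affine al be x1 x2 y1 y2 : x1 <= x2 -> y1 <= y2 ->
  rint (fun z => al + be * z)%C x1 x2 y1 y2 = 0.
Proof.
  intros Hx Hy. set (f := fun z : C => (al + be * z)%C).
  assert (Hc : forall z, cont f z) by (intros z; apply holo_cont, holo_affine).
  assert (H1 : hint f y1 x1 x2 = (hint f y2 x1 x2 + RtoC (x2 - x1) * (be * (Ci * RtoC (y1 - y2))))%C).
  { unfold hint. rewrite <- cint_const, <- cint_plus.
    - apply cint_ext; auto. intros x _. unfold f. apply Cext; simpl; ring.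
    - apply hint_ok; auto.
    - split; apply ex_RInt_const. }
  assert (H2 : vint f x2 y1 y2 = (vint f x1 y1 y2 + RtoC (y2 - y1) * (Ci * (be * RtoC (x2 - x1))))%C).
  { unfold vint. rewrite <- cint_const, <- cint_plus.
    - apply cint_ext; auto. intros x _. unfold f. apply Cext; simpl; ring.
    - apply vint_ok; auto.
    - split; apply ex_RInt_const. }
  unfold rint. rewrite H1, H2. rewrite !RtoC_minus. ring.
Qed.

Lemma nested_point (x l : nat -> R) : (forall n, 0 <= l n) ->
  (forall n, x n <= x (S n) /\ x (S n) + l (S n) <= x n + l n) ->
  exists c, forall n, x n <= c <= x n + l n.
Proof.
  intros Hl H.
  assert (A : forall n k, x n <= x (n + k)%nat /\ x (n + k)%nat + l (n + k)%nat <= x n + l n).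
  { intros n k. induction k as [|k IH].
    - rewrite Nat.add_0_r. lra.
    - rewrite Nat.add_succ_r. specialize (H (n + k)%nat). lra. }
  assert (B : forall n m, x m <= x n + l n).
  { intros n m. destruct (Nat.le_ge_cases n m) as [L|L].
    - replace m with (n + (m - n))%nat by lia. specialize (A n (m - n)%nat). specialize (Hl (n + (m-n))%nat). lra.
    - replace n with (m + (n - m))%nat by lia. specialize (A m (n - m)%nat). specialize (Hl (m + (n-m))%nat). lra. }
  destruct (completeness (fun t => exists n, t = x n)) as [c [U L]].
  - exists (x 0%nat + l 0%nat). intros t [n ->]. apply B.
  - exists (x 0%nat), 0%nat. reflexivity.
  - exists c. intros n. split; [apply U; now exists n|].
    apply L. intros t [m ->]. apply B.
Qed.

(** Quartering divides both the integral and the square of the half perimeter [w + h] by four. So if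
    the integral exceeds [eps * (w + h) ^ 2], the corresponding excess survives in some quarter, and
    in a nested sequence of rectangles shrinking to a point; there [f] is affine up to an error that
    is too small for the excess. *)
Lemma Goursat f x1 x2 y1 y2 : x1 <= x2 -> y1 <= y2 ->
  (forall z, rcl x1 x2 y1 y2 z -> holo f z) -> rint f x1 x2 y1 y2 = 0.
Proof.
  intros Hx Hy Hf.
  set (w := x2 - x1). set (h := y2 - y1).
  set (sz := fun n => (w + h) / 2 ^ n).
  assert (P2 : forall n, 0 < 2 ^ n) by (intros; apply pow_lt; lra).
  assert (Small : forall eps, 0 < eps -> Cmod (rint f x1 x2 y1 y2) <= eps * (w + h) ^ 2).
  2:{ apply Cmod_eq_0. apply Rle_antisym; [|apply Cmod_ge_0].
      apply Rnot_lt_le. intros Hp. assert (Hw : 0 <= (w + h)^2) by apply pow2_ge_0.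
      specialize (Small (Cmod (rint f x1 x2 y1 y2) / (2 * ((w+h)^2 + 1)))).
      assert (S1 : 0 < Cmod (rint f x1 x2 y1 y2) / (2 * ((w+h)^2 + 1))) by (apply Rdiv_lt_0_compat; lra).
      specialize (Small S1).
      set (I := Cmod (rint f x1 x2 y1 y2)) in *. set (q := (w+h)^2) in *.
      assert (E : I = I / (2 * (q + 1)) * (2 * (q + 1))) by (field; lra).
      set (k := I / (2 * (q + 1))) in *. assert (0 <= k * q) by (apply Rmult_le_pos; lra). lra. }
  intros eps He. apply Rnot_lt_le. intros Hbad.
  set (wn := fun n => w / 2 ^ n). set (hn := fun n => h / 2 ^ n).
  assert (Hw0 : forall n, 0 <= wn n) by (intros n; apply Rdiv_le_0_compat; [unfold w; lra|auto]).
  assert (Hh0 : forall n, 0 <= hn n) by (intros n; apply Rdiv_le_0_compat; [unfold h; lra|auto]).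
  assert (Hws : forall n, wn n = 2 * wn (S n)).
  { intros n. unfold wn. simpl. specialize (P2 n). field. lra. }
  assert (Hhs : forall n, hn n = 2 * hn (S n)).
  { intros n. unfold hn. simpl. specialize (P2 n). field. lra. }
  set (bad := fun n (c : C) =>
    (x1 <= fst c /\ fst c + wn n <= x2) /\ (y1 <= snd c /\ snd c + hn n <= y2) /\
    eps * (wn n + hn n) ^ 2 < Cmod (rint f (fst c) (fst c + wn n) (snd c) (snd c + hn n))).
  set (next := fun n (c c' : C) => bad (S n) c' /\
     (fst c <= fst c' /\ fst c' + wn (S n) <= fst c + wn n) /\
     (snd c <= snd c' /\ snd c' + hn (S n) <= snd c + hn n)).
  (* The existential stands outside the implication so that a choice function defined on all corners
     can be extracted. *)
  assert (Step : forall n c, exists c', bad n c -> next n c c').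
  { intros n [x y]. destruct (classic (exists c', next n (x, y) c')) as [[c' H]|H].
    { now exists c'. }
    exists (x, y). intros [[B1 B2] [[B3 B4] B5]]. exfalso. simpl in *.
    specialize (Hw0 (S n)) as W. specialize (Hh0 (S n)) as V.
    rewrite (Hws n), (Hhs n) in *.
    set (w' := wn (S n)) in *. set (h' := hn (S n)) in *.
    assert (Hcont : forall z, rcl x (x + 2 * w') y (y + 2 * h') z -> cont f z).
    { intros z [Z1 Z2]. apply holo_cont, Hf. split; lra. }
    assert (Q : forall x' y', (x' = x \/ x' = x + w') -> (y' = y \/ y' = y + h') ->
      Cmod (rint f x' (x' + w') y' (y' + h')) <= eps * (w' + h') ^ 2).
    { intros x' y' E1 E2. apply Rnot_lt_le. intros L. apply H. exists (x', y').
      unfold next, bad; simpl. fold w' h'. rewrite (Hws n), (Hhs n). fold w' h'.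
      repeat split; try (destruct E1; destruct E2; lra). }
    rewrite (rint_split_x f x (x + w')) in B5 by first [assumption | lra].
    rewrite (rint_split_y f x (x + w') y (y + h')) in B5.
    2: lra. 2: lra. 2:{ intros z [Z1 Z2]. apply Hcont. split; lra. }
    rewrite (rint_split_y f (x + w') (x + 2 * w') y (y + h')) in B5.
    2: lra. 2: lra. 2:{ intros z [Z1 Z2]. apply Hcont. split; lra. }
    replace (x + 2 * w') with (x + w' + w') in B5 by ring.
    replace (y + 2 * h') with (y + h' + h') in B5 by ring.
    assert (Q1 := Q x y (or_introl eq_refl) (or_introl eq_refl)).
    assert (Q2 := Q x (y + h') (or_introl eq_refl) (or_intror eq_refl)).
    assert (Q3 := Q (x + w') y (or_intror eq_refl) (or_introl eq_refl)).
    assert (Q4 := Q (x + w') (y + h') (or_intror eq_refl) (or_intror eq_refl)).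
    set (I1 := rint f x (x + w') y (y + h')) in *.
    set (I2 := rint f x (x + w') (y + h') (y + h' + h')) in *.
    set (I3 := rint f (x + w') (x + w' + w') y (y + h')) in *.
    set (I4 := rint f (x + w') (x + w' + w') (y + h') (y + h' + h')) in *.
    assert (T0 := Cmod_triangle (I1 + I2) (I3 + I4)).
    assert (T1 := Cmod_triangle I1 I2). assert (T2 := Cmod_triangle I3 I4). nra. }
  set (nx := fun n c => proj1_sig (constructive_indefinite_description _ (Step n c))).
  set (c := fix c n := match n with O => (x1, y1) | S m => nx m (c m) end).
  assert (HB : forall n, bad n (c n)).
  { induction n as [|n IH].
    - unfold bad. simpl. unfold wn, hn. simpl. rewrite !Rdiv_1_r. unfold w, h.
      replace (x1 + (x2 - x1)) with x2 by ring. replace (y1 + (y2 - y1)) with y2 by ring.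
      repeat split; try lra. exact Hbad.
    - simpl. unfold nx. destruct (constructive_indefinite_description _ (Step n (c n))) as [c' Hc]. simpl.
      now apply Hc. }
  assert (HN : forall n, next n (c n) (c (S n))).
  { intros n. simpl. unfold nx. destruct (constructive_indefinite_description _ (Step n (c n))) as [c' Hc]. simpl.
    now apply Hc. }
  destruct (nested_point (fun n => fst (c n)) wn Hw0) as [px Hpx]. { intros n. apply HN. }
  destruct (nested_point (fun n => snd (c n)) hn Hh0) as [py Hpy]. { intros n. apply HN. }
  set (p := (px, py) : C).
  assert (Hp : holo f p).
  { apply Hf. destruct (HB 0%nat) as [? [? _]]. specialize (Hpx 0%nat). specialize (Hpy 0%nat).
    split; simpl; lra. }
  apply Cdiff_holo in Hp. destruct Hp as [L HL].
  change Defs.Cmod with Cmod in HL; change Csub with Cminus in HL; change Cadd with Cplus in HL;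
    change Cmul with Cmult in HL.
  (* [rint_bound] contributes the factor [4 * (W + H)], so the integral over the small rectangle is
     at most half of [eps * (W + H) ^ 2]. *)
  destruct (HL (eps / 8)) as [d [Hd HL']]; [lra|]. clear HL.
  assert (Hlim : exists n, sz n < d).
  { destruct (pow_lt_1_zero (/2)) with (y := d / (w + h + 1)) as [n Hn].
    - rewrite Rabs_pos_eq; lra.
    - apply Rdiv_lt_0_compat; [lra|unfold w, h; lra].
    - exists n. specialize (Hn n (le_n n)). rewrite Rabs_pos_eq in Hn by (apply pow_le; lra).
      rewrite pow_inv in Hn. apply Rlt_div_r in Hn; [|unfold w, h; lra].
      unfold sz, Rdiv. assert (0 < / 2 ^ n) by (apply Rinv_0_lt_compat; auto). nra. }
  destruct Hlim as [n Hn].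
  destruct (HB n) as [[B1 B2] [[B3 B4] B5]].
  specialize (Hpx n). specialize (Hpy n). simpl in Hpx, Hpy.
  set (x := fst (c n)) in *. set (y := snd (c n)) in *.
  assert (Esz : sz n = wn n + hn n) by (unfold sz, wn, hn; field; specialize (P2 n); lra).
  specialize (Hw0 n). specialize (Hh0 n).
  set (W := wn n) in *. set (H := hn n) in *.
  assert (Hdist : forall z, rcl x (x + W) y (y + H) z -> Cmod (z - p) <= W + H).
  { intros z [Z1 Z2]. eapply Rle_trans; [apply Cmod_le_sum|]. simpl.
    apply Rplus_le_compat; apply Rabs_le; lra. }
  assert (Herr : forall z, rcl x (x + W) y (y + H) z ->
     Cmod (f z - (f p + L * (z - p))) <= eps / 8 * (W + H)).
  { intros z Hz. specialize (Hdist z Hz).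
    destruct (Req_dec (Cmod (z - p)) 0) as [E|E].
    - apply Cmod_eq_0, Cminus_eq0 in E. subst z.
      replace (f p - (f p + L * (p - p)))%C with (RtoC 0) by ring. rewrite Cmod_0. nra.
    - assert (T := Cmod_ge_0 (z - p)).
      specialize (HL' (z - p)%C). replace (p + (z - p))%C with z in HL' by ring.
      replace (f z - (f p + L * (z - p)))%C with (f z - f p - L * (z - p))%C by ring.
      eapply Rle_trans; [apply HL'; lra|]. apply Rmult_le_compat_l; lra. }
  assert (Hh : forall z, rcl x (x + W) y (y + H) z -> holo f z).
  { intros z [Z1 Z2]. apply Hf. split; lra. }
  (* [al + be * z] is minus the affine approximation of [f] at [p]; adding it leaves the integral
     unchanged. *)
  set (al := (- (f p - L * p))%C). set (be := (- L)%C).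
  assert (Hsum : rint f x (x + W) y (y + H) = rint (fun z => f z + (al + be * z))%C x (x + W) y (y + H)).
  { rewrite rint_plus; [|lra|lra| |].
    - rewrite rint_affine by lra. ring.
    - intros z [Hz _]. now apply holo_cont, Hh.
    - intros z _. apply holo_cont, holo_affine. }
  assert (Hb : Cmod (rint f x (x + W) y (y + H)) <= 4 * ((x + W) - x + ((y + H) - y)) * (eps / 8 * (W + H))).
  { rewrite Hsum. apply rint_bound; [lra|lra| |].
    - intros z [Hz _]. apply cont_plus; [now apply holo_cont, Hh|apply holo_cont, holo_affine].
    - intros z [Hz _]. replace (f z + (al + be * z))%C with (f z - (f p + L * (z - p)))%C; [now apply Herr|].
      unfold al, be. ring. }
  assert (0 <= eps * (W + H) ^ 2) by (apply Rmult_le_pos; nra).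
  nra.
Qed.

(** * Cauchy's estimate on a square *)

Lemma cint_scal c g a b : integrable g a b -> cint (fun x => c * g x)%C a b = (c * cint g a b)%C.
Proof.
  intros [G1 G2]. apply Cext; simpl.
  - etransitivity.
    + exact (RInt_minus (fun x => scal (fst c) (fst (g x))) (fun x => scal (snd c) (snd (g x))) a b
        (ex_RInt_scal _ _ _ _ G1) (ex_RInt_scal _ _ _ _ G2)).
    + exact (f_equal2 Rminus (RInt_scal (V := R_CompleteNormedModule) _ a b (fst c) G1)
        (RInt_scal (V := R_CompleteNormedModule) _ a b (snd c) G2)).
  - etransitivity.
    + exact (RInt_plus (fun x => scal (fst c) (snd (g x))) (fun x => scal (snd c) (fst (g x))) a b
        (ex_RInt_scal _ _ _ _ G2) (ex_RInt_scal _ _ _ _ G1)).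
    + exact (f_equal2 Rplus (RInt_scal (V := R_CompleteNormedModule) _ a b (fst c) G2)
        (RInt_scal (V := R_CompleteNormedModule) _ a b (snd c) G1)).
Qed.

Lemma rint_scal c f x1 x2 y1 y2 : x1 <= x2 -> y1 <= y2 ->
  (forall z, rbd x1 x2 y1 y2 z -> cont f z) ->
  rint (fun z => c * f z)%C x1 x2 y1 y2 = (c * rint f x1 x2 y1 y2)%C.
Proof.
  intros Hx Hy Hf.
  assert (Hh : forall y, y = y1 \/ y = y2 -> hint (fun z => c * f z)%C y x1 x2 = (c * hint f y x1 x2)%C).
  { intros y Hyy. unfold hint. rewrite <- cint_scal.
    - apply cint_ext; auto. intros. ring.
    - apply hint_ok; auto. intros; apply Hf; in_rect. }
  assert (Hv : forall x, x = x1 \/ x = x2 -> vint (fun z => c * f z)%C x y1 y2 = (c * vint f x y1 y2)%C).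
  { intros x Hxx. unfold vint. rewrite <- cint_scal.
    - apply cint_ext; auto. intros. ring.
    - apply vint_ok; auto. intros; apply Hf; in_rect. }
  unfold rint. rewrite !Hh, !Hv by auto. ring.
Qed.

Lemma rint_ext f g x1 x2 y1 y2 : x1 <= x2 -> y1 <= y2 ->
  (forall z, rbd x1 x2 y1 y2 z -> f z = g z) -> rint f x1 x2 y1 y2 = rint g x1 x2 y1 y2.
Proof.
  intros Hx Hy H. unfold rint, hint, vint.
  f_equal; [f_equal; [f_equal|]|]; apply cint_ext; auto; intros; rewrite H; auto; in_rect.
Qed.

Lemma holo_comp (f g : C -> C) z : holo f (g z) -> holo g z -> holo (fun x => f (g x)) z.
Proof.
  intros [a Ha] [b Hb]. eexists.
  exact (is_derive_comp (K := C_AbsRing) (V := AbsRing_NormedModule C_AbsRing) f g z a b Ha Hb).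
Qed.

Lemma holo_minus_const (c z : C) : holo (fun x => x - c)%C z.
Proof. apply holo_plus; [apply holo_id|apply holo_const]. Qed.

Lemma holo_inv_shift (c z : C) : z <> c -> holo (fun x => / (x - c))%C z.
Proof.
  intros H. apply (holo_comp Cinv (fun x => x - c)%C).
  - apply holo_inv. intros E. apply H, Cminus_eq0, E.
  - apply holo_minus_const.
Qed.

Lemma holo_pow f n z : holo f z -> holo (fun x => (f x ^ n)%C) z.
Proof.
  intros H. induction n as [|n IH]; simpl; [apply holo_const|].
  apply holo_mult; assumption.
Qed.

Lemma snd_Cinv (z : C) : snd (/ z)%C = - snd z / (fst z ^ 2 + snd z ^ 2).
Proof. reflexivity. Qed.
Lemma fst_Cinv (z : C) : fst (/ z)%C = fst z / (fst z ^ 2 + snd z ^ 2).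
Proof. reflexivity. Qed.

Lemma cint_snd_ge g a b m : a <= b -> integrable g a b ->
  (forall x, a < x < b -> m <= snd (g x)) -> (b - a) * m <= snd (cint g a b).
Proof.
  intros Hab [_ G2] H. simpl.
  replace ((b - a) * m) with (RInt (fun _ => m) a b) by (rewrite RInt_const; reflexivity).
  apply RInt_le; auto. apply ex_RInt_const.
Qed.

Lemma cint_snd_le g a b m : a <= b -> integrable g a b ->
  (forall x, a < x < b -> snd (g x) <= m) -> snd (cint g a b) <= (b - a) * m.
Proof.
  intros Hab [_ G2] H. simpl.
  replace ((b - a) * m) with (RInt (fun _ => m) a b) by (rewrite RInt_const; reflexivity).
  apply RInt_le; auto. apply ex_RInt_const.
Qed.

(** The integral is [2 pi i], but a positive lower bound is enough and avoids the arctangent. With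
    [t] the coordinate along a side, each side contributes to the imaginary part the integral of
    [rho / (t^2 + rho^2) >= 1 / (2 rho)] over a length [2 rho], hence at least 1. *)
Lemma rint_kernel (c : C) rho : 0 < rho ->
  4 <= Cmod (rint (fun z => / (z - c))%C (fst c - rho) (fst c + rho) (snd c - rho) (snd c + rho)).
Proof.
  intros Hr.
  assert (Hc : forall z, fst z <> fst c \/ snd z <> snd c -> cont (fun z => / (z - c))%C z).
  { intros z Hz. apply holo_cont, holo_inv_shift. intros ->. tauto. }
  destruct c as [cx cy]. simpl fst in *; simpl snd in *.
  assert (K : forall t, - rho <= t <= rho -> / (2 * rho) <= rho / (t ^ 2 + rho ^ 2)).
  { intros t Ht. assert (0 < t ^ 2 + rho ^ 2) by nra.
    apply (Rmult_le_reg_r (2 * rho * (t ^ 2 + rho ^ 2))); [nra|].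
    replace (/ (2 * rho) * (2 * rho * (t ^ 2 + rho ^ 2))) with (t ^ 2 + rho ^ 2) by (field; lra).
    replace (rho / (t ^ 2 + rho ^ 2) * (2 * rho * (t ^ 2 + rho ^ 2))) with (2 * rho ^ 2) by (field; lra).
    nra. }
  assert (H1 : (cx + rho - (cx - rho)) * / (2 * rho) <=
     snd (hint (fun z => / (z - (cx, cy)))%C (cy - rho) (cx - rho) (cx + rho))).
  { apply cint_snd_ge; [lra|apply (hint_ok (fun z => / (z - (cx, cy)))%C); [lra|]; intros; apply Hc; simpl; lra|].
    intros x Hx. rewrite Cmult_1_l, snd_Cinv. simpl fst; simpl snd.
    eapply Rle_trans; [apply (K (x - cx)); lra|]. right.
    field; repeat split; apply Rgt_not_eq; nra. }
  assert (H2 : (cy + rho - (cy - rho)) * / (2 * rho) <=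
     snd (vint (fun z => / (z - (cx, cy)))%C (cx + rho) (cy - rho) (cy + rho))).
  { apply cint_snd_ge; [lra|apply (vint_ok (fun z => / (z - (cx, cy)))%C); [lra|]; intros; apply Hc; simpl; lra|].
    intros y Hy. 
    replace (snd (Ci * / (((cx + rho)%R, y) - (cx, cy)))%C) with (fst (/ (((cx + rho)%R, y) - (cx, cy)))%C)
      by (unfold Ci, Cmult; simpl; ring).
    rewrite fst_Cinv. simpl fst; simpl snd.
    eapply Rle_trans; [apply (K (y - cy)); lra|]. right. field; repeat split; apply Rgt_not_eq; nra. }
  assert (H3 : snd (hint (fun z => / (z - (cx, cy)))%C (cy + rho) (cx - rho) (cx + rho))
     <= (cx + rho - (cx - rho)) * - / (2 * rho)).
  { apply cint_snd_le; [lra|apply (hint_ok (fun z => / (z - (cx, cy)))%C); [lra|]; intros; apply Hc; simpl; lra|].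
    intros x Hx. rewrite Cmult_1_l, snd_Cinv. simpl fst; simpl snd.
    eapply Rle_trans; [|apply Ropp_le_contravar, (K (x - cx)); lra]. right.
    field; repeat split; apply Rgt_not_eq; nra. }
  assert (H4 : snd (vint (fun z => / (z - (cx, cy)))%C (cx - rho) (cy - rho) (cy + rho))
     <= (cy + rho - (cy - rho)) * - / (2 * rho)).
  { apply cint_snd_le; [lra|apply (vint_ok (fun z => / (z - (cx, cy)))%C); [lra|]; intros; apply Hc; simpl; lra|].
    intros y Hy. 
    replace (snd (Ci * / (((cx - rho)%R, y) - (cx, cy)))%C) with (fst (/ (((cx - rho)%R, y) - (cx, cy)))%C)
      by (unfold Ci, Cmult; simpl; ring).
    rewrite fst_Cinv. simpl fst; simpl snd.
    eapply Rle_trans; [|apply Ropp_le_contravar, (K (y - cy)); lra]. right. field; repeat split; apply Rgt_not_eq; nra. }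
  eapply Rle_trans; [|apply snd_le_Cmod]. eapply Rle_trans; [|apply Rle_abs].
  unfold rint.
  assert (E : forall s t u w : C, snd (s + t - u - w)%C = snd s + snd t - snd u - snd w)
    by (intros; simpl; ring).
  rewrite E.
  set (I1 := snd (hint _ (cy - rho) _ _)) in *. set (I2 := snd (vint _ (cx + rho) _ _)) in *.
  set (I3 := snd (hint _ (cy + rho) _ _)) in *. set (I4 := snd (vint _ (cx - rho) _ _)) in *.
  replace (cx + rho - (cx - rho)) with (2 * rho) in * by ring.
  replace (cy + rho - (cy - rho)) with (2 * rho) in * by ring.
  rewrite Rinv_r in * by lra. replace (2 * rho * - / (2 * rho)) with (-1) in * by (field; lra).
  lra.
Qed.

(** Goursat's theorem removes everything but an arbitrarily small square around [c], on which [f] is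
    bounded by continuity. *)
Lemma rint_removable f (c : C) rho : 0 < rho ->
  let Q := rcl (fst c - rho) (fst c + rho) (snd c - rho) (snd c + rho) in
  (forall z, Q z -> cont f z) -> (forall z, Q z -> z <> c -> holo f z) ->
  rint f (fst c - rho) (fst c + rho) (snd c - rho) (snd c + rho) = 0.
Proof.
  intros Hr Q Hc Hf. subst Q.
  apply Cmod_eq_0, Rle_antisym; [|apply Cmod_ge_0]. apply Rnot_lt_le. intros Hp.
  set (I := rint _ _ _ _ _) in *.
  destruct (Hc c) with (eps := 1) as [d [Hd Hd']]; [split; lra|lra|].
  assert (HK := Cmod_ge_0 (f c)). set (K := Cmod (f c) + 1).
  (* The three entries keep the small square inside the large one, keep [|f| <= K] on it, and make
     the bound [16 * de * K] of its integral at most half of [|I|]. *)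
  set (de := Rmin (rho / 2) (Rmin (d / 4) (Cmod I / (32 * K)))).
  assert (P : 0 < Cmod I / (32 * K)) by (apply Rdiv_lt_0_compat; unfold K; lra).
  assert (Hde : 0 < de) by (repeat apply Rmin_pos; lra).
  assert (E1 : de <= rho / 2) by apply Rmin_l.
  assert (E2 : de <= d / 4) by (eapply Rle_trans; [apply Rmin_r|apply Rmin_l]).
  assert (E3 : de <= Cmod I / (32 * K)) by (eapply Rle_trans; [apply Rmin_r|apply Rmin_r]).
  destruct c as [cx cy]. simpl fst in *; simpl snd in *.
  assert (Hs : I = rint f (cx - de) (cx + de) (cy - de) (cy + de)).
  { unfold I. rewrite (rint_split_x f (cx - rho) (cx - de) (cx + rho)); [|lra|lra|exact Hc].
    rewrite (rint_split_x f (cx - de) (cx + de) (cx + rho)); [|lra|lra|].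
    2:{ intros z [Z1 Z2]. apply Hc. split; lra. }
    rewrite (rint_split_y f (cx - de) (cx + de) (cy - rho) (cy - de) (cy + rho)); [|lra|lra|].
    2:{ intros z [Z1 Z2]. apply Hc. split; lra. }
    rewrite (rint_split_y f (cx - de) (cx + de) (cy - de) (cy + de) (cy + rho)); [|lra|lra|].
    2:{ intros z [Z1 Z2]. apply Hc. split; lra. }
    rewrite (Goursat f (cx - rho)), (Goursat f (cx + de)), (Goursat f _ _ (cy - rho)), (Goursat f _ _ (cy + de)).
    ring.
    all: try lra.
    all: intros z [Z1 Z2]; apply Hf; [split; lra|]; intros ->; simpl in *; lra. }
  assert (B : Cmod I <= 4 * (cx + de - (cx - de) + (cy + de - (cy - de))) * K).
  { rewrite Hs. apply rint_bound; [lra|lra| |].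
    - intros z [[Z1 Z2] _]. apply Hc. split; lra.
    - intros z [[Z1 Z2] _]. specialize (Hd' z).
      assert (T : Cmod (z - (cx, cy)) < d).
      { eapply Rle_lt_trans; [apply Cmod_le_sum|]. simpl.
        apply Rle_lt_trans with (de + de); [|lra]. apply Rplus_le_compat; apply Rabs_le; lra. }
      apply Hd' in T. assert (T2 := Cmod_triangle (f z - f (cx, cy)) (f (cx, cy))).
      replace (f z - f (cx, cy) + f (cx, cy))%C with (f z) in T2 by ring. unfold K. lra. }
  replace (4 * (cx + de - (cx - de) + (cy + de - (cy - de))) * K) with (16 * de * K) in B by ring.
  apply Rle_div_r in E3; [|unfold K; lra]. lra.
Qed.

(** The difference quotient of [G] at [c], completed by the derivative, is continuous on the square
    and holomorphic off [c], so its integral vanishes. Thus [G c] times the kernel integral, of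
    modulus at least 4, equals the integral of [G z / (z - c)], of modulus at most [16 * M]. *)
Lemma cauchy_bound G (c : C) rho M : 0 < rho ->
  (forall z, rcl (fst c - rho) (fst c + rho) (snd c - rho) (snd c + rho) z -> holo G z) ->
  (forall z, rbd (fst c - rho) (fst c + rho) (snd c - rho) (snd c + rho) z -> Cmod (G z) <= M) ->
  Cmod (G c) <= 4 * M.
Proof.
  intros Hr HG HM.
  set (x1 := fst c - rho) in *. set (x2 := fst c + rho) in *.
  set (y1 := snd c - rho) in *. set (y2 := snd c + rho) in *.
  assert (Hx : x1 <= x2) by (unfold x1, x2; lra). assert (Hy : y1 <= y2) by (unfold y1, y2; lra).
  assert (Hcc : rcl x1 x2 y1 y2 c) by (split; unfold x1, x2, y1, y2; lra).
  destruct (HG c Hcc) as [D HD].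
  assert (HD' : exists L : C, forall eps, 0 < eps -> exists delta, 0 < delta /\
    forall h : C, 0 < Cmod h < delta -> Cmod (G (c + h) - G c - L * h)%C <= eps * Cmod h).
  { apply (proj2 (Cdiff_holo G c)). now exists D. }
  clear D HD. destruct HD' as [L HL].
  set (k := fun z : C => (/ (z - c))%C).
  assert (Hbd : forall z, rbd x1 x2 y1 y2 z -> z <> c).
  { intros z [_ Hz] ->. unfold x1, x2, y1, y2 in Hz. lra. }
  set (h := fun z => if excluded_middle_informative (z = c) then L else ((G z - G c) * k z)%C).
  assert (Hh : forall z, z <> c -> h z = ((G z - G c) * k z)%C).
  { intros z Hz. unfold h. now destruct (excluded_middle_informative (z = c)). }
  assert (Hhc : h c = L).
  { unfold h. now destruct (excluded_middle_informative (c = c)). }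
  assert (Hholo : forall z, rcl x1 x2 y1 y2 z -> z <> c -> holo h z).
  { intros z Hz Hn. assert (Hp : 0 < Cmod (z - c)).
    { apply Cmod_gt_0. intros E. apply Hn, Cminus_eq0, E. }
    apply (holo_ext_near (fun z => (G z - G c) * k z)%C h z (Cmod (z - c)) Hp).
    - intros w Hw. symmetry. apply Hh. intros ->.
      replace (c - z)%C with (- (z - c))%C in Hw by ring. rewrite Cmod_opp in Hw. lra.
    - apply holo_mult; [apply holo_plus; [now apply HG|apply holo_const]|].
      now apply holo_inv_shift. }
  assert (Hcont : forall z, rcl x1 x2 y1 y2 z -> cont h z).
  { intros z Hz. destruct (classic (z = c)) as [->|Hn]; [|now apply holo_cont, Hholo].
    intros e He. destruct (HL (e/2)) as [d [Hd H]]; [lra|]. exists d. split; auto.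
    intros w Hw. rewrite Hhc. destruct (classic (w = c)) as [->|Hn].
    - rewrite Hhc. replace (L - L)%C with (RtoC 0) by ring. now rewrite Cmod_0.
    - rewrite Hh by auto. assert (Hq : (w - c)%C <> 0) by (intros E; apply Hn, Cminus_eq0, E).
      assert (Hp : 0 < Cmod (w - c)) by now apply Cmod_gt_0.
      specialize (H (w - c)%C (conj Hp Hw)). replace (c + (w - c))%C with w in H by ring.
      unfold k. replace ((G w - G c) * / (w - c) - L)%C with ((G w - G c - L * (w - c)) / (w - c))%C by (field; auto).
      rewrite Cmod_div by auto. apply Rle_lt_trans with (e/2); [|lra].
      apply Rle_div_l; auto. }
  assert (H0 : rint h x1 x2 y1 y2 = 0) by (apply rint_removable; auto).
  assert (Hk : forall z, rbd x1 x2 y1 y2 z -> cont k z).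
  { intros z Hz. apply holo_cont, holo_inv_shift. now apply Hbd. }
  assert (HGk : forall z, rbd x1 x2 y1 y2 z -> cont (fun z => G z * k z)%C z).
  { intros z Hz. apply holo_cont, holo_mult; [apply HG, Hz|apply holo_inv_shift; now apply Hbd]. }
  assert (E : rint h x1 x2 y1 y2 = (rint (fun z => G z * k z)%C x1 x2 y1 y2 + (- G c) * rint k x1 x2 y1 y2)%C).
  { rewrite <- rint_scal, <- rint_plus; auto.
    - apply rint_ext; auto. intros z Hz. rewrite Hh by now apply Hbd. ring.
    - intros z Hz. apply holo_cont, holo_mult; [apply holo_const|apply holo_inv_shift; now apply Hbd]. }
  rewrite H0 in E.
  assert (E2 : (G c * rint k x1 x2 y1 y2 = rint (fun z => G z * k z)%C x1 x2 y1 y2)%C).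
  { symmetry. apply Cminus_eq0. rewrite E. ring. }
  assert (B1 : 4 <= Cmod (rint k x1 x2 y1 y2)) by now apply rint_kernel.
  assert (B2 : Cmod (rint (fun z => G z * k z)%C x1 x2 y1 y2) <= 4 * (x2 - x1 + (y2 - y1)) * (M * / rho)).
  { apply rint_bound; auto. intros z Hz. rewrite Cmod_mult. apply Rmult_le_compat; try apply Cmod_ge_0; auto.
    unfold k. rewrite Cmod_inv.
    2:{ intros F. apply (Hbd z Hz), Cminus_eq0, F. }
    apply Rinv_le_contravar; auto.
    destruct Hz as [_ Hz]. unfold x1, x2, y1, y2 in Hz.
    assert (F1 := fst_le_Cmod (z - c)). assert (F2 := snd_le_Cmod (z - c)). simpl in F1, F2.
    destruct Hz as [Hz|[Hz|[Hz|Hz]]]; rewrite Hz in *.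
    - eapply Rle_trans; [|exact F1]. rewrite <- Rabs_Ropp. eapply Rle_trans; [|apply Rle_abs]. lra.
    - eapply Rle_trans; [|exact F1]. eapply Rle_trans; [|apply Rle_abs]. lra.
    - eapply Rle_trans; [|exact F2]. rewrite <- Rabs_Ropp. eapply Rle_trans; [|apply Rle_abs]. lra.
    - eapply Rle_trans; [|exact F2]. eapply Rle_trans; [|apply Rle_abs]. lra. }
  rewrite <- E2, Cmod_mult in B2.
  replace (4 * (x2 - x1 + (y2 - y1)) * (M * / rho)) with (16 * M) in B2
    by (unfold x1, x2, y1, y2; field; lra).
  assert (T := Cmod_ge_0 (G c)). nra.
Qed.

(** * The identity theorem *)

Lemma rcont_bounded g a b : a <= b -> (forall x, a <= x <= b -> rcont g x) ->
  exists M, forall x, a <= x <= b -> Cmod (g x) <= M.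
Proof.
  intros Hab H.
  destruct (continuity_ab_maj (fun x => Cmod (g x)) a b Hab) as [m [Hm _]].
  - intros x Hx e He. destruct (H x Hx e He) as [d [Hd Hw]]. exists d. split; auto.
    intros y [_ Hy]. specialize (Hw y Hy). simpl. unfold R_dist. eapply Rle_lt_trans; [|exact Hw].
    apply Rabs_le. assert (T1 := Cmod_triangle (g y - g x) (g x)).
    assert (T2 := Cmod_triangle (- (g y - g x)) (g y)). rewrite Cmod_opp in T2.
    replace (g y - g x + g x)%C with (g y) in T1 by ring.
    replace (- (g y - g x) + g y)%C with (g x) in T2 by ring. lra.
  - exists (Cmod (g m)). exact Hm.
Qed.

Lemma cont_rbd_bounded f x1 x2 y1 y2 : x1 <= x2 -> y1 <= y2 ->
  (forall z, rcl x1 x2 y1 y2 z -> cont f z) ->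
  exists M, forall z, rbd x1 x2 y1 y2 z -> Cmod (f z) <= M.
Proof.
  intros Hx Hy Hc.
  assert (Hh : forall y, y1 <= y <= y2 -> exists M, forall x, x1 <= x <= x2 -> Cmod (f (x, y)) <= M).
  { intros y Hyy. destruct (rcont_bounded (fun x => 1 * f (x, y))%C x1 x2 Hx) as [M HM].
    - intros x Hxx. apply rcont_h, Hc. split; auto.
    - exists M. intros x Hxx. specialize (HM x Hxx). now rewrite Cmult_1_l in HM. }
  assert (Hv : forall x, x1 <= x <= x2 -> exists M, forall y, y1 <= y <= y2 -> Cmod (f (x, y)) <= M).
  { intros x Hxx. destruct (rcont_bounded (fun y => 1 * f (x, y))%C y1 y2 Hy) as [M HM].
    - intros y Hyy. apply rcont_v, Hc. split; auto.
    - exists M. intros y Hyy. specialize (HM y Hyy). now rewrite Cmult_1_l in HM. }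
  destruct (Hh y1) as [M1 N1]; [lra|]. destruct (Hh y2) as [M2 N2]; [lra|].
  destruct (Hv x1) as [M3 N3]; [lra|]. destruct (Hv x2) as [M4 N4]; [lra|].
  exists (Rmax (Rmax M1 M2) (Rmax M3 M4)).
  assert (B1 := Rmax_l M1 M2). assert (B2 := Rmax_r M1 M2).
  assert (B3 := Rmax_l M3 M4). assert (B4 := Rmax_r M3 M4).
  assert (B5 := Rmax_l (Rmax M1 M2) (Rmax M3 M4)). assert (B6 := Rmax_r (Rmax M1 M2) (Rmax M3 M4)).
  intros [x y] [[Z1 Z2] Z]. simpl in Z1, Z2, Z.
  specialize (N1 x Z1). specialize (N2 x Z1). specialize (N3 y Z2). specialize (N4 y Z2).
  destruct Z as [-> | [-> | [-> | ->]]]; lra.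
Qed.

Lemma le_geom_0 x K : 0 <= x -> (forall n, x <= K * (/2) ^ n) -> x = 0.
Proof.
  intros Hx H. apply Rle_antisym; auto. apply Rnot_lt_le. intros Hp.
  assert (HK := H 0%nat). simpl in HK.
  destruct (pow_lt_1_zero (/2)) with (y := x / (2 * K)) as [n Hn].
  - rewrite Rabs_pos_eq; lra.
  - apply Rdiv_lt_0_compat; lra.
  - specialize (Hn n (le_n n)). rewrite Rabs_pos_eq in Hn by (apply pow_le; lra).
    specialize (H n). apply Rlt_div_r in Hn; [|lra]. lra.
Qed.

(** [f z / (z - c) ^ n] stays holomorphic at [c] for every [n], because [f] vanishes around [c]. No
    power series is involved: on the boundary of a square about [zt] the factor [|z - c|] is at
    least twice its value at [zt], and letting [n] grow gives [f zt = 0]. The size of [s] has no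
    influence on the radius reached, which makes the step repeatable along a path. *)
Lemma vanish_local (f : C -> C) (c : C) r s : 0 < s ->
  (forall z, Cmod (z - c) < r -> holo f z) ->
  (forall z, Cmod (z - c) < s -> f z = 0) ->
  forall zt, Cmod (zt - c) < r / 8 -> f zt = 0.
Proof.
  intros Hs Hf H0 zt Hz.
  (* The square stays in the disc since [2 * 3/8 + 1/8 < 1], and its boundary stays
     [(3/8 - 1/8) r = r/4] away from [c]. *)
  set (rho := 3 * r / 8). assert (Hzc := Cmod_ge_0 (zt - c)).
  assert (Hr : 0 < rho) by (unfold rho; lra).
  set (x1 := fst zt - rho). set (x2 := fst zt + rho). set (y1 := snd zt - rho). set (y2 := snd zt + rho).
  assert (Hin : forall z, rcl x1 x2 y1 y2 z -> Cmod (z - c) < r).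
  { intros z [Z1 Z2]. replace (z - c)%C with ((z - zt) + (zt - c))%C by ring.
    eapply Rle_lt_trans; [apply Cmod_triangle|].
    assert (Cmod (z - zt) <= rho + rho).
    { eapply Rle_trans; [apply Cmod_le_sum|]. simpl. unfold x1, x2, y1, y2 in *.
      apply Rplus_le_compat; apply Rabs_le; lra. }
    unfold rho in *. lra. }
  assert (Hout : forall z, rbd x1 x2 y1 y2 z -> r / 4 <= Cmod (z - c)).
  { intros z [_ Hb].
    assert (T := Cmod_triangle (z - c) (- (zt - c))). rewrite Cmod_opp in T.
    replace (z - c + - (zt - c))%C with (z - zt)%C in T by ring.
    assert (rho <= Cmod (z - zt)).
    { assert (F1 := fst_le_Cmod (z - zt)). assert (F2 := snd_le_Cmod (z - zt)). simpl in F1, F2.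
      unfold x1, x2, y1, y2 in Hb. destruct Hb as [Hb|[Hb|[Hb|Hb]]]; rewrite Hb in *.
      - eapply Rle_trans; [|exact F1]. rewrite <- Rabs_Ropp. eapply Rle_trans; [|apply Rle_abs]. lra.
      - eapply Rle_trans; [|exact F1]. eapply Rle_trans; [|apply Rle_abs]. lra.
      - eapply Rle_trans; [|exact F2]. rewrite <- Rabs_Ropp. eapply Rle_trans; [|apply Rle_abs]. lra.
      - eapply Rle_trans; [|exact F2]. eapply Rle_trans; [|apply Rle_abs]. lra. }
    unfold rho in *. lra. }
  destruct (cont_rbd_bounded f x1 x2 y1 y2) as [M HM]; [unfold x1, x2; lra|unfold y1, y2; lra| |].
  { intros z Hz'. now apply holo_cont, Hf, Hin. }
  apply Cmod_eq_0. apply le_geom_0 with (K := 4 * M); [apply Cmod_ge_0|]. intros n.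
  destruct (classic (zt = c)) as [->|Hne].
  { rewrite H0. 2:{ replace (c - c)%C with (RtoC 0) by ring. now rewrite Cmod_0. }
    rewrite Cmod_0. apply Rmult_le_pos; [|apply pow_le; lra].
    assert (Hb : rbd x1 x2 y1 y2 (x1, y1)).
    { split; [split|]; unfold x1, x2, y1, y2; simpl; lra. }
    specialize (HM _ Hb). assert (T := Cmod_ge_0 (f (x1, y1))). lra. }
  set (G := fun z => (f z * (/ (z - c)) ^ n)%C).
  assert (HG : Cmod (G zt) <= 4 * (M * (/ (r / 4)) ^ n)).
  { apply cauchy_bound with (rho := rho); auto.
    - intros z Hz'. destruct (classic (z = c)) as [->|Hzc'].
      + apply holo_ext_near with (f := fun _ => RtoC 0) (d := s); auto; [|apply holo_const].
        intros w Hw. unfold G. rewrite H0 by auto. ring.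
      + apply holo_mult; [now apply Hf, Hin|]. apply holo_pow, holo_inv_shift, Hzc'.
    - intros z Hb. unfold G. rewrite Cmod_mult, Cmod_pow. specialize (Hout z Hb).
      assert (Hzn : (z - c)%C <> 0) by (apply Cmod_gt_0; lra). rewrite Cmod_inv by auto.
      apply Rmult_le_compat; [apply Cmod_ge_0|apply pow_le; left; apply Rinv_0_lt_compat; lra|now apply HM|].
      apply pow_incr. split; [left; apply Rinv_0_lt_compat; lra|]. apply Rinv_le_contravar; lra. }
  assert (Hq : (zt - c)%C <> 0) by (intros E; apply Hne, Cminus_eq0, E).
  assert (E : f zt = (G zt * (zt - c) ^ n)%C).
  { unfold G. rewrite Cpow_inv by auto. field. now apply Cpow_nz. }
  rewrite E, Cmod_mult, Cmod_pow.
  apply Rle_trans with (4 * (M * (/ (r / 4)) ^ n) * (r / 8) ^ n).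
  { apply Rmult_le_compat; try apply Cmod_ge_0; auto. apply pow_le; lra. apply pow_incr; lra. }
  right. replace (/ 2) with (/ (r / 4) * (r / 8)) by (field; lra). rewrite Rpow_mult_distr. ring.
Qed.

(** Compactness of the interval as induction: around the supremum [m] of the initial segments on
    which [Q] holds, [Q] passes from a point left of [m] to all points up to [m + d], so [m] cannot
    stop short of 1. *)
Lemma unit_interval_ind (Q : R -> Prop) :
  (forall t, 0 <= t <= 1 -> exists d, 0 < d /\ forall t1 t2, 0 <= t1 <= 1 -> 0 <= t2 <= 1 ->
     Rabs (t1 - t) < d -> Rabs (t2 - t) < d -> Q t1 -> Q t2) -> Q 0 -> Q 1.
Proof.
  intros H Q0.
  set (E := fun t => 0 <= t <= 1 /\ forall s, 0 <= s <= t -> Q s).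
  assert (E0 : E 0). { split; [lra|]. intros s Hs. replace s with 0 by lra. auto. }
  destruct (completeness E) as [m [U L]].
  { exists 1. intros t [Ht _]. lra. } { now exists 0. }
  assert (Hm : 0 <= m <= 1).
  { split; [apply U, E0|]. apply L. intros t [Ht _]. lra. }
  destruct (H m Hm) as [d [Hd HQ]].
  assert (Ht : exists t, E t /\ m - d < t).
  { destruct (classic (exists t, E t /\ m - d < t)) as [?|N]; auto. exfalso.
    assert (m <= m - d); [|lra]. apply L. intros t Et. apply Rnot_lt_le. intros ?. apply N. now exists t. }
  destruct Ht as [t [Et Htm]]. assert (Htm' := U t Et).
  assert (Hup : forall u, 0 <= u <= 1 -> u < m + d -> Q u).
  { intros u Hu Hud. destruct (Rle_dec u t) as [?|N]; [apply Et; lra|].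
    destruct Et as [Et1 Et2].
    apply (HQ t u); [lra|lra| | |apply Et2; lra].
    - apply Rabs_def1; lra.
    - apply Rabs_def1; lra. }
  destruct (Rlt_dec 1 (m + d)) as [?|N]; [apply Hup; lra|].
  exfalso. assert (F : m + d / 2 <= m); [|lra]. apply U. split; [lra|]. intros s Hs. apply Hup; lra.
Qed.

Definition seg (A B : C) (t : R) : C := (A + RtoC t * (B - A))%C.

Lemma segment_ind (P : C -> Prop) (A B : C) :
  (forall t, 0 <= t <= 1 -> exists r, 0 < r /\ forall w1 w2,
     Cmod (w1 - seg A B t) < r -> Cmod (w2 - seg A B t) < r -> P w1 -> P w2) -> P A -> P B.
Proof.
  intros H PA.
  replace B with (seg A B 1) by (unfold seg; ring).
  apply (unit_interval_ind (fun t => P (seg A B t))).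
  - intros t Ht. destruct (H t Ht) as [r [Hr HP]].
    assert (HK := Cmod_ge_0 (B - A)). set (K := Cmod (B - A) + 1).
    exists (r / K). split; [apply Rdiv_lt_0_compat; unfold K; lra|].
    assert (D : forall u, Rabs (u - t) < r / K -> Cmod (seg A B u - seg A B t) < r).
    { intros u Hu. replace (seg A B u - seg A B t)%C with (RtoC (u - t) * (B - A))%C
        by (unfold seg; rewrite RtoC_minus; ring).
      rewrite Cmod_mult, Cmod_R. apply Rlt_div_r in Hu; [|unfold K; lra].
      unfold K in Hu. assert (T := Rabs_pos (u - t)). lra. }
    intros t1 t2 _ _ H1 H2. apply HP; auto.
  - replace (seg A B 0) with A by (unfold seg; ring). exact PA.
Qed.

Lemma seg_ball A B z r t : Cmod (A - z) < r -> Cmod (B - z) < r -> 0 <= t <= 1 ->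
  Cmod (seg A B t - z) < r.
Proof.
  intros HA HB Ht.
  replace (seg A B t - z)%C with (RtoC (1 - t) * (A - z) + RtoC t * (B - z))%C
    by (unfold seg; rewrite RtoC_minus; ring).
  eapply Rle_lt_trans; [apply Cmod_triangle|]. rewrite !Cmod_mult, !Cmod_R, !Rabs_pos_eq by lra.
  assert (H1 := Cmod_ge_0 (A - z)). assert (H2 := Cmod_ge_0 (B - z)).
  destruct (Rle_dec t (1/2)); nra.
Qed.

Definition zero_near (f : C -> C) (z : C) : Prop :=
  exists s, 0 < s /\ forall w, Cmod (w - z) < s -> f w = 0.

Definition opn (O : C -> Prop) : Prop :=
  forall z, O z -> exists r, 0 < r /\ forall w, Cmod (w - z) < r -> O w.

Lemma zero_near_segment (O : C -> Prop) (f : C -> C) (A B : C) : opn O -> (forall z, O z -> holo f z) ->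
  (forall t, 0 <= t <= 1 -> O (seg A B t)) -> zero_near f A -> zero_near f B.
Proof.
  intros HO Hf Hseg. apply segment_ind. intros t Ht.
  destruct (HO _ (Hseg t Ht)) as [r [Hr HB]]. set (z := seg A B t) in *.
  (* [vanish_local] about [w1] with radius [r / 2] reaches distance [r / 16], while points within
     [r / 100] of [w2] are within [3 r / 100] of [w1]. *)
  exists (r / 100). split; [lra|]. intros w1 w2 H1 H2 [s [Hs Hz]].
  exists (r / 100). split; [lra|]. intros w Hw.
  apply (vanish_local f w1 (r / 2) s Hs); auto.
  - intros u Hu. apply Hf, HB. replace (u - z)%C with ((u - w1) + (w1 - z))%C by ring.
    eapply Rle_lt_trans; [apply Cmod_triangle|]. lra.
  - replace (w - w1)%C with ((w - w2) + ((w2 - z) + - (w1 - z)))%C by ring.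
    eapply Rle_lt_trans; [apply Cmod_triangle|].
    assert (T := Cmod_triangle (w2 - z) (- (w1 - z))). rewrite Cmod_opp in T. lra.
Qed.

Lemma list_isolate (z : C) (l : list C) :
  exists r, 0 < r /\ forall s, In s l -> Cmod (s - z) < r -> s = z.
Proof.
  induction l as [|a l [r [Hr H]]].
  - exists 1. split; [lra|]. intros s [].
  - destruct (classic (a = z)) as [->|N].
    + exists r. split; auto. intros s [->|Hs]; auto.
    + assert (Hp : 0 < Cmod (a - z)). { apply Cmod_gt_0. intros E. apply N, Cminus_eq0, E. }
      exists (Rmin r (Cmod (a - z))). split; [now apply Rmin_pos|].
      intros s [->|Hs] Hd.
      * assert (T := Rmin_r r (Cmod (s - z))). lra.
      * apply H; auto. eapply Rlt_le_trans; [exact Hd|apply Rmin_l].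
Qed.

Lemma locfin_isolate (D S : C -> Prop) (z : C) : locfin D S -> D z ->
  exists r, 0 < r /\ forall s, S s -> Cmod (s - z) < r -> s = z.
Proof.
  intros [_ H] Hz. destruct (H z Hz) as [r [Hr [l Hl]]].
  destruct (list_isolate z l) as [r' [Hr' H']].
  exists (Rmin r r'). split; [now apply Rmin_pos|]. intros s Hs Hd. apply H'.
  - apply Hl; auto. change (Cmod (s - z) < r). eapply Rlt_le_trans; [exact Hd|apply Rmin_l].
  - eapply Rlt_le_trans; [exact Hd|apply Rmin_r].
Qed.

(** The straight segment from [A] to [B] can meet [z] only if [A - z] and [B - z] are parallel, that
    is, if their cross product [cr] vanishes. In that case the path goes through [z + Ci * (A - z)],
    which is parallel to neither. *)
Lemma zero_near_punctured (f : C -> C) (z : C) r (A B : C) :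
  (forall w, Cmod (w - z) < r -> w <> z -> holo f w) ->
  Cmod (A - z) < r -> A <> z -> Cmod (B - z) < r -> B <> z ->
  zero_near f A -> zero_near f B.
Proof.
  intros Hf.
  set (O := fun w => Cmod (w - z) < r /\ w <> z).
  assert (HO : opn O).
  { intros w [Hw Hn]. assert (Hp : 0 < Cmod (w - z)).
    { apply Cmod_gt_0. intros E. apply Hn, Cminus_eq0, E. }
    exists (Rmin (Cmod (w - z)) (r - Cmod (w - z))). split; [apply Rmin_pos; lra|].
    intros u Hu. assert (U1 := Rlt_le_trans _ _ _ Hu (Rmin_l _ _)).
    assert (U2 := Rlt_le_trans _ _ _ Hu (Rmin_r _ _)). split.
    - replace (u - z)%C with ((u - w) + (w - z))%C by ring.
      eapply Rle_lt_trans; [apply Cmod_triangle|lra].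
    - intros ->. replace (z - w)%C with (- (w - z))%C in U1 by ring. rewrite Cmod_opp in U1. lra. }
  set (cr := fun a b : C => fst a * snd b - snd a * fst b).
  assert (Base : forall A B, Cmod (A - z) < r -> Cmod (B - z) < r -> cr (A - z)%C (B - z)%C <> 0 ->
    zero_near f A -> zero_near f B).
  { clear A B. intros A B HA HB Hc. apply (zero_near_segment O f A B HO).
    - intros w [W1 W2]. now apply Hf.
    - intros t Ht. split; [now apply seg_ball|]. intros E. apply Hc.
      assert (E1 : (1 - t) * fst (A - z)%C + t * fst (B - z)%C = 0).
      { rewrite <- E. unfold seg. simpl. ring. }
      assert (E2 : (1 - t) * snd (A - z)%C + t * snd (B - z)%C = 0).
      { rewrite <- E. unfold seg. simpl. ring. }
      unfold cr. set (a1 := fst (A - z)%C) in *. set (a2 := snd (A - z)%C) in *.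
      set (b1 := fst (B - z)%C) in *. set (b2 := snd (B - z)%C) in *.
      replace (a1 * b2 - a2 * b1) with
        (a1 * ((1 - t) * a2 + t * b2) - a2 * ((1 - t) * a1 + t * b1)
         + b2 * ((1 - t) * a1 + t * b1) - b1 * ((1 - t) * a2 + t * b2)) by ring.
      rewrite E1, E2. ring. }
  intros HA NA HB NB.
  destruct (Req_dec (cr (A - z)%C (B - z)%C) 0) as [E|N]; [|now apply Base].
  intros HZ. set (m := (z + Ci * (A - z))%C).
  assert (Em : (m - z)%C = (Ci * (A - z))%C) by (unfold m; ring).
  assert (NA' : 0 < fst (A - z)%C ^ 2 + snd (A - z)%C ^ 2).
  { rewrite <- Cmod2_alt. apply pow_lt, Cmod_gt_0. intros F. apply NA, Cminus_eq0, F. }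
  assert (NB' : 0 < fst (B - z)%C ^ 2 + snd (B - z)%C ^ 2).
  { rewrite <- Cmod2_alt. apply pow_lt, Cmod_gt_0. intros F. apply NB, Cminus_eq0, F. }
  assert (Hm : Cmod (m - z) < r) by (rewrite Em, Cmod_mult, Cmod_Ci; lra).
  apply (Base m B Hm HB); [|apply (Base A m HA Hm); [|exact HZ]]; rewrite Em; unfold cr in *.
  - change (fst (Ci * (A - z))%C) with (0 * fst (A - z)%C - 1 * snd (A - z)%C).
    change (snd (Ci * (A - z))%C) with (0 * snd (A - z)%C + 1 * fst (A - z)%C).
    set (a1 := fst (A - z)%C) in *. set (a2 := snd (A - z)%C) in *.
    set (b1 := fst (B - z)%C) in *. set (b2 := snd (B - z)%C) in *. intros F.
    assert (F' : a1 * b1 + a2 * b2 = 0) by lra.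
    assert (P := Rmult_lt_0_compat _ _ NA' NB').
    replace ((a1 ^ 2 + a2 ^ 2) * (b1 ^ 2 + b2 ^ 2)) with
      ((a1 * b1 + a2 * b2) ^ 2 + (a1 * b2 - a2 * b1) ^ 2) in P by ring.
    rewrite F', E in P. lra.
  - change (fst (Ci * (A - z))%C) with (0 * fst (A - z)%C - 1 * snd (A - z)%C).
    change (snd (Ci * (A - z))%C) with (0 * snd (A - z)%C + 1 * fst (A - z)%C). nra.
Qed.

(** Points of [S] are left out because [merom_on] says nothing about the values there. *)
Definition zero_off (S : C -> Prop) (f : C -> C) (z : C) : Prop :=
  exists s, 0 < s /\ forall w, Cmod (w - z) < s -> ~ S w -> f w = 0.

Lemma identity_segment (O S : C -> Prop) (f : C -> C) (A B : C) : opn O -> locfin O S ->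
  (forall z, O z -> ~ S z -> holo f z) ->
  (forall t, 0 <= t <= 1 -> O (seg A B t)) -> zero_off S f A -> zero_off S f B.
Proof.
  intros HO HS Hf Hseg. apply segment_ind. intros t Ht.
  destruct (HO _ (Hseg t Ht)) as [r1 [Hr1 HB]].
  destruct (locfin_isolate O S _ HS (Hseg t Ht)) as [r2 [Hr2 HI]].
  set (z := seg A B t) in *. set (r := Rmin r1 r2).
  assert (Hr : 0 < r) by now apply Rmin_pos.
  assert (HB' : forall w, Cmod (w - z) < r -> O w) by (intros w Hw; apply HB; eapply Rlt_le_trans; [exact Hw|apply Rmin_l]).
  assert (HI' : forall w, Cmod (w - z) < r -> S w -> w = z) by (intros w Hw Sw; apply HI; auto; eapply Rlt_le_trans; [exact Hw|apply Rmin_r]).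
  clear HI HB.
  assert (Hin : forall w w' d, Cmod (w - z) < r -> Cmod (w' - w) < d -> d <= r - Cmod (w - z) -> Cmod (w' - z) < r).
  { intros w w' d H1 H2 H3. replace (w' - z)%C with ((w' - w) + (w - z))%C by ring.
    eapply Rle_lt_trans; [apply Cmod_triangle|lra]. }
  exists r. split; auto. intros w1 w2 H1 H2 [s [Hs Hz]].
  (* In this disc only [z] can be exceptional. If it is, the zeros travel through the punctured
     disc, whatever kind of singularity sits at [z]; otherwise they travel along segments in the
     full disc. *)
  destruct (classic (S z)) as [Sz|NSz].
  - assert (Hw : exists w, Cmod (w - z) < r /\ w <> z /\ zero_near f w).
    { set (s' := Rmin s (r - Cmod (w1 - z))).
      assert (Hs' : 0 < s') by (apply Rmin_pos; lra).
      assert (Hs1 : s' <= s) by apply Rmin_l.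
      assert (Hs2 : s' <= r - Cmod (w1 - z)) by apply Rmin_r.
      assert (G : exists w, Cmod (w - w1) < s' / 2 /\ w <> z).
      { destruct (classic (w1 = z)) as [->|N].
        - exists (z + RtoC (s' / 4))%C. split.
          + replace (z + RtoC (s' / 4) - z)%C with (RtoC (s' / 4)) by ring. rewrite Cmod_R, Rabs_pos_eq; lra.
          + intros F. assert (F2 : RtoC (s' / 4) = 0).
            { replace (RtoC (s' / 4)) with (z + RtoC (s' / 4) - z)%C by ring. rewrite F. ring. }
            apply (f_equal fst) in F2. simpl in F2. lra.
        - exists w1. split; auto. replace (w1 - w1)%C with (RtoC 0) by ring. rewrite Cmod_0. lra. }
      destruct G as [w [W1 W2]]. exists w. split; [|split]; auto.
      - apply (Hin w1 w (s' / 2)); auto; lra.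
      - assert (Hp : 0 < Cmod (w - z)). { apply Cmod_gt_0. intros E. apply W2, Cminus_eq0, E. }
        exists (Rmin (s' / 2) (Cmod (w - z))). split; [apply Rmin_pos; lra|]. intros u Hu.
        assert (U1 := Rlt_le_trans _ _ _ Hu (Rmin_l _ _)).
        assert (U2 := Rlt_le_trans _ _ _ Hu (Rmin_r _ _)).
        assert (U3 : Cmod (u - w1) < s').
        { replace (u - w1)%C with ((u - w) + (w - w1))%C by ring.
          eapply Rle_lt_trans; [apply Cmod_triangle|lra]. }
        apply Hz; [lra|]. intros Su. apply HI' in Su.
        + subst u. replace (z - w)%C with (- (w - z))%C in U2 by ring. rewrite Cmod_opp in U2. lra.
        + apply (Hin w1 u s'); auto; lra. }
    destruct Hw as [w [W1 [W2 W3]]].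
    exists (r - Cmod (w2 - z)). split; [lra|]. intros u Hu Su.
    assert (Nu : u <> z) by (intros ->; auto).
    assert (Hur : Cmod (u - z) < r) by (apply (Hin w2 u (r - Cmod (w2 - z))); auto; lra).
    assert (Hpun : forall x, Cmod (x - z) < r -> x <> z -> holo f x).
    { intros x Hx Nx. apply Hf; auto. }
    destruct (zero_near_punctured f z r w u Hpun W1 W2 Hur Nu W3) as [q [Hq Hzq]].
    apply Hzq. replace (u - u)%C with (RtoC 0) by ring. now rewrite Cmod_0.
  - assert (NS : forall w, Cmod (w - z) < r -> ~ S w).
    { intros w Hw Sw. apply NSz. rewrite <- (HI' w Hw Sw). exact Sw. }
    destruct (zero_near_segment (fun w => Cmod (w - z) < r) f w1 w2) as [q [Hq Hzq]].
    + intros w Hw. exists (r - Cmod (w - z)). split; [cbv beta in Hw; lra|]. intros u Hu.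
      apply (Hin w u (r - Cmod (w - z))); auto; lra.
    + intros w Hw. apply Hf; auto.
    + intros u Hu. now apply seg_ball.
    + exists (Rmin s (r - Cmod (w1 - z))). split; [apply Rmin_pos; lra|]. intros w Hw.
      apply Hz; [eapply Rlt_le_trans; [exact Hw|apply Rmin_l]|]. apply NS.
      apply (Hin w1 w (Rmin s (r - Cmod (w1 - z)))); auto. apply Rmin_r.
    + exists q. split; auto.
Qed.

(** * Floquet multipliers *)

Definition mroot (a v : R) (z m : C) : Prop :=
  m <> 0 /\ (RtoC a * (m * m + 1))%C = ((z * z - RtoC (v ^ 2 + 1 + a ^ 2)) * m)%C.

Lemma Csqrt_exists (z : C) : exists s : C, (s * s)%C = z.
Proof.
  destruct z as [x y]. set (r := Cmod (x, y)).
  assert (Hr : r ^ 2 = x ^ 2 + y ^ 2).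
  { unfold r. rewrite Cmod2_alt. reflexivity. }
  assert (Hx : Rabs x <= r) by apply (fst_le_Cmod (x, y)).
  apply Rabs_le_between in Hx.
  set (p := sqrt ((r + x) / 2)). set (q := sqrt ((r - x) / 2)).
  assert (Hp : p * p = (r + x) / 2) by (apply sqrt_sqrt; lra).
  assert (Hq : q * q = (r - x) / 2) by (apply sqrt_sqrt; lra).
  assert (Hp0 : 0 <= p) by apply sqrt_pos. assert (Hq0 : 0 <= q) by apply sqrt_pos.
  assert (Hpq : 2 * (p * q) = Rabs y).
  { apply Rsqr_inj; [nra|apply Rabs_pos|]. rewrite <- Rsqr_abs. unfold Rsqr.
    replace (2 * (p * q) * (2 * (p * q))) with (4 * ((p * p) * (q * q))) by ring.
    rewrite Hp, Hq. nra. }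
  destruct (Rle_dec 0 y) as [Hy|Hy].
  - rewrite Rabs_pos_eq in Hpq by auto. exists (p, q). apply Cext; simpl; lra.
  - rewrite Rabs_left in Hpq by lra. exists (p, - q). apply Cext; simpl; lra.
Qed.

Lemma mroot_exists a v z : 0 < a -> exists m, mroot a v z m.
Proof.
  intros Ha. set (w := (z * z - RtoC (v ^ 2 + 1 + a ^ 2))%C).
  destruct (Csqrt_exists (w * w - RtoC (4 * a ^ 2))%C) as [s Hs].
  assert (Ha' : RtoC a <> 0) by (intros E; apply (f_equal fst) in E; simpl in E; lra).
  assert (H2 : RtoC 2 <> 0) by (intros E; apply (f_equal fst) in E; simpl in E; lra).
  set (m := ((w + s) / (2 * RtoC a))%C).
  assert (Hm : (RtoC a * (m * m + 1))%C = (w * m)%C).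
  { unfold m.
    replace (RtoC a * ((w + s) / (2 * RtoC a) * ((w + s) / (2 * RtoC a)) + 1))%C with
      ((w * w + 2 * w * s + s * s + 4 * (RtoC a * RtoC a)) / (4 * RtoC a))%C.
    - rewrite Hs. replace (4 * a ^ 2) with (4 * (a * a)) by ring.
      rewrite !RtoC_mult. field. auto.
    - field. auto. }
  exists m. split; [|exact Hm]. intros E. rewrite E in Hm.
  replace (w * 0)%C with (RtoC 0) in Hm by ring.
  replace (RtoC a * (0 * 0 + 1))%C with (RtoC a) in Hm by ring. auto.
Qed.

Lemma mroot_inv a v z m : mroot a v z m -> mroot a v z (/ m)%C.
Proof.
  intros [Hm H]. split.
  - intros E. assert (F : (m * / m)%C = 1) by (apply Cinv_r; auto). rewrite E in F.
    replace (m * 0)%C with (RtoC 0) in F by ring. apply (f_equal fst) in F. simpl in F. lra.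
  - replace (RtoC a * (/ m * / m + 1))%C with (RtoC a * (m * m + 1) * (/ m * / m))%C by (field; auto).
    rewrite H. field. auto.
Qed.

(** Eliminating [z] from the two equations leaves [a (m' - m) (m m' - 1) = 0]. *)
Lemma mroot_two a v z m m' : 0 < a -> mroot a v z m -> mroot a v z m' -> m' = m \/ (m * m')%C = 1.
Proof.
  intros Ha [Hm H] [Hm' H'].
  assert (Ha' : RtoC a <> 0) by (intros E; apply (f_equal fst) in E; simpl in E; lra).
  assert (E : (RtoC a * ((m' - m) * (m * m' - 1)))%C = 0).
  { replace (RtoC a * ((m' - m) * (m * m' - 1)))%C with
      (m * (RtoC a * (m' * m' + 1)) - m' * (RtoC a * (m * m + 1)))%C by ring.
    rewrite H, H'. ring. }
  destruct (classic (m' = m)) as [?|N1]; auto. right.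
  destruct (classic ((m * m')%C = 1)) as [?|N2]; auto. exfalso. revert E.
  repeat apply Cmult_neq_0; auto; intros F; [apply N1|apply N2]; apply Cminus_eq0, F.
Qed.

(** Real and imaginary part of the equation multiplied by the conjugate of [m]. The last identity
    links the sign of [|m| - 1] to those of [snd m] and of [fst z * snd z]. *)
Lemma mroot_real a v z m : mroot a v z m ->
  let n2 := fst m ^ 2 + snd m ^ 2 in
  0 < n2 /\
  (fst z ^ 2 - snd z ^ 2 - (v ^ 2 + 1 + a ^ 2)) * n2 = a * fst m * (n2 + 1) /\
  2 * fst z * snd z * n2 = a * snd m * (n2 - 1).
Proof.
  intros [Hm H] n2. destruct z as [x y]. destruct m as [p q]. unfold n2. simpl fst in *; simpl snd in *. clear n2.
  assert (E1 := f_equal fst H). assert (E2 := f_equal snd H). simpl in E1, E2.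
  split; [|split].
  - assert (N : p <> 0 \/ q <> 0).
    { destruct (Req_dec p 0) as [->|]; auto. destruct (Req_dec q 0) as [->|]; auto. }
    destruct N; nra.
  - transitivity (p * (a * (p * p - q * q + 1) - 0 * (p * q + q * p + 0)) +
      q * (a * (p * q + q * p + 0) + 0 * (p * p - q * q + 1))); [rewrite E1, E2|]; ring.
  - transitivity (p * (a * (p * q + q * p + 0) + 0 * (p * p - q * q + 1)) -
      q * (a * (p * p - q * q + 1) - 0 * (p * q + q * p + 0))); [rewrite E1, E2|]; ring.
Qed.

Lemma Cmod_sq (m : C) : Cmod m ^ 2 = fst m ^ 2 + snd m ^ 2.
Proof. apply Cmod2_alt. Qed.

(** For [|m| = 1] the equation reads [z^2 = v^2 + 1 + a^2 + 2 a Re m], which is real and lies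
    between [v^2 + (a - 1)^2] and [v^2 + (a + 1)^2]. Hence off the bands exactly one root lies
    inside the unit circle. *)
Lemma mroot_unit_sigma a v z m : 0 < a -> mroot a v z m -> Cmod m = 1 -> sigma_ac a v z.
Proof.
  intros Ha Hm H1. destruct (mroot_real a v z m Hm) as [Hn [E1 E2]].
  assert (N : fst m ^ 2 + snd m ^ 2 = 1) by (rewrite <- Cmod_sq, H1; ring).
  rewrite N in *. destruct z as [x y]. destruct m as [p q]. simpl fst in *; simpl snd in *.
  assert (Hp : -1 <= p <= 1) by nra.
  assert (X : x ^ 2 - y ^ 2 = v ^ 2 + 1 + a ^ 2 + 2 * a * p) by lra.
  assert (L1 : v ^ 2 + (a - 1) ^ 2 <= x ^ 2 - y ^ 2) by nra.
  assert (L2 : x ^ 2 - y ^ 2 <= v ^ 2 + (a + 1) ^ 2) by nra.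
  assert (P1 := pow2_ge_0 v). assert (P2 := pow2_ge_0 (a - 1)).
  assert (Hy : y = 0).
  { assert (XY : x * y = 0) by lra. apply Rmult_integral in XY. destruct XY as [->|]; auto. nra. }
  subst y. replace (x ^ 2 - 0 ^ 2) with (x ^ 2) in * by ring.
  split; [reflexivity|]. simpl fst. unfold lam0p, lam1m, lam1p, lam0m.
  assert (S1 : sqrt (v ^ 2 + (a - 1) ^ 2) <= Rabs x).
  { rewrite <- sqrt_Rsqr_abs. apply sqrt_le_1_alt. unfold Rsqr. lra. }
  assert (S2 : Rabs x <= sqrt (v ^ 2 + (a + 1) ^ 2)).
  { rewrite <- sqrt_Rsqr_abs. apply sqrt_le_1_alt. unfold Rsqr. lra. }
  destruct (Rle_dec 0 x).
  - rewrite Rabs_pos_eq in * by auto. right. lra.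
  - rewrite Rabs_left in * by lra. left. lra.
Qed.

Lemma mroot_le1 a v z : 0 < a -> exists m, mroot a v z m /\ Cmod m <= 1.
Proof.
  intros Ha. destruct (mroot_exists a v z Ha) as [m Hm].
  destruct (Rle_dec (Cmod m) 1) as [?|N]; [now exists m|].
  exists (/ m)%C. split; [now apply mroot_inv|]. rewrite Cmod_inv by apply Hm.
  rewrite <- Rinv_1. apply Rinv_le_contravar; lra.
Qed.

Lemma mroot_nonac a v z : 0 < a -> nonac a v z -> exists m, mroot a v z m /\ Cmod m < 1.
Proof.
  intros Ha Hz. destruct (mroot_le1 a v z Ha) as [m [Hm H1]]. exists m. split; auto.
  destruct (Req_dec (Cmod m) 1) as [E|]; [|lra]. exfalso. apply Hz.
  now apply (mroot_unit_sigma a v z m).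
Qed.

(** Holds for either root: when [|m| > 1], dividing the equation by [m] gives
    [a m = z^2 - v^2 - 1 - a^2 - a / m], whose last term is at most [a]. This is what makes the
    estimates insensitive to the sheet. *)
Lemma mroot_bound a v z m : 0 < a -> mroot a v z m ->
  Cmod m <= (Cmod z ^ 2 + (v ^ 2 + 1 + a ^ 2)) / a + 1.
Proof.
  intros Ha [Hm H]. assert (Hp : 0 < Cmod m) by now apply Cmod_gt_0.
  assert (P1 := pow2_ge_0 v). assert (P2 := pow2_ge_0 a). assert (P3 := pow2_ge_0 (Cmod z)).
  set (W := Cmod z ^ 2 + (v ^ 2 + 1 + a ^ 2)).
  assert (HW : 0 < W / a) by (apply Rdiv_lt_0_compat; unfold W; lra).
  destruct (Rle_dec (Cmod m) 1) as [?|N]; [lra|].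
  assert (E : (RtoC a * m)%C = ((z * z - RtoC (v ^ 2 + 1 + a ^ 2)) - RtoC a * / m)%C).
  { replace (z * z - RtoC (v ^ 2 + 1 + a ^ 2))%C with
      ((z * z - RtoC (v ^ 2 + 1 + a ^ 2)) * m * / m)%C by (field; auto).
    rewrite <- H. field. auto. }
  apply (f_equal Cmod) in E. rewrite Cmod_mult, Cmod_R, Rabs_pos_eq in E by lra.
  assert (T1 := Cmod_triangle (z * z - RtoC (v ^ 2 + 1 + a ^ 2)) (- (RtoC a * / m))).
  assert (T2 := Cmod_triangle (z * z) (- RtoC (v ^ 2 + 1 + a ^ 2))).
  rewrite Cmod_opp, Cmod_mult in T1, T2. rewrite Cmod_R in T1, T2.
  rewrite Rabs_pos_eq in T1, T2 by lra. rewrite Cmod_inv in T1 by auto.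
  assert (I : / Cmod m <= 1) by (rewrite <- Rinv_1; apply Rinv_le_contravar; lra).
  assert (a * Cmod m <= W + a).
  { rewrite E. unfold W. unfold Cminus in *. nra. }
  apply (Rmult_le_reg_l a); auto. replace (a * (W / a + 1)) with (W + a) by (field; lra). auto.
Qed.

Lemma cont_mult f g z : cont f z -> cont g z -> cont (fun x => f x * g x)%C z.
Proof.
  intros Hf Hg e He.
  assert (K1 := Cmod_ge_0 (f z)). assert (K2 := Cmod_ge_0 (g z)).
  set (A := Cmod (f z) + 1). set (B := Cmod (g z) + 1).
  destruct (Hf (e / (2 * B))) as [d1 [P1 Q1]]; [apply Rdiv_lt_0_compat; unfold B; lra|].
  destruct (Hg (Rmin 1 (e / (2 * A)))) as [d2 [P2 Q2]].
  { apply Rmin_pos; [lra|apply Rdiv_lt_0_compat; unfold A; lra]. }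
  exists (Rmin d1 d2). split; [now apply Rmin_pos|]. intros w Hw.
  specialize (Q1 w (Rlt_le_trans _ _ _ Hw (Rmin_l _ _))).
  specialize (Q2 w (Rlt_le_trans _ _ _ Hw (Rmin_r _ _))).
  assert (Q3 := Rlt_le_trans _ _ _ Q2 (Rmin_l _ _)). assert (Q4 := Rlt_le_trans _ _ _ Q2 (Rmin_r _ _)).
  replace (f w * g w - f z * g z)%C with ((f w - f z) * g w + f z * (g w - g z))%C by ring.
  eapply Rle_lt_trans; [apply Cmod_triangle|]. rewrite !Cmod_mult.
  assert (T := Cmod_triangle (g w - g z) (g z)). replace (g w - g z + g z)%C with (g w) in T by ring.
  assert (T' : Cmod (g w) <= B) by (unfold B; lra).
  apply Rlt_div_r in Q1; [|unfold B; lra]. apply Rlt_div_r in Q4; [|unfold A; lra].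
  assert (S1 := Cmod_ge_0 (f w - f z)). assert (S2 := Cmod_ge_0 (g w - g z)).
  assert (Cmod (f w - f z) * Cmod (g w) <= Cmod (f w - f z) * B) by (apply Rmult_le_compat_l; auto).
  assert (Cmod (f z) * Cmod (g w - g z) <= A * Cmod (g w - g z)) by (apply Rmult_le_compat_r; unfold A; lra).
  lra.
Qed.

Lemma cont_comp f g z : cont f (g z) -> cont g z -> cont (fun x => f (g x)) z.
Proof.
  intros Hf Hg e He. destruct (Hf e He) as [d [Hd H]]. destruct (Hg d Hd) as [d' [Hd' H']].
  exists d'. split; auto.
Qed.

(** A selection of roots is holomorphic as soon as it keeps away from the competing root [1 / M z];
    no branch of a square root has to be constructed. The difference quotient is explicit, since [a
    (M w - M z) (M z M w - 1) = (w - z) (w + z) M z M w]. *)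
Lemma mroot_branch_holo a v (M : C -> C) (z : C) r c : 0 < a -> 0 < r -> 0 < c ->
  (forall w, Cmod (w - z) < r -> mroot a v w (M w)) ->
  (forall w, Cmod (w - z) < r -> c <= Cmod (M z * M w - 1)) -> holo M z.
Proof.
  intros Ha Hr Hc HM Hlow.
  assert (Ha' : RtoC a <> 0) by (intros E; apply (f_equal fst) in E; simpl in E; lra).
  assert (Hzz : Cmod (z - z) < r).
  { replace (z - z)%C with (RtoC 0) by ring. now rewrite Cmod_0. }
  assert (Hn : forall w, Cmod (w - z) < r -> (M z * M w - 1)%C <> 0).
  { intros w Hw. apply Cmod_gt_0. specialize (Hlow w Hw). lra. }
  set (g := fun w => ((w + z) * (M z * M w) * / (RtoC a * (M z * M w - 1)))%C).
  assert (E : forall w, Cmod (w - z) < r -> (M w - M z)%C = ((w - z) * g w)%C).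
  { intros w Hw. destruct (HM z Hzz) as [N1 R1]. destruct (HM w Hw) as [N2 R2].
    assert (F : (RtoC a * ((M w - M z) * (M z * M w - 1)))%C = ((w - z) * (w + z) * (M z * M w))%C).
    { replace (RtoC a * ((M w - M z) * (M z * M w - 1)))%C with
        (M z * (RtoC a * (M w * M w + 1)) - M w * (RtoC a * (M z * M z + 1)))%C by ring.
      rewrite R1, R2. ring. }
    unfold g. replace (M w - M z)%C with
      (RtoC a * ((M w - M z) * (M z * M w - 1)) / (RtoC a * (M z * M w - 1)))%C by (field; auto).
    rewrite F. field. auto. }
  (* Boundedness of [g] yields continuity of [M], this in turn continuity of [g], and [g z] is the
     derivative. *)
  assert (CM : cont M z).
  { set (K := (Cmod z + 1) ^ 2). set (B := (K + (v ^ 2 + 1 + a ^ 2)) / a + 1).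
    assert (Kz := Cmod_ge_0 z). assert (P1 := pow2_ge_0 v). assert (P2 := pow2_ge_0 a).
    assert (KB : forall w, Cmod (w - z) < Rmin r 1 -> Cmod (M w) <= B /\ Cmod (w + z) <= 2 * Cmod z + 1).
    { intros w Hw. assert (W1 := Rlt_le_trans _ _ _ Hw (Rmin_l _ _)).
      assert (W2 := Rlt_le_trans _ _ _ Hw (Rmin_r _ _)).
      assert (T := Cmod_triangle (w - z) z). replace (w - z + z)%C with w in T by ring.
      assert (T2 := Cmod_triangle w z). assert (T3 := Cmod_ge_0 w). split; [|lra].
      eapply Rle_trans; [apply (mroot_bound a v w (M w) Ha (HM w W1))|].
      unfold B, K. apply Rplus_le_compat_r. apply Rmult_le_compat_r; [left; now apply Rinv_0_lt_compat|].
      apply Rplus_le_compat_r. apply pow_incr. lra. }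
    assert (HB0 : 0 < B).
    { unfold B. assert (0 < (K + (v ^ 2 + 1 + a ^ 2)) / a); [|lra].
      apply Rdiv_lt_0_compat; auto. assert (0 <= K) by apply pow2_ge_0. lra. }
    set (L := (2 * Cmod z + 1) * (B * B) / (a * c)).
    assert (HL : 0 < L).
    { unfold L. apply Rdiv_lt_0_compat; repeat apply Rmult_lt_0_compat; lra. }
    intros e He. exists (Rmin (Rmin r 1) (e / L)). split.
    { repeat apply Rmin_pos; try lra. now apply Rdiv_lt_0_compat. }
    intros w Hw. assert (W1 := Rlt_le_trans _ _ _ Hw (Rmin_l _ _)).
    assert (W2 := Rlt_le_trans _ _ _ Hw (Rmin_r _ _)). assert (W3 := Rlt_le_trans _ _ _ W1 (Rmin_l _ _)).
    rewrite E, Cmod_mult by auto. apply Rlt_div_r in W2; auto.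
    eapply Rle_lt_trans; [|exact W2]. apply Rmult_le_compat_l; [apply Cmod_ge_0|].
    unfold g, L. rewrite !Cmod_mult, Cmod_inv, Cmod_mult, Cmod_R, Rabs_pos_eq.
    2: lra. 2:{ apply Cmult_neq_0; auto. }
    destruct (KB w W1) as [KB1 KB2].
    assert (W0 : Cmod (z - z) < Rmin r 1).
    { replace (z - z)%C with (RtoC 0) by ring. rewrite Cmod_0. apply Rmin_pos; lra. }
    destruct (KB z W0) as [KB3 _]. specialize (Hlow w W3).
    apply Rmult_le_compat.
    - repeat apply Rmult_le_pos; apply Cmod_ge_0.
    - left. apply Rinv_0_lt_compat. apply Rmult_lt_0_compat; lra.
    - apply Rmult_le_compat; auto; try apply Cmod_ge_0.
      + apply Rmult_le_pos; apply Cmod_ge_0.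
      + apply Rmult_le_compat; auto; apply Cmod_ge_0.
    - apply Rinv_le_contravar; [now apply Rmult_lt_0_compat|]. apply Rmult_le_compat_l; lra. }
  assert (Cg : cont g z).
  { unfold g. apply cont_mult; [apply cont_mult|].
    - apply holo_cont, holo_plus; [apply holo_id|apply holo_const].
    - apply cont_mult; auto. apply holo_cont, holo_const.
    - apply (cont_comp Cinv (fun w => RtoC a * (M z * M w - 1))%C).
      + apply holo_cont, holo_inv. apply Cmult_neq_0; auto.
      + apply cont_mult; [apply holo_cont, holo_const|]. apply cont_plus; [|apply holo_cont, holo_const].
        apply cont_mult; auto. apply holo_cont, holo_const. }
  apply Cdiff_holo. exists (g z).
  change Defs.Cmod with Cmod; change Csub with Cminus; change Cadd with Cplus;
    change Cmul with Cmult.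
  intros eps He. destruct (Cg eps He) as [d [Hd Hg]].
  exists (Rmin d r). split; [now apply Rmin_pos|]. refine (fun (h : C) Hh => _). destruct Hh as [Hh1 Hh2].
  assert (Eh : (z + h - z)%C = h) by ring.
  specialize (E (z + h)%C). specialize (Hg (z + h)%C). rewrite Eh in E, Hg.
  rewrite E by (eapply Rlt_le_trans; [exact Hh2|apply Rmin_r]).
  replace (h * g (z + h) - g z * h)%C with ((g (z + h) - g z) * h)%C by ring.
  rewrite Cmod_mult. apply Rmult_le_compat_r; [apply Cmod_ge_0|]. left. apply Hg.
  eapply Rlt_le_trans; [exact Hh2|apply Rmin_l].
Qed.

(** * Jost solution and Green function *)

(** Generated inductively instead of given by coefficients, as only two properties of polynomials in
    [z] and [m] matter: holomorphy along a holomorphic branch of [m], and boundedness on bounded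
    sets. *)
Inductive poly2 : (C -> C -> C) -> Prop :=
| poly2_const c : poly2 (fun _ _ => c)
| poly2_z : poly2 (fun z _ => z)
| poly2_m : poly2 (fun _ m => m)
| poly2_plus F G : poly2 F -> poly2 G -> poly2 (fun z m => F z m + G z m)%C
| poly2_mult F G : poly2 F -> poly2 G -> poly2 (fun z m => F z m * G z m)%C.

Lemma poly2_holo F M z : poly2 F -> holo M z -> holo (fun x => F x (M x)) z.
Proof.
  intros HF HM. induction HF.
  - apply holo_const.
  - apply holo_id.
  - exact HM.
  - now apply holo_plus.
  - now apply holo_mult.
Qed.

Lemma poly2_bounded F : poly2 F -> forall Rz B, exists K, 0 <= K /\
  forall z m, Cmod z <= Rz -> Cmod m <= B -> Cmod (F z m) <= K.
Proof.
  intros HF Rz B. induction HF as [c| | |F G _ [K [HK H]] _ [L [HL H']]|F G _ [K [HK H]] _ [L [HL H']]].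
  - exists (Cmod c). split; [apply Cmod_ge_0|]. intros; lra.
  - exists (Rmax Rz 0). split; [apply Rmax_r|]. intros. assert (T := Rmax_l Rz 0). lra.
  - exists (Rmax B 0). split; [apply Rmax_r|]. intros. assert (T := Rmax_l B 0). lra.
  - exists (K + L). split; [lra|]. intros z m Hz Hm. eapply Rle_trans; [apply Cmod_triangle|].
    specialize (H z m Hz Hm). specialize (H' z m Hz Hm). lra.
  - exists (K * L). split; [now apply Rmult_le_pos|]. intros z m Hz Hm. rewrite Cmod_mult.
    apply Rmult_le_compat; auto; apply Cmod_ge_0.
Qed.

Lemma poly2_minus F G : poly2 F -> poly2 G -> poly2 (fun z m => F z m + (- (1)) * G z m)%C.
Proof. intros HF HG. apply poly2_plus; auto. apply poly2_mult; auto. apply poly2_const. Qed.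

Fixpoint csum (u : nat -> C) (n : nat) : C :=
  match n with O => RtoC 0 | S k => (csum u k + u (S k))%C end.

Lemma poly2_csum (F : nat -> C -> C -> C) N : (forall n, poly2 (F n)) ->
  poly2 (fun z m => csum (fun n => F n z m) N).
Proof.
  intros H. induction N as [|N IH]; simpl; [apply poly2_const|]. now apply poly2_plus.
Qed.

Lemma csum_ext u w N : (forall n, (1 <= n <= N)%nat -> u n = w n) -> csum u N = csum w N.
Proof.
  intros H. induction N as [|N IH]; simpl; auto. rewrite IH, H by (intros; try apply H; lia).
  reflexivity.
Qed.

Lemma csum_scal c u N : csum (fun n => c * u n)%C N = (c * csum u N)%C.
Proof. induction N as [|N IH]; simpl; [ring|]. rewrite IH. ring. Qed.

(* The three-term relation at site [S n], in which the value at index 0 does occur. *)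
Definition site (A V : nat -> R) (z : C) (y : nat -> C) (n : nat) : C :=
  (RtoC (A n) * y n + RtoC (A (S n)) * y (S (S n)) + (RtoC (V (S n)) - z) * y (S n))%C.

(** Solving downwards from sites [N] and [S N] divides only by the real numbers [A n], so polynomial
    data at the end give polynomial values everywhere. *)
Lemma back_exists A V f N : (forall n, A n <> 0) ->
  forall X Y, poly2 X -> poly2 Y -> exists y : nat -> C -> C -> C,
  (forall n, poly2 (y n)) /\ y N = X /\ y (S N) = Y /\
  forall z m n, (n < N)%nat -> site A V z (fun k => y k z m) n = f (S n).
Proof.
  intros HA. induction N as [|N IH]; intros X Y HX HY.
  - exists (fun n => match n with O => X | _ => Y end). repeat split; auto.
    + intros [|n]; auto.
    + intros; lia.
  - set (X' := fun z m : C => (RtoC (/ A N) * (f (S N) + (- (1)) * (RtoC (A (S N)) * Y z m +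
       (RtoC (V (S N)) + (- (1)) * z) * X z m)))%C).
    assert (HX' : poly2 X').
    { unfold X'. repeat (apply poly2_mult || apply poly2_plus || apply poly2_const || apply poly2_z || auto). }
    destruct (IH X' X HX' HX) as [y [H1 [H2 [H3 H4]]]].
    exists (fun n => if Nat.leb n (S N) then y n else Y). repeat split.
    + intros n. destruct (Nat.leb n (S N)); auto.
    + rewrite Nat.leb_refl. auto.
    + replace (Nat.leb (S (S N)) (S N)) with false by (symmetry; apply Nat.leb_gt; lia). auto.
    + intros z m n Hn. destruct (Nat.eq_dec n N) as [->|Hne].
      * unfold site. rewrite Nat.leb_refl.
        replace (Nat.leb N (S N)) with true by (symmetry; apply Nat.leb_le; lia).
        replace (Nat.leb (S (S N)) (S N)) with false by (symmetry; apply Nat.leb_gt; lia).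
        rewrite H2, H3. unfold X'. rewrite RtoC_inv by auto. field.
        intros E. apply (f_equal fst) in E. exact (HA _ E).
      * unfold site.
        replace (Nat.leb n (S N)) with true by (symmetry; apply Nat.leb_le; lia).
        replace (Nat.leb (S n) (S N)) with true by (symmetry; apply Nat.leb_le; lia).
        replace (Nat.leb (S (S n)) (S N)) with true by (symmetry; apply Nat.leb_le; lia).
        apply H4. lia.
Qed.

Lemma site_unique A V z y N : (forall n, A n <> 0) -> y N = RtoC 0 -> y (S N) = RtoC 0 ->
  (forall n, (n < N)%nat -> site A V z y n = 0) -> forall n, (n <= S N)%nat -> y n = 0.
Proof.
  intros HA. induction N as [|N IH]; intros H1 H2 H n Hn.
  - destruct n as [|[|n]]; auto; lia.
  - assert (E : y N = 0).
    { specialize (H N (Nat.lt_succ_diag_r N)). unfold site in H. rewrite H1, H2 in H.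
      assert (HN : RtoC (A N) <> 0) by (intros E; apply (f_equal fst) in E; exact (HA _ E)).
      destruct (classic (y N = 0)) as [?|F]; auto. exfalso. apply (Cmult_neq_0 _ _ HN F). rewrite <- H. ring. }
    destruct (Nat.eq_dec n (S (S N))) as [->|]; auto. apply IH; auto. lia.
Qed.

(** The invariant carried downwards is [|y (S j)| <= K |y j|]. At the next site it gives [(2 K + 2)
    |y (S j)| <= 2 |y j| + 2 K |y (S j)|], hence [|y (S j)| <= |y j|], which restores the invariant
    because [K >= 1]. *)
Lemma site_domination A V z (y : nat -> C) p K : 1 <= K ->
  (forall n, 0 < A n <= 2) ->
  (forall n, (n < p)%nat -> site A V z y n = 0) ->
  (forall j, (1 <= j <= p)%nat -> 2 * K + 2 <= Cmod (RtoC (V j) - z)) ->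
  Cmod (y (S p)) <= K * Cmod (y p) -> Cmod (y p) <= Cmod (y 0%nat).
Proof.
  intros HK HA Hs HV Hp.
  assert (G : forall k, (k <= p)%nat ->
     Cmod (y p) <= Cmod (y (p - k)%nat) /\ Cmod (y (S (p - k))) <= K * Cmod (y (p - k)%nat)).
  { induction k as [|k IH]; intros Hk.
    - rewrite Nat.sub_0_r. split; [lra|auto].
    - destruct IH as [I1 I2]; [lia|]. set (j := (p - S k)%nat).
      replace (p - k)%nat with (S j) in I1, I2 by lia.
      assert (E := Hs j ltac:(lia)). unfold site in E.
      specialize (HV (S j) ltac:(lia)).
      destruct (HA j) as [A1 A2]. destruct (HA (S j)) as [A3 A4].
      assert (E2 : ((RtoC (V (S j)) - z) * y (S j))%C =
         (- (RtoC (A j) * y j + RtoC (A (S j)) * y (S (S j))))%C).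
      { apply Cminus_eq0. rewrite <- E. ring. }
      apply (f_equal Cmod) in E2. rewrite Cmod_opp, Cmod_mult in E2.
      assert (T := Cmod_triangle (RtoC (A j) * y j) (RtoC (A (S j)) * y (S (S j)))).
      rewrite !Cmod_mult, !Cmod_R, !Rabs_pos_eq in T by lra.
      assert (P1 := Cmod_ge_0 (y j)). assert (P2 := Cmod_ge_0 (y (S j))). assert (P3 := Cmod_ge_0 (y (S (S j)))).
      assert ((2 * K + 2) * Cmod (y (S j)) <= 2 * Cmod (y j) + 2 * (K * Cmod (y (S j)))) by nra.
      split; nra. }
  destruct (G p (le_n p)) as [G1 _]. now rewrite Nat.sub_diag in G1.
Qed.

Lemma acoef_pos a n : 0 < a -> 0 < acoef a n.
Proof. intros. unfold acoef. destruct (Nat.even n); lra. Qed.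

Lemma acoef_SS a n : acoef a (S (S n)) = acoef a n.
Proof. reflexivity. Qed.
Lemma vcoef_SS v n : vcoef v (S (S n)) = vcoef v n.
Proof. reflexivity. Qed.
Lemma vcoef_S v n : vcoef v (S n) = - vcoef v n.
Proof. unfold vcoef. rewrite Nat.even_succ, <- Nat.negb_even. destruct (Nat.even n); simpl; ring. Qed.
Lemma vcoef_sq v n : vcoef v n ^ 2 = v ^ 2.
Proof. unfold vcoef. destruct (Nat.even n); ring. Qed.
Lemma acoef_prod a n : acoef a n * acoef a (S n) = a.
Proof. unfold acoef. rewrite Nat.even_succ, <- Nat.negb_even. destruct (Nat.even n); simpl; ring. Qed.
Lemma acoef_sumsq a n : acoef a n ^ 2 + acoef a (S n) ^ 2 = 1 + a ^ 2.
Proof. unfold acoef. rewrite Nat.even_succ, <- Nat.negb_even. destruct (Nat.even n); simpl; ring. Qed.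

Lemma vcoef_limit v p : vcoef v (S p) = (-1) ^ p * v.
Proof.
  induction p as [|p IH]; [simpl; unfold vcoef; simpl; ring|].
  rewrite vcoef_S, IH. simpl. ring.
Qed.

(* The value at site [p + k] of the Floquet solution with multiplier [m] over one period, normalised
   by [z - vcoef v (S p)] at site [p] so that it is polynomial in [z] and [m]. *)
Fixpoint floquet (a v : R) (p : nat) (k : nat) (z m : C) : C :=
  match k with
  | O => (z + RtoC (- vcoef v (S p)))%C
  | S O => (RtoC (acoef a p) + RtoC (acoef a (S p)) * m)%C
  | S (S k) => (m * floquet a v p k z m)%C
  end.

Lemma nat_ind2 (P : nat -> Prop) : P 0%nat -> P 1%nat -> (forall n, P n -> P (S (S n))) -> forall n, P n.
Proof.
  intros P0 P1 H n. assert (P n /\ P (S n)) as [? _]; auto.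
  induction n as [|n [I1 I2]]; split; auto.
Qed.

Lemma floquet_poly2 a v p k : poly2 (floquet a v p k).
Proof.
  induction k as [| |k IH] using nat_ind2; simpl.
  - apply poly2_plus; [apply poly2_z|apply poly2_const].
  - apply poly2_plus; [apply poly2_const|apply poly2_mult; [apply poly2_const|apply poly2_m]].
  - apply poly2_mult; [apply poly2_m|exact IH].
Qed.

(** At [k = 0] this is an identity, owing to the choice of the first two values; at [k = 1] it is
    the equation of the multiplier; later sites repeat these two, multiplied by [m]. *)
Lemma floquet_site a v p k z m : mroot a v z m ->
  (RtoC (acoef a (p + k)) * floquet a v p k z m +
   RtoC (acoef a (S (p + k))) * floquet a v p (S (S k)) z m +
   (RtoC (vcoef v (S (p + k))) - z) * floquet a v p (S k) z m)%C = 0.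
Proof.
  intros [Hm H]. induction k as [| |k IH] using nat_ind2.
  - rewrite Nat.add_0_r. simpl floquet. rewrite RtoC_opp. ring.
  - rewrite Nat.add_1_r, acoef_SS, vcoef_SS. simpl floquet.
    rewrite (vcoef_S v p). set (x := vcoef v p). set (s := acoef a p). set (t := acoef a (S p)).
    assert (E1 : (RtoC s * RtoC t)%C = RtoC a) by (rewrite <- RtoC_mult; f_equal; apply acoef_prod).
    assert (E2 : (RtoC s * RtoC s + RtoC t * RtoC t)%C = RtoC (1 + a ^ 2)).
    { rewrite <- !RtoC_mult, <- RtoC_plus. f_equal. rewrite <- (acoef_sumsq a p). unfold s, t. ring. }
    assert (E3 : (RtoC x * RtoC x)%C = RtoC (v ^ 2)).
    { rewrite <- RtoC_mult. f_equal. rewrite <- (vcoef_sq v p). unfold x. ring. }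
    replace (v ^ 2 + 1 + a ^ 2) with (v ^ 2 + (1 + a ^ 2)) in H by ring.
    rewrite RtoC_plus, <- E1, <- E2, <- E3 in H.
    rewrite Ropp_involutive.
    transitivity (RtoC s * RtoC t * (m * m + 1) -
      (z * z - (RtoC x * RtoC x + (RtoC s * RtoC s + RtoC t * RtoC t))) * m)%C; [ring|].
    rewrite H. ring.
  - replace (p + S (S k))%nat with (S (S (p + k))) by lia.
    rewrite !acoef_SS. rewrite (vcoef_SS v (S (p + k))).
    change (floquet a v p (S (S (S (S k)))) z m) with (m * floquet a v p (S (S k)) z m)%C.
    change (floquet a v p (S (S (S k))) z m) with (m * floquet a v p (S k) z m)%C.
    change (acoef a (S (S (S (p + k))))) with (acoef a (S (p + k))).
    change (floquet a v p (S (S k)) z m) with (m * floquet a v p k z m)%C at 1.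
    replace (RtoC 0) with (m * 0)%C by ring. rewrite <- IH.
    change (floquet a v p (S (S k)) z m) with (m * floquet a v p k z m)%C. ring.
Qed.

(** The backward solution below [p] is glued to the Floquet values above. The modulus of [m] does
    not enter, so the same [psi] taken at the other root belongs to the second sheet. *)
Lemma jost_exists a v p q : 0 < a -> (forall n, (p < n)%nat -> q n = 0) ->
  exists psi : nat -> C -> C -> C, (forall n, poly2 (psi n)) /\
  (forall k, psi (p + k)%nat = floquet a v p k) /\
  forall z m, mroot a v z m -> forall n,
    site (acoef a) (fun n => vcoef v n + q n) z (fun k => psi k z m) n = 0.
Proof.
  intros Ha Hq.
  destruct (back_exists (acoef a) (fun n => vcoef v n + q n) (fun _ => RtoC 0) p) with
    (X := floquet a v p 0) (Y := floquet a v p 1) as [y [H1 [H2 [H3 H4]]]].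
  { intros n. apply Rgt_not_eq, acoef_pos, Ha. } { apply floquet_poly2. } { apply floquet_poly2. }
  set (psi := fun n => if Nat.leb n p then y n else floquet a v p (n - p)).
  assert (Hle : forall n, (n <= p)%nat -> psi n = y n).
  { intros n Hn. unfold psi. replace (Nat.leb n p) with true by (symmetry; apply Nat.leb_le; lia). auto. }
  assert (Hge : forall k, psi (p + k)%nat = floquet a v p k).
  { intros [|k].
    - rewrite Nat.add_0_r, Hle by lia. auto.
    - unfold psi. replace (Nat.leb (p + S k) p) with false by (symmetry; apply Nat.leb_gt; lia).
      f_equal. lia. }
  assert (HS : psi (S p) = y (S p)).
  { replace (S p) with (p + 1)%nat by lia. rewrite Hge. replace (p + 1)%nat with (S p) by lia. auto. }
  exists psi. split; [|split; [exact Hge|]].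
  - intros n. unfold psi. destruct (Nat.leb n p); auto. apply floquet_poly2.
  - intros z m Hm n. destruct (Nat.lt_ge_cases n p) as [L|L].
    + specialize (H4 z m n L). unfold site in *. rewrite (Hle n) by lia. rewrite (Hle (S n)) by lia.
      destruct (Nat.eq_dec (S n) p) as [E|N].
      * rewrite E in *. rewrite HS. exact H4.
      * rewrite (Hle (S (S n))) by lia. exact H4.
    + replace n with (p + (n - p))%nat by lia. set (k := (n - p)%nat). unfold site.
      rewrite Hq, Rplus_0_r by lia.
      replace (S (S (p + k))) with (p + S (S k))%nat by lia. rewrite (Hge k), (Hge (S (S k))).
      rewrite <- (floquet_site a v p k z m Hm). 
      replace (psi (S (p + k))) with (floquet a v p (S k)); [reflexivity|].
      rewrite <- Hge. f_equal. lia.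
Qed.

(* [Jop] ignores the value at index 0, whereas [site] reads it as a boundary condition. *)
Definition dirichlet (u : nat -> C) (n : nat) : C := match n with O => RtoC 0 | _ => u n end.

Lemma site_dirichlet a v q (z : C) (u : nat -> C) n :
  site (acoef a) (fun n => vcoef v n + q n) z (dirichlet u) n =
  Csub (Jop a v q u (S n)) (Cmul z (u (S n))).
Proof.
  change Csub with Cminus; change Cmul with Cmult. unfold site, Jop.
  change Cadd with Cplus; change Cmul with Cmult; change Defs.RtoC with RtoC.
  destruct n as [|n]; simpl dirichlet; ring.
Qed.

Lemma l2_tendsto_0 u : l2 u -> forall eps, 0 < eps ->
  exists n0, forall n, (n0 <= n)%nat -> Cmod (u n) < eps.
Proof.
  intros [l Hl] eps He.
  destruct (Hl (eps ^ 2 / 2)) as [N HN]; [assert (0 < eps ^ 2) by (now apply pow_lt); lra|].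
  exists (S (S N)). intros n Hn. destruct n as [|[|n]]; try lia.
  assert (E1 := HN n ltac:(lia)). assert (E2 := HN (S n) ltac:(lia)).
  simpl sum_f_R0 in E2. change Defs.Cmod with Cmod in *. unfold R_dist in *.
  set (x := sum_f_R0 _ n) in *. set (y := Cmod (u (S (S n)))) in *.
  assert (Hy : 0 <= y) by apply Cmod_ge_0.
  apply Rabs_def2 in E1. apply Rabs_def2 in E2. nra.
Qed.

(** The defect [d k] of the multiplier relation, two sites further for each [k], satisfies
    [d k = m * d (S k)]. As [|m| <= 1] its modulus cannot decrease, yet it tends to 0 with [u]. The
    case [|m| = 1] is included, so that eigenvalues on the bands are covered. *)
Lemma l2_tail a v q (z m : C) (u : nat -> C) N : 0 < a -> mroot a v z m -> Cmod m <= 1 -> l2 u ->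
  (forall n, (N < n)%nat -> q n = 0) ->
  (forall n, (N <= n)%nat -> site (acoef a) (fun n => vcoef v n + q n) z u n = 0) ->
  u (S (S N)) = (m * u N)%C.
Proof.
  intros Ha [Hm H] Hm1 Hl Hq Hs.
  assert (Ha' : RtoC a <> 0) by (intros E; apply (f_equal fst) in E; simpl in E; lra).
  set (d := fun k => (u (S (S (N + 2 * k))) - m * u (N + 2 * k)%nat)%C).
  assert (Hd : forall k, d k = (m * d (S k))%C).
  { intros k. set (n := (N + 2 * k)%nat).
    assert (E1 := Hs n ltac:(lia)). assert (E2 := Hs (S n) ltac:(lia)). assert (E3 := Hs (S (S n)) ltac:(lia)).
    unfold site in E1, E2, E3. rewrite !Hq, !Rplus_0_r in E1, E2, E3 by lia.
    rewrite (acoef_SS a n), (vcoef_SS v n) in E2.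
    rewrite (acoef_SS a (S n)), (acoef_SS a n), (vcoef_SS v (S n)) in E3.
    rewrite (vcoef_S v n) in E1, E3.
    unfold d. replace (N + 2 * S k)%nat with (S (S n)) by lia. fold n.
    set (x := vcoef v n) in *. set (s := acoef a n) in *. set (t := acoef a (S n)) in *.
    assert (F1 : (RtoC s * RtoC t)%C = RtoC a) by (rewrite <- RtoC_mult; f_equal; apply acoef_prod).
    assert (F2 : (RtoC s * RtoC s + RtoC t * RtoC t)%C = RtoC (1 + a ^ 2)).
    { rewrite <- !RtoC_mult, <- RtoC_plus. f_equal. rewrite <- (acoef_sumsq a n). unfold s, t. ring. }
    assert (F3 : (RtoC x * RtoC x)%C = RtoC (v ^ 2)).
    { rewrite <- RtoC_mult. f_equal. rewrite <- (vcoef_sq v n). unfold x. ring. }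
    replace (v ^ 2 + 1 + a ^ 2) with (v ^ 2 + (1 + a ^ 2)) in H by ring.
    rewrite RtoC_plus, <- F2, <- F3 in H.
    rewrite RtoC_opp in E1, E3.
    set (s0 := u n) in *. set (u1 := u (S n)) in *. set (s1 := u (S (S n))) in *.
    set (u3 := u (S (S (S n)))) in *. set (s2 := u (S (S (S (S n))))) in *.
    (* Combining three consecutive relations with weights [t], [x + z] and [s] eliminates the
       intermediate sites and leaves the recurrence over one period. *)
    assert (E : (RtoC a * (s0 + s2))%C =
       ((z * z - (RtoC x * RtoC x + (RtoC s * RtoC s + RtoC t * RtoC t))) * s1)%C).
    { apply Cminus_eq0. rewrite <- F1.
      transitivity (RtoC t * (RtoC s * s0 + RtoC t * s1 + (- RtoC x - z) * u1) +
        (RtoC x + z) * (RtoC t * u1 + RtoC s * u3 + (RtoC x - z) * s1) +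
        RtoC s * (RtoC s * s1 + RtoC t * s2 + (- RtoC x - z) * u3))%C; [ring|].
      rewrite E1, E2, E3. ring. }
    apply Cminus_eq0.
    assert (G : (RtoC a * (s1 - m * s0 - m * (s2 - m * s1)))%C = 0).
    { transitivity (RtoC a * (m * m + 1) * s1 - m * (RtoC a * (s0 + s2)))%C; [ring|].
      rewrite H, E. ring. }
    destruct (classic ((s1 - m * s0 - m * (s2 - m * s1))%C = 0)) as [?|F]; auto.
    exfalso. exact (Cmult_neq_0 _ _ Ha' F G). }
  assert (Hmono : forall k, Cmod (d 0%nat) <= Cmod (d k)).
  { induction k as [|k IH]; [lra|]. rewrite (Hd k), Cmod_mult in IH.
    assert (T := Cmod_ge_0 (d (S k))). nra. }
  apply Cminus_eq0. replace (u (S (S N)) - m * u N)%C with (d 0%nat).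
  2:{ unfold d. now replace (N + 2 * 0)%nat with N by lia. }
  apply Cmod_eq_0, Rle_antisym; [|apply Cmod_ge_0]. apply Rnot_lt_le. intros Hp.
  destruct (l2_tendsto_0 u Hl (Cmod (d 0%nat) / 4)) as [n0 Hn0]; [lra|].
  specialize (Hmono n0). unfold d at 2 in Hmono.
  assert (T := Cmod_triangle (u (S (S (N + 2 * n0)))) (- (m * u (N + 2 * n0)%nat))).
  rewrite Cmod_opp, Cmod_mult in T.
  assert (T1 := Hn0 (S (S (N + 2 * n0))) ltac:(lia)). assert (T2 := Hn0 (N + 2 * n0)%nat ltac:(lia)).
  assert (T3 := Cmod_ge_0 (u (N + 2 * n0)%nat)).
  unfold Cminus in Hmono. nra.
Qed.

Lemma floquet_even a v p k z m :
  floquet a v p (2 * k) z m = (m ^ k * floquet a v p 0 z m)%C /\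
  floquet a v p (S (2 * k)) z m = (m ^ k * floquet a v p 1 z m)%C.
Proof.
  induction k as [|k [I1 I2]].
  - split; simpl; ring.
  - replace (2 * S k)%nat with (S (S (2 * k))) by lia.
    change (floquet a v p (S (S (2 * k))) z m) with (m * floquet a v p (2 * k) z m)%C.
    change (floquet a v p (S (S (S (2 * k)))) z m) with (m * floquet a v p (S (2 * k)) z m)%C.
    rewrite I1, I2. simpl Cpow. split; ring.
Qed.

(** [N] has the parity of [p], so [psi N] is [m ^ k] times [z - vcoef v (S p)], which does not
    vanish, and [c] can be read off at [N]. The relation at site [S N] together with [l2_tail] fixes
    the value there, and two consecutive values determine a solution backwards. *)
Lemma green_decomposition a v p q (psi : nat -> C -> C -> C) (z m : C) (u b f : nat -> C) k :
  let N := (p + 2 * k)%nat in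
  0 < a -> mroot a v z m -> Cmod m <= 1 -> l2 u ->
  (forall n, (p < n)%nat -> q n = 0) -> (forall n, (N < n)%nat -> f n = 0) ->
  (forall k, psi (p + k)%nat = floquet a v p k) ->
  (forall n, site (acoef a) (fun n => vcoef v n + q n) z (fun k => psi k z m) n = 0) ->
  (forall n, (n < N)%nat -> site (acoef a) (fun n => vcoef v n + q n) z b n = f (S n)) ->
  b N = RtoC 0 -> b (S N) = RtoC 0 ->
  (forall n, site (acoef a) (fun n => vcoef v n + q n) z u n = f (S n)) ->
  z <> RtoC (vcoef v (S p)) ->
  exists c, forall n, (n <= S N)%nat -> u n = (c * psi n z m + b n)%C.
Proof.
  intros N Ha Hm Hm1 Hl Hq Hf Hpsi Hps Hb Hb1 Hb2 Hu Hz.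
  assert (Hzz : (z + RtoC (- vcoef v (S p)))%C <> 0).
  { intros E. apply Hz. apply Cminus_eq0. rewrite <- E, RtoC_opp. ring. }
  assert (Hmk : (m ^ k)%C <> 0) by (apply Cpow_nz, Hm).
  destruct (floquet_even a v p k z m) as [F1 F2]. rewrite <- (Hpsi (2 * k)%nat) in F1. rewrite <- (Hpsi (S (2 * k))) in F2.
  replace (p + S (2 * k))%nat with (S N) in F2 by lia. fold N in F1. simpl floquet in F1, F2.
  assert (Ht : u (S (S N)) = (m * u N)%C).
  { apply (l2_tail a v q z m u N Ha Hm Hm1 Hl).
    - intros n Hn. apply Hq. lia.
    - intros n Hn. rewrite Hu. apply Hf. lia. }
  set (X := (z + RtoC (- vcoef v (S p)))%C) in *.
  set (M := (m ^ k)%C) in *.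
  set (c := (u N / (M * X))%C).
  assert (E1 : u N = (c * psi N z m)%C).
  { rewrite F1. unfold c. field. auto. }
  assert (Hpar : acoef a N = acoef a p /\ acoef a (S N) = acoef a (S p) /\ vcoef v (S N) = vcoef v (S p)).
  { unfold N, acoef, vcoef. rewrite !Nat.even_succ, <- !Nat.negb_even, Nat.even_add_mul_2. auto. }
  destruct Hpar as [A1 [A2 A3]].
  assert (E2 : u (S N) = (c * psi (S N) z m)%C).
  { assert (S1 := Hu N). rewrite Hf in S1 by lia. unfold site in S1.
    rewrite Hq, Rplus_0_r, A1, A2, A3, Ht in S1 by lia.
    assert (S2 : (X * u (S N))%C = (RtoC (acoef a p) * u N + RtoC (acoef a (S p)) * (m * u N))%C).
    { symmetry. apply Cminus_eq0. rewrite <- S1. unfold X. rewrite RtoC_opp. ring. }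
    replace (u (S N)) with (X * u (S N) / X)%C by (field; auto).
    rewrite S2, F2. unfold c. field. auto. }
  exists c. intros n Hn. apply Cminus_eq0.
  apply (site_unique (acoef a) (fun n => vcoef v n + q n) z
    (fun n => u n - (c * psi n z m + b n))%C N); auto.
  - intros i. apply Rgt_not_eq, acoef_pos, Ha.
  - rewrite Hb1, E1. ring.
  - rewrite Hb2, E2. ring.
  - intros i Hi. specialize (Hu i). specialize (Hb i Hi). specialize (Hps i).
    unfold site in *. 
    replace (RtoC 0) with (f (S i) - c * 0 - f (S i))%C by ring.
    rewrite <- Hu at 1. rewrite <- Hps, <- Hb. ring.
Qed.

Lemma Un_cv_eventually_const (U : nat -> R) N c l :
  (forall n, (N <= n)%nat -> U n = c) -> Un_cv U l -> l = c.
Proof.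
  intros H Hl. apply (UL_sequence U); auto. intros e He. exists N. intros n Hn.
  rewrite H by lia. unfold R_dist. rewrite Rminus_diag, Rabs_R0. auto.
Qed.

Lemma csum_parts (x : nat -> C) n :
  fst (csum x (S n)) = sum_f_R0 (fun k => fst (x (S k))) n /\
  snd (csum x (S n)) = sum_f_R0 (fun k => snd (x (S k))) n.
Proof.
  induction n as [|n [I1 I2]].
  - simpl. split; ring.
  - change (csum x (S (S n))) with (csum x (S n) + x (S (S n)))%C.
    simpl sum_f_R0. rewrite <- I1, <- I2. split; reflexivity.
Qed.

Lemma csum_const (x : nat -> C) N n : (forall k, (N < k)%nat -> x k = 0) -> (N <= n)%nat ->
  csum x n = csum x N.
Proof.
  intros H Hn. induction Hn as [|n Hn IH]; auto. simpl. rewrite IH, H by lia. ring.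
Qed.

Lemma Cseries_finite (x : nat -> C) N w : (forall k, (N < k)%nat -> x k = 0) ->
  Cseries x w <-> w = csum x N.
Proof.
  intros H.
  assert (P : forall n, (N <= n)%nat ->
    sum_f_R0 (fun k => fst (x (S k))) n = fst (csum x N) /\
    sum_f_R0 (fun k => snd (x (S k))) n = snd (csum x N)).
  { intros n Hn. destruct (csum_parts x n) as [<- <-]. now rewrite (csum_const x N) by (auto; lia). }
  split.
  - intros [H1 H2]. apply Cext.
    + apply (Un_cv_eventually_const _ N _ _ (fun n Hn => proj1 (P n Hn)) H1).
    + apply (Un_cv_eventually_const _ N _ _ (fun n Hn => proj2 (P n Hn)) H2).
  - intros ->. split; intros e He; exists N; intros n Hn; destruct (P n Hn) as [P1 P2];
    rewrite ?P1, ?P2; unfold R_dist; rewrite Rminus_diag, Rabs_R0; auto.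
Qed.

(** The Dirichlet condition [0 = c psi_0 + b_0] eliminates the unknown [c]:
    [psi_0 u_n = psi_0 b_n - b_0 psi_n], where the right side is polynomial. The conclusion is kept
    free of division, so it also holds at zeros of [psi_0]; [num] depends on [f] and [g] but not on
    [z]. *)
Lemma green_exists a v p q : 0 < a -> (forall n, (p < n)%nat -> q n = 0) ->
  exists psi : nat -> C -> C -> C, (forall n, poly2 (psi n)) /\
  (forall k, psi (p + k)%nat = floquet a v p k) /\
  (forall z m, mroot a v z m -> forall n,
    site (acoef a) (fun n => vcoef v n + q n) z (fun k => psi k z m) n = 0) /\
  forall f g, fin_supp f -> fin_supp g -> exists num, poly2 num /\
    forall z m w, mroot a v z m -> Cmod m <= 1 -> z <> RtoC (vcoef v (S p)) ->
      resolv_val a v q f g z w -> (psi 0%nat z m * w)%C = num z m.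
Proof.
  intros Ha Hq. destruct (jost_exists a v p q Ha Hq) as [psi [P1 [P2 P3]]].
  exists psi. split; [exact P1|]. split; [exact P2|]. split; [exact P3|].
  intros f g [Nf Hf] [Ng Hg].
  (* Beyond the perturbation and both supports, and at an even distance from [p], as
     [green_decomposition] requires. *)
  set (N := (p + 2 * (Nf + Ng))%nat).
  destruct (back_exists (acoef a) (fun n => vcoef v n + q n) f N) with
    (X := fun _ _ : C => RtoC 0) (Y := fun _ _ : C => RtoC 0) as [b [H1 [H2 [H3 H4]]]].
  { intros n. apply Rgt_not_eq, acoef_pos, Ha. } { apply poly2_const. } { apply poly2_const. }
  exists (fun z m => csum (fun n => (psi 0%nat z m * b n z m + (- (1)) * (b 0%nat z m * psi n z m)) *
     Cconj (g n))%C N).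
  split.
  - apply (poly2_csum (fun n z m => (psi 0%nat z m * b n z m + (- (1)) * (b 0%nat z m * psi n z m)) *
     Cconj (g n))%C). intros n. apply poly2_mult; [|apply poly2_const].
    apply (poly2_minus (fun z m => psi 0%nat z m * b n z m)%C (fun z m => b 0%nat z m * psi n z m)%C);
      apply poly2_mult; auto.
  - intros z m w Hm Hm1 Hz [_ [u [Hl [Hu Hw]]]].
    destruct (green_decomposition a v p q psi z m (dirichlet u) (fun n => b n z m) f (Nf + Ng))
      as [c Hc]; auto.
    + intros n Hn. apply Hf. lia.
    + change (b N z m = RtoC 0). now rewrite H2.
    + change (b (S N) z m = RtoC 0). now rewrite H3.
    + intros n. rewrite site_dirichlet. apply Hu. lia.
    + change Cmul with Cmult in Hw. change Defs.Cconj with Cconj in Hw.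
      apply (Cseries_finite (fun n => u n * Cconj (g n))%C N) in Hw.
      2:{ intros k Hk. rewrite Hg by lia. apply Cext; simpl; ring. }
      rewrite Hw, <- csum_scal. apply csum_ext. intros n Hn.
      replace (u n) with (dirichlet u n) by (destruct n; [lia|reflexivity]).
      assert (E0 := Hc 0%nat ltac:(lia)). rewrite (Hc n ltac:(lia)). simpl in E0.
      assert (E : (c * psi 0%nat z m)%C = (- b 0%nat z m)%C).
      { apply Cminus_eq0. rewrite E0. ring. }
      transitivity ((c * psi 0%nat z m * psi n z m + psi 0%nat z m * b n z m) * Cconj (g n))%C; [ring|].
      rewrite E. ring.
Qed.

Lemma eigenvalue_jost_zero a v p q (psi : nat -> C -> C -> C) (z m : C) : 0 < a ->
  (forall n, (p < n)%nat -> q n = 0) ->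
  (forall k, psi (p + k)%nat = floquet a v p k) ->
  mroot a v z m -> Cmod m <= 1 -> z <> RtoC (vcoef v (S p)) ->
  (forall n, site (acoef a) (fun n => vcoef v n + q n) z (fun k => psi k z m) n = 0) ->
  eigenvalue a v q z -> psi 0%nat z m = 0.
Proof.
  intros Ha Hq H2 Hm Hm1 Hz H3 [u [Hl [[n [Hn Hne]] Hu]]].
  destruct (classic (psi 0%nat z m = 0)) as [?|H0]; auto. exfalso.
  (* Taking [n] periods makes the range long enough to contain the site [n] at which [u] is
     nonzero. *)
  destruct (green_decomposition a v p q psi z m (dirichlet u) (fun _ => RtoC 0) (fun _ => RtoC 0) n)
    as [c Hc]; auto.
  - intros i _. unfold site. ring.
  - intros i. rewrite site_dirichlet. rewrite Hu by lia.
    apply Cext; simpl; ring.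
  - assert (E0 := Hc 0%nat ltac:(lia)). simpl in E0.
    assert (E : c = 0).
    { destruct (classic (c = 0)) as [?|F]; auto. exfalso. apply (Cmult_neq_0 _ _ F H0).
      replace (c * psi 0%nat z m)%C with (c * psi 0%nat z m + 0)%C by ring. now rewrite <- E0. }
    apply Hne. change (u n = RtoC 0). replace (u n) with (dirichlet u n) by (destruct n; [lia|reflexivity]).
    rewrite Hc by lia. rewrite E. apply Cext; simpl; ring.
Qed.

(** * Resolvent at large spectral parameter *)

Definition sqnorm (y : nat -> C) (M : nat) : R := sum_f_R0 (fun k => Cmod (y (S k)) ^ 2) M.

Lemma l2_sqnorm_bounded y : l2 y -> exists B, 0 <= B /\ forall M, sqnorm y M <= B.
Proof.
  intros [l Hl].
  assert (G : Un_growing (sqnorm y)).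
  { intros n. unfold sqnorm. simpl sum_f_R0. assert (T := pow2_ge_0 (Cmod (y (S (S n))))). lra. }
  assert (L : forall M, sqnorm y M <= l) by (intros M; exact (growing_ineq _ _ G Hl M)).
  exists l. split; auto. specialize (L 0%nat). unfold sqnorm in L. simpl sum_f_R0 in L.
  assert (T := pow2_ge_0 (Cmod (y 1%nat))). lra.
Qed.

Lemma sqnorm_bounded_l2 y B : (forall M, sqnorm y M <= B) -> l2 y.
Proof.
  intros H. destruct (growing_cv (sqnorm y)) as [l Hl].
  - intros n. unfold sqnorm. simpl sum_f_R0. assert (T := pow2_ge_0 (Cmod (y (S (S n))))). lra.
  - exists B. intros x [n ->]. apply H.
  - exists l. exact Hl.
Qed.

Lemma sqnorm_S y n : sqnorm y (S n) = sqnorm y n + Cmod (y (S (S n))) ^ 2.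
Proof. reflexivity. Qed.

Lemma sqnorm_term y n B : sqnorm y n <= B -> Cmod (y (S n)) ^ 2 <= B.
Proof.
  destruct n as [|n]; intros H; [exact H|]. rewrite sqnorm_S in H.
  assert (0 <= sqnorm y n); [|lra]. apply cond_pos_sum. intros. apply pow2_ge_0.
Qed.

Lemma Cmod_triangle_sq (x y : C) : Cmod (x + y) ^ 2 <= 2 * (Cmod x ^ 2 + Cmod y ^ 2).
Proof.
  assert (T := Cmod_triangle x y). assert (P := Cmod_ge_0 (x + y)%C).
  assert (Cmod (x + y) ^ 2 <= (Cmod x + Cmod y) ^ 2) by (apply pow_incr; lra).
  assert (Q := pow2_ge_0 (Cmod x - Cmod y)). nra.
Qed.

Lemma sqnorm_combine (y w x : nat -> C) c B1 B2 : 0 <= c ->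
  (forall n, Cmod (x (S n)) ^ 2 <= c * (Cmod (y (S n)) ^ 2 + Cmod (w (S n)) ^ 2)) ->
  (forall M, sqnorm y M <= B1) -> (forall M, sqnorm w M <= B2) ->
  forall M, sqnorm x M <= c * (B1 + B2).
Proof.
  intros Hc H H1 H2 M. apply Rle_trans with (c * (sqnorm y M + sqnorm w M)).
  - unfold sqnorm. rewrite <- sum_plus, scal_sum. apply sum_Rle. intros n _. specialize (H n). lra.
  - apply Rmult_le_compat_l; auto. specialize (H1 M). specialize (H2 M). lra.
Qed.

(** At spectral parameter 0 [site] is the operator itself. One factor 3 comes from the square of a
    sum of three terms, the other from the three shifted copies of [y]. *)
Lemma site_sqnorm A V K y B : 0 <= K -> (forall n, Rabs (A n) <= K) -> (forall n, Rabs (V n) <= K) ->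
  y 0%nat = RtoC 0 -> (forall M, sqnorm y M <= B) ->
  forall M, sum_f_R0 (fun i => Cmod (site A V 0 y i) ^ 2) M <= 9 * K ^ 2 * B.
Proof.
  intros HK HA HV H0 HB M.
  assert (E1 : forall M, sum_f_R0 (fun i => Cmod (y i) ^ 2) M + Cmod (y (S M)) ^ 2 = sqnorm y M).
  { induction M0 as [|n IH].
    - unfold sqnorm. simpl sum_f_R0. rewrite H0, Cmod_0. ring.
    - rewrite tech5, sqnorm_S. lra. }
  assert (E2 : forall M, sum_f_R0 (fun i => Cmod (y (S (S i))) ^ 2) M + Cmod (y 1%nat) ^ 2 = sqnorm y (S M)).
  { induction M0 as [|n IH].
    - unfold sqnorm. simpl sum_f_R0. ring.
    - rewrite tech5, (sqnorm_S y (S n)). lra. }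
  assert (B1 := E1 M). assert (B2 := E2 M). assert (HB1 := HB M). assert (HB2 := HB (S M)).
  assert (P1 := pow2_ge_0 (Cmod (y (S M)))). assert (P2 := pow2_ge_0 (Cmod (y 1%nat))).
  apply Rle_trans with (sum_f_R0 (fun i => (Cmod (y i) ^ 2 + Cmod (y (S i)) ^ 2 + Cmod (y (S (S i))) ^ 2) * (3 * K ^ 2)) M).
  - apply sum_Rle. intros n _. unfold site.
    assert (T1 := Cmod_triangle (RtoC (A n) * y n + RtoC (A (S n)) * y (S (S n))) ((RtoC (V (S n)) - 0) * y (S n))).
    assert (T2 := Cmod_triangle (RtoC (A n) * y n) (RtoC (A (S n)) * y (S (S n)))).
    replace (RtoC (V (S n)) - 0)%C with (RtoC (V (S n))) in * by ring.
    rewrite !Cmod_mult, !Cmod_R in T1. rewrite !Cmod_mult, !Cmod_R in T2.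
    assert (A1 := HA n). assert (A2 := HA (S n)). assert (A3 := HV (S n)).
    assert (C1 := Cmod_ge_0 (y n)). assert (C2 := Cmod_ge_0 (y (S n))). assert (C3 := Cmod_ge_0 (y (S (S n)))).
    set (c1 := Cmod (y n)) in *. set (c2 := Cmod (y (S n))) in *. set (c3 := Cmod (y (S (S n)))) in *.
    assert (M1 : Rabs (A n) * c1 <= K * c1) by now apply Rmult_le_compat_r.
    assert (M2 : Rabs (A (S n)) * c3 <= K * c3) by now apply Rmult_le_compat_r.
    assert (M3 : Rabs (V (S n)) * c2 <= K * c2) by now apply Rmult_le_compat_r.
    apply Rle_trans with ((K * (c1 + c2 + c3)) ^ 2).
    + apply pow_incr. split; [apply Cmod_ge_0|]. lra.
    + rewrite Rpow_mult_distr. replace ((c1 ^ 2 + c2 ^ 2 + c3 ^ 2) * (3 * K ^ 2)) with (K ^ 2 * (3 * (c1 ^ 2 + c2 ^ 2 + c3 ^ 2))) by ring.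
      apply Rmult_le_compat_l; [apply pow2_ge_0|].
      assert (Q1 := pow2_ge_0 (c1 - c2)). assert (Q2 := pow2_ge_0 (c1 - c3)). assert (Q3 := pow2_ge_0 (c2 - c3)). nra.
  - rewrite <- scal_sum, !sum_plus. fold (sqnorm y M).
    replace (9 * K ^ 2 * B) with (3 * K ^ 2 * (B + B + B)) by ring.
    apply Rmult_le_compat_l; [assert (T := pow2_ge_0 K); lra|lra].
Qed.

(** Its fixed points are the solutions of [(J - z) y = h] with value 0 at index 0. By [site_sqnorm]
    it contracts squared norms by [9 / 144 = 1 / 16] once [|z| >= 12 K]. *)
Definition resolvent_step A V (z : C) (h y : nat -> C) (n : nat) : C :=
  match n with O => RtoC 0 | S i => ((site A V 0 y i - h (S i)) / z)%C end.

Lemma resolvent_step_sqnorm A V K (z : C) h y B : 1 <= K -> 12 * K <= Cmod z ->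
  (forall n, Rabs (A n) <= K) -> (forall n, Rabs (V n) <= K) ->
  y 0%nat = RtoC 0 -> (forall M, sqnorm y M <= B) -> (forall i, h (S i) = RtoC 0) ->
  forall M, sqnorm (resolvent_step A V z h y) M <= / 16 * B.
Proof.
  intros HK Hz HA HV H0 HB Hh M.
  assert (Hz0 : z <> 0). { apply Cmod_gt_0. lra. }
  assert (B0 : 0 <= B). { eapply Rle_trans; [apply (pow2_ge_0 (Cmod (y 1%nat)))|]. apply (sqnorm_term y 0), HB. }
  assert (S1 := site_sqnorm A V K y B ltac:(lra) HA HV H0 HB M).
  apply Rle_trans with (sum_f_R0 (fun i => Cmod (site A V 0 y i) ^ 2 * / (144 * K ^ 2)) M).
  - apply sum_Rle. intros n _. simpl resolvent_step. rewrite Hh.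
    replace (site A V 0 y n - 0)%C with (site A V 0 y n) by ring.
    rewrite Cmod_div by auto. unfold Rdiv. rewrite Rpow_mult_distr.
    apply Rmult_le_compat_l; [apply pow2_ge_0|]. rewrite pow_inv. apply Rinv_le_contravar; [nra|].
    replace (144 * K ^ 2) with ((12 * K) ^ 2) by ring. apply pow_incr. lra.
  - rewrite <- scal_sum. apply Rle_trans with (/ (144 * K ^ 2) * (9 * K ^ 2 * B)).
    + apply Rmult_le_compat_l; auto. left. apply Rinv_0_lt_compat. nra.
    + right. field. lra.
Qed.

Lemma resolvent_step_minus A V (z : C) h y w n : z <> 0 ->
  resolvent_step A V z (fun _ => RtoC 0) (fun i => (y i - w i)%C) n =
  (resolvent_step A V z h y n - resolvent_step A V z h w n)%C.
Proof. intros Hz. destruct n as [|n]; simpl; [ring|]. unfold site. field. auto. Qed.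

Lemma resolvent_step_bounded A V K (z : C) h y B : 1 <= K -> 12 * K <= Cmod z ->
  (forall n, Rabs (A n) <= K) -> (forall n, Rabs (V n) <= K) ->
  y 0%nat = RtoC 0 -> (forall M, sqnorm y M <= B) -> (forall M, sqnorm h M <= B) ->
  forall M, sqnorm (resolvent_step A V z h y) M <= B.
Proof.
  intros HK Hz HA HV H0 HB Hh M.
  assert (Hz0 : z <> 0). { apply Cmod_gt_0. lra. }
  assert (B0 : 0 <= B). { eapply Rle_trans; [apply (pow2_ge_0 (Cmod (y 1%nat)))|]. apply (sqnorm_term y 0), HB. }
  apply Rle_trans with (2 * (/ 16 * B + / 144 * B)); [|lra].
  apply (sqnorm_combine (resolvent_step A V z (fun _ => RtoC 0) y) (fun n => - h n / z)%C); [lra| | |].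
  - intros n. eapply Rle_trans; [|apply Cmod_triangle_sq]. right. do 2 f_equal. simpl. field. auto.
  - apply (resolvent_step_sqnorm A V K); auto.
  - intros M'. apply Rle_trans with (sum_f_R0 (fun i => Cmod (h (S i)) ^ 2 * / 144) M').
    + apply sum_Rle. intros n _. rewrite Cmod_div, Cmod_opp by auto. unfold Rdiv. rewrite Rpow_mult_distr.
      apply Rmult_le_compat_l; [apply pow2_ge_0|]. rewrite pow_inv. apply Rinv_le_contravar; [lra|].
      replace 144 with (12 ^ 2) by ring. apply pow_incr. lra.
    + rewrite <- scal_sum. apply Rmult_le_compat_l; [lra|]. apply Hh.
Qed.

Definition Clim (s : nat -> C) (l : C) : Prop :=
  is_lim_seq (fun k => fst (s k)) (fst l) /\ is_lim_seq (fun k => snd (s k)) (snd l).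

Lemma Clim_plus s t l m : Clim s l -> Clim t m -> Clim (fun k => s k + t k)%C (l + m)%C.
Proof.
  intros [H1 H2] [H3 H4]. split.
  - exact (is_lim_seq_plus' _ _ _ _ H1 H3).
  - exact (is_lim_seq_plus' _ _ _ _ H2 H4).
Qed.

Lemma is_lim_seq_scal_l' (c : R) u (l : R) : is_lim_seq u l -> is_lim_seq (fun k => c * u k) (c * l).
Proof. intros H. exact (is_lim_seq_mult' _ _ _ _ (is_lim_seq_const c) H). Qed.

Lemma Clim_scal c s l : Clim s l -> Clim (fun k => c * s k)%C (c * l)%C.
Proof.
  intros [H1 H2]. split.
  - exact (is_lim_seq_minus' _ _ _ _ (is_lim_seq_scal_l' (fst c) _ _ H1) (is_lim_seq_scal_l' (snd c) _ _ H2)).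
  - exact (is_lim_seq_plus' _ _ _ _ (is_lim_seq_scal_l' (fst c) _ _ H2) (is_lim_seq_scal_l' (snd c) _ _ H1)).
Qed.

Lemma Clim_unique s l m : Clim s l -> Clim s m -> l = m.
Proof.
  intros [H1 H2] [H3 H4]. apply Cext.
  - apply is_lim_seq_unique in H1. apply is_lim_seq_unique in H3. rewrite H1 in H3. now injection H3.
  - apply is_lim_seq_unique in H2. apply is_lim_seq_unique in H4. rewrite H2 in H4. now injection H4.
Qed.

Lemma Clim_shift s l : Clim s l -> Clim (fun k => s (S k)) l.
Proof. intros [H1 H2]. split; [now apply is_lim_seq_incr_1 in H1|now apply is_lim_seq_incr_1 in H2]. Qed.

Lemma geometric_cauchy_lim (x : nat -> R) K : (forall k, Rabs (x (S k) - x k) <= K * (/ 4) ^ k) ->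
  exists l : R, is_lim_seq x l.
Proof.
  intros H.
  assert (E : ex_series (fun k => x (S k) - x k)).
  { apply (ex_series_le (V := R_CompleteNormedModule)) with (b := fun k => K * (/4) ^ k); auto.
    apply (ex_series_scal_l K (fun k => (/4) ^ k)). apply ex_series_geom. rewrite Rabs_pos_eq; lra. }
  destruct E as [l Hl]. exists (l + x 0%nat).
  apply is_lim_seq_incr_1. apply is_lim_seq_ext with (fun n => sum_n (fun k => x (S k) - x k) n + x 0%nat).
  - intros n. induction n as [|n IH].
    + rewrite sum_O. ring.
    + rewrite sum_Sn. unfold plus; simpl. lra.
  - apply is_lim_seq_plus'; [exact Hl|apply is_lim_seq_const].
Qed.

Lemma geometric_cauchy_Clim (x : nat -> C) K : (forall k, Cmod (x (S k) - x k) <= K * (/ 4) ^ k) ->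
  exists l, Clim x l.
Proof.
  intros H.
  destruct (geometric_cauchy_lim (fun k => fst (x k)) K) as [l1 H1].
  { intros k. eapply Rle_trans; [apply (fst_le_Cmod (x (S k) - x k))|apply H]. }
  destruct (geometric_cauchy_lim (fun k => snd (x k)) K) as [l2 H2].
  { intros k. eapply Rle_trans; [apply (snd_le_Cmod (x (S k) - x k))|apply H]. }
  exists (l1, l2). split; auto.
Qed.

Lemma sqnorm_lim (U : nat -> nat -> C) u M : (forall n, Clim (fun k => U k n) (u n)) ->
  is_lim_seq (fun k => sqnorm (U k) M) (sqnorm u M).
Proof.
  intros H.
  assert (T : forall n, is_lim_seq (fun k => Cmod (U k n) ^ 2) (Cmod (u n) ^ 2)).
  { intros n. destruct (H n) as [H1 H2]. rewrite Cmod_sq.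
    apply is_lim_seq_ext with (fun k => fst (U k n) ^ 2 + snd (U k n) ^ 2).
    - intros k. now rewrite Cmod_sq.
    - apply is_lim_seq_plus'; simpl; repeat apply is_lim_seq_mult'; auto; apply is_lim_seq_const. }
  unfold sqnorm. induction M as [|M IH]; simpl sum_f_R0; [apply T|].
  apply is_lim_seq_plus'; [apply IH|apply T].
Qed.

(** Fixed-point iteration from 0, with limits taken coordinatewise. Each coordinate converges
    geometrically with ratio [1/4], and the uniform bound [B] on the partial sums passes to the
    limit, which is therefore square summable. *)
Lemma resolvent_exists A V K (z : C) h : 1 <= K -> 12 * K <= Cmod z ->
  (forall n, Rabs (A n) <= K) -> (forall n, Rabs (V n) <= K) -> l2 h ->
  exists u, l2 u /\ u 0%nat = RtoC 0 /\ forall n, site A V z u n = h (S n).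
Proof.
  intros HK Hz HA HV Hh.
  assert (Hz0 : z <> 0). { apply Cmod_gt_0. lra. }
  destruct (l2_sqnorm_bounded h Hh) as [B [B0 HB]].
  set (U := fix U k := match k with O => fun _ : nat => RtoC 0 | S k => resolvent_step A V z h (U k) end).
  assert (U0 : forall k, U k 0%nat = RtoC 0) by (intros [|k]; reflexivity).
  assert (UB : forall k M, sqnorm (U k) M <= B).
  { induction k as [|k IH].
    - intros M. unfold sqnorm. simpl U. rewrite Cmod_0. rewrite sum_cte. lra.
    - apply (resolvent_step_bounded A V K); auto. }
  assert (UD : forall k M, sqnorm (fun n => U (S k) n - U k n)%C M <= (/ 16) ^ k * B).
  { induction k as [|k IH].
    - intros M. rewrite pow_O, Rmult_1_l.
      replace (sqnorm (fun n => U 1%nat n - U 0%nat n)%C M) with (sqnorm (U 1%nat) M); [apply UB|].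
      apply sum_eq. intros n _. do 2 f_equal. change (U 0%nat (S n)) with (RtoC 0). ring.
    - intros M. replace ((/16) ^ S k * B) with (/ 16 * ((/ 16) ^ k * B)) by (simpl; ring).
      replace (sqnorm (fun n => U (S (S k)) n - U (S k) n)%C M) with
        (sqnorm (resolvent_step A V z (fun _ => RtoC 0) (fun i => (U (S k) i - U k i)%C)) M).
      + apply (resolvent_step_sqnorm A V K); auto. rewrite !U0. ring.
      + apply sum_eq. intros n _. do 2 f_equal. apply (resolvent_step_minus A V z h (U (S k)) (U k)); auto. }
  assert (UL : forall n, exists l, Clim (fun k => U k n) l).
  { intros n. destruct n as [|n].
    - exists (RtoC 0). split; apply is_lim_seq_ext with (fun _ => 0); try apply is_lim_seq_const;
      intros k; now rewrite U0.
    - apply (geometric_cauchy_Clim _ (sqrt B)). intros k.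
      apply Rsqr_incr_0; [|apply Cmod_ge_0|apply Rmult_le_pos; [apply sqrt_pos|apply pow_le; lra]].
      rewrite Rsqr_mult, Rsqr_sqrt by auto. unfold Rsqr at 2. rewrite <- Rpow_mult_distr.
      replace (/ 4 * / 4) with (/ 16) by field. rewrite Rmult_comm.
      assert (T := sqnorm_term _ n _ (UD k n)). simpl in T. rewrite Rmult_1_r in T. exact T. }
  destruct (choice (fun n l => Clim (fun k => U k n) l) UL) as [u Hu].
  exists u. split; [|split].
  - apply sqnorm_bounded_l2 with B. intros M.
    assert (T := is_lim_seq_le (fun k => sqnorm (U k) M) (fun _ => B) (sqnorm u M) B).
    simpl in T. apply T; [intros k; apply UB|now apply sqnorm_lim|apply is_lim_seq_const].
  - apply (Clim_unique (fun k => U k 0%nat)); auto.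
    split; apply is_lim_seq_ext with (fun _ => 0); try apply is_lim_seq_const; intros k; now rewrite U0.
  (* By definition of the iteration this sequence is constantly [h (S n)]; it involves finitely many
     coordinates, so it also converges to [site A V z u n]. *)
  - intros n. apply (Clim_unique (fun k => site A V 0 (U k) n + (- z) * U (S k) (S n))%C).
    + unfold site. replace ((RtoC (V (S n)) - z) * u (S n))%C with ((RtoC (V (S n)) - 0) * u (S n) + (- z) * u (S n))%C by ring.
      replace (RtoC (A n) * u n + RtoC (A (S n)) * u (S (S n)) + ((RtoC (V (S n)) - 0) * u (S n) + - z * u (S n)))%C
        with (RtoC (A n) * u n + RtoC (A (S n)) * u (S (S n)) + (RtoC (V (S n)) - 0) * u (S n) + - z * u (S n))%C by ring.
      repeat apply Clim_plus; apply Clim_scal; auto. apply (Clim_shift (fun k => U k (S n))). apply Hu.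
    + assert (E : forall k, (site A V 0 (U k) n + - z * U (S k) (S n))%C = h (S n)).
      { intros k. change (U (S k) (S n)) with ((site A V 0 (U k) n - h (S n)) / z)%C. field. auto. }
      split; [apply is_lim_seq_ext with (fun _ => fst (h (S n)))|apply is_lim_seq_ext with (fun _ => snd (h (S n)))];
        try apply is_lim_seq_const; intros k; now rewrite E.
Qed.

Lemma resolvent_unique A V K (z : C) d : 1 <= K -> 12 * K <= Cmod z ->
  (forall n, Rabs (A n) <= K) -> (forall n, Rabs (V n) <= K) ->
  d 0%nat = RtoC 0 -> (exists B, forall M, sqnorm d M <= B) -> (forall n, site A V z d n = 0) ->
  forall n, d n = 0.
Proof.
  intros HK Hz HA HV H0 [B HB] Hd [|n]; auto.
  assert (Hz0 : z <> 0). { apply Cmod_gt_0. lra. }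
  assert (E : forall i, d i = resolvent_step A V z (fun _ => RtoC 0) d i).
  { intros [|i]; auto. simpl. replace (site A V 0 d i) with (site A V z d i + z * d (S i))%C by (unfold site; ring).
    rewrite Hd. field. auto. }
  assert (G : forall k M, sqnorm d M <= (/ 16) ^ k * B).
  { induction k as [|k IH].
    - intros M. rewrite pow_O, Rmult_1_l. apply HB.
    - intros M. replace ((/16) ^ S k * B) with (/ 16 * ((/ 16) ^ k * B)) by (simpl; ring).
      replace (sqnorm d M) with (sqnorm (resolvent_step A V z (fun _ => RtoC 0) d) M).
      + apply (resolvent_step_sqnorm A V K); auto.
      + apply sum_eq. intros i _. now rewrite <- E. }
  apply Cmod_eq_0.
  assert (S0 : Cmod (d (S n)) ^ 2 = 0).
  { apply le_geom_0 with B; [apply pow2_ge_0|]. intros k.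
    eapply Rle_trans; [apply (sqnorm_term d n _ (G k n))|].
    assert (B0 : 0 <= B). { eapply Rle_trans; [apply (pow2_ge_0 (Cmod (d 1%nat)))|]. apply (sqnorm_term d 0), HB. }
    rewrite Rmult_comm. apply Rmult_le_compat_l; auto. apply pow_incr. lra. }
  assert (T := Cmod_ge_0 (d (S n))). nra.
Qed.

Lemma perturbation_bounded q p : (forall n, (p < n)%nat -> q n = 0) -> exists K, forall n : nat, Rabs (q n) <= K.
Proof.
  intros H.
  assert (G : forall m, exists K, forall n, (n <= m)%nat -> Rabs (q n) <= K).
  { induction m as [|m [K HK]].
    - exists (Rabs (q 0%nat)). intros n Hn. replace n with 0%nat by lia. lra.
    - exists (Rmax K (Rabs (q (S m)))). intros n Hn. destruct (Nat.eq_dec n (S m)) as [->|].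
      + apply Rmax_r.
      + eapply Rle_trans; [apply HK; lia|apply Rmax_l]. }
  destruct (G p) as [K HK]. exists (Rmax K 0). intros n. destruct (Nat.le_gt_cases n p).
  - eapply Rle_trans; [apply HK; auto|apply Rmax_l].
  - rewrite H, Rabs_R0 by auto. apply Rmax_r.
Qed.

(** Provides the open set of resolvent points at which the continuation is known and from which the
    identity theorem starts. *)
Lemma res_set_large a v q p : (forall n, (p < n)%nat -> q n = 0) ->
  exists L, 0 < L /\ forall z, L <= Cmod z -> res_set a v q z.
Proof.
  intros Hq. destruct (perturbation_bounded q p Hq) as [Q HQ].
  set (K := Rabs a + 1 + Rabs v + Rabs Q).
  assert (P1 := Rabs_pos a). assert (P2 := Rabs_pos v). assert (P3 := Rabs_pos Q).
  assert (HK : 1 <= K) by (unfold K; lra).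
  assert (HA : forall n, Rabs (acoef a n) <= K).
  { intros n. unfold acoef. destruct (Nat.even n); [unfold K; lra|]. rewrite Rabs_R1. lra. }
  assert (HV : forall n, Rabs (vcoef v n + q n) <= K).
  { intros n. eapply Rle_trans; [apply Rabs_triang|]. specialize (HQ n). assert (T := Rle_abs Q).
    assert (Rabs (vcoef v n) = Rabs v) by (unfold vcoef; destruct (Nat.even n); rewrite ?Rabs_Ropp; auto).
    unfold K. lra. }
  exists (12 * K). split; [lra|]. intros z Hz h Hh. split.
  - destruct (resolvent_exists (acoef a) (fun n => vcoef v n + q n) K z h HK Hz HA HV Hh) as [u [H1 [H2 H3]]].
    exists u. split; auto. intros [|n] Hn; [lia|].
    rewrite <- H3, <- site_dirichlet. destruct n as [|n]; unfold site; simpl dirichlet; rewrite ?H2; reflexivity.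
  - intros u1 u2 L1 L2 E1 E2 n Hn.
    destruct (l2_sqnorm_bounded u1 L1) as [B1 [_ Q1]]. destruct (l2_sqnorm_bounded u2 L2) as [B2 [_ Q2]].
    set (d := fun i => (dirichlet u1 i - dirichlet u2 i)%C).
    assert (D : d n = 0).
    { apply (resolvent_unique (acoef a) (fun n => vcoef v n + q n) K z d HK Hz HA HV).
      - unfold d. simpl. ring.
      - exists (2 * (B1 + B2)). apply (sqnorm_combine u1 u2); auto; [lra|].
        intros i. unfold d, dirichlet, Cminus. eapply Rle_trans; [apply Cmod_triangle_sq|]. rewrite Cmod_opp. lra.
      - intros i. assert (F1 := E1 (S i) ltac:(lia)). assert (F2 := E2 (S i) ltac:(lia)).
        rewrite <- site_dirichlet in F1, F2. unfold site, d in *.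
        assert (Z : (h (S i) - h (S i))%C = RtoC 0) by (generalize (h (S i)); intros x; apply Cext; simpl; ring).
        rewrite <- Z. rewrite <- F1 at 1. rewrite <- F2. ring. }
    unfold d in D. destruct n; [lia|]. exact (Cminus_eq0 _ _ D).
Qed.

(** * Continuation to the second sheet *)

Lemma delta_min (q0 : nat -> R) p : (forall j, (1 <= j <= p)%nat -> q0 j <> 0) ->
  exists d, 0 < d /\ forall j, (1 <= j <= p)%nat -> d <= Rabs (q0 j).
Proof.
  induction p as [|p IH]; intros H.
  - exists 1. split; [lra|]. intros; lia.
  - destruct IH as [d [Hd HD]]. { intros j Hj. apply H. lia. }
    exists (Rmin d (Rabs (q0 (S p)))). split.
    + apply Rmin_pos; auto. apply Rabs_pos_lt, H. lia.
    + intros j Hj. destruct (Nat.eq_dec j (S p)) as [->|]; [apply Rmin_r|].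
      eapply Rle_trans; [apply Rmin_l|apply HD; lia].
Qed.

Lemma qt_out t p q0 n : (p < n)%nat -> qt t p q0 n = 0.
Proof.
  intros H. unfold qt. replace (Nat.leb n p) with false by (symmetry; apply Nat.leb_gt; lia).
  now rewrite Bool.andb_false_r.
Qed.

Lemma qt_in t p q0 n : (1 <= n <= p)%nat -> qt t p q0 n = t * q0 n.
Proof.
  intros H. unfold qt. replace (Nat.leb n p) with true by (symmetry; apply Nat.leb_le; lia).
  now replace (Nat.leb 1 n) with true by (symmetry; apply Nat.leb_le; lia).
Qed.

Lemma jost_lower v a p q0 : 0 < a <= 2 -> (forall j, (1 <= j <= p)%nat -> q0 j <> 0) ->
  forall Rz eps, 0 < eps -> exists t0, 1 < t0 /\ forall t, t0 < t ->
  forall (psi : nat -> C -> C -> C) (z m : C),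
    (forall k, psi (p + k)%nat = floquet a v p k) ->
    (forall n, site (acoef a) (fun n => vcoef v n + qt t p q0 n) z (fun k => psi k z m) n = 0) ->
    mroot a v z m -> Cmod z <= Rz -> eps <= Cmod (z - RtoC (vcoef v (S p))) ->
    eps <= Cmod (psi 0%nat z m).
Proof.
  intros Ha Hq Rz eps He. destruct (delta_min q0 p Hq) as [d [Hd HD]].
  set (B := (Rz ^ 2 + (v ^ 2 + 1 + a ^ 2)) / a + 1).
  (* Bounds [|psi_{p+1}| / |psi_p|]: the numerator [a_p + a_{p+1} m] is at most [2 + 2 * B], the
     denominator [z - vcoef v (S p)] at least [eps]. *)
  set (K := Rmax 1 ((2 + 2 * B) / eps)).
  (* Beyond this threshold [t |q0 j|] exceeds [2 * K + 2] even after losing [|v|] and [|z|], so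
     every perturbed diagonal entry satisfies the hypothesis of [site_domination]. *)
  set (t0 := Rmax 2 ((2 * K + 2 + Rabs v + Rz) / d)).
  exists t0. split; [assert (T := Rmax_l 2 ((2 * K + 2 + Rabs v + Rz) / d)); unfold t0; lra|].
  intros t Ht psi z m Hpsi Hs Hm Hz Hze.
  assert (Ht1 := Rle_lt_trans _ _ _ (Rmax_l _ _) Ht).
  assert (Ht2 := Rle_lt_trans _ _ _ (Rmax_r _ _) Ht).
  apply Rlt_div_l in Ht2; auto.
  assert (HB : Cmod m <= B).
  { eapply Rle_trans; [apply (mroot_bound a v z m); [lra|auto]|]. unfold B.
    apply Rplus_le_compat_r. apply Rmult_le_compat_r; [left; apply Rinv_0_lt_compat; lra|].
    apply Rplus_le_compat_r. apply pow_incr. split; [apply Cmod_ge_0|auto]. }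
  assert (HA : forall n, 0 < acoef a n <= 2).
  { intros n. split; [apply acoef_pos; lra|]. unfold acoef. destruct (Nat.even n); lra. }
  assert (F0 := Hpsi 0%nat). assert (F1 := Hpsi 1%nat). rewrite Nat.add_0_r in F0. rewrite Nat.add_1_r in F1.
  assert (Ep : eps <= Cmod (psi p z m)).
  { rewrite F0. simpl floquet. rewrite RtoC_opp. exact Hze. }
  eapply Rle_trans; [exact Ep|].
  apply (site_domination (acoef a) (fun n => vcoef v n + qt t p q0 n) z (fun k => psi k z m) p K); auto.
  - apply Rmax_l.
  - intros j Hj. rewrite qt_in by auto. specialize (HD j Hj).
    assert (T1 := Cmod_triangle (RtoC (vcoef v j + t * q0 j) - z) (z + RtoC (- vcoef v j))).
    replace (RtoC (vcoef v j + t * q0 j) - z + (z + RtoC (- vcoef v j)))%C with (RtoC (t * q0 j)) in T1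
      by (rewrite RtoC_plus, RtoC_opp; ring).
    assert (T2 := Cmod_triangle z (RtoC (- vcoef v j))).
    rewrite Cmod_R, Rabs_mult, (Rabs_pos_eq t) in T1 by lra. rewrite Cmod_R, Rabs_Ropp in T2.
    assert (Ev : Rabs (vcoef v j) = Rabs v) by (unfold vcoef; destruct (Nat.even j); rewrite ?Rabs_Ropp; auto).
    rewrite Ev in T2. assert (t * d <= t * Rabs (q0 j)) by (apply Rmult_le_compat_l; lra). lra.
  - rewrite F1. simpl floquet. eapply Rle_trans; [apply Cmod_triangle|].
    rewrite Cmod_mult, !Cmod_R, !Rabs_pos_eq by (left; apply HA).
    assert (HA1 := HA p). assert (HA2 := HA (S p)). assert (Pm := Cmod_ge_0 m).
    assert (Q : (2 + 2 * B) / eps <= K) by apply Rmax_r.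
    apply Rle_div_l in Q; auto.
    apply Rle_trans with (2 + 2 * B); [nra|]. eapply Rle_trans; [exact Q|].
    apply Rmult_le_compat_l; auto. assert (T := Rmax_l 1 ((2 + 2 * B) / eps)). fold K in T. lra.
Qed.

(** * The cut plane and the crossing of a band *)

Lemma locfin_avoid (D S : C -> Prop) (A : C) d : locfin D S -> D A -> 0 < d ->
  exists A' s, 0 < s /\ forall w, Cmod (w - A') < s -> Cmod (w - A) < d /\ w <> A /\ ~ S w.
Proof.
  intros HS HA Hd. destruct (locfin_isolate D S A HS HA) as [r [Hr HI]].
  set (m := Rmin d r). assert (Hm : 0 < m) by now apply Rmin_pos.
  exists (A + RtoC (m / 2))%C, (m / 4). split; [lra|]. intros w Hw.
  assert (U : Cmod (w - A) < m).
  { replace (w - A)%C with ((w - (A + RtoC (m / 2))) + RtoC (m / 2))%C by ring.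
    eapply Rle_lt_trans; [apply Cmod_triangle|]. rewrite Cmod_R, Rabs_pos_eq; lra. }
  assert (N : w <> A).
  { intros ->. replace (A - (A + RtoC (m / 2)))%C with (- RtoC (m / 2))%C in Hw by ring.
    rewrite Cmod_opp, Cmod_R, Rabs_pos_eq in Hw; lra. }
  split; [eapply Rlt_le_trans; [exact U|apply Rmin_l]|]. split; auto.
  intros Sw. apply N, HI; auto. eapply Rlt_le_trans; [exact U|apply Rmin_r].
Qed.

Lemma nonac_nonreal a v z : snd z <> 0 -> nonac a v z.
Proof. intros H [E _]. auto. Qed.

Lemma real_interval_near x lo hi (w : C) d : Cmod (w - (x, 0)) < d -> d <= x - lo -> d <= hi - x -> lo < fst w < hi.
Proof.
  intros H H1 H2. assert (T := fst_le_Cmod (w - (x, 0))). simpl in T.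
  assert (T2 := Rle_lt_trans _ _ _ T H). apply Rabs_def2 in T2. lra.
Qed.

Lemma nonac_open a v : opn (nonac a v).
Proof.
  intros [x y] Hz. destruct (Req_dec y 0) as [->|Hy].
  - assert (Hc : x < lam0p a v \/ (lam1m a v < x < lam1p a v) \/ lam0m a v < x).
    { destruct (Rlt_dec x (lam0p a v)) as [?|N1]; auto. destruct (Rlt_dec (lam0m a v) x) as [?|N2]; auto.
      right. left. destruct (Rlt_dec (lam1m a v) x) as [?|N3].
      - destruct (Rlt_dec x (lam1p a v)) as [?|N4]; auto. exfalso. apply Hz. split; [reflexivity|]. right. simpl. lra.
      - exfalso. apply Hz. split; [reflexivity|]. left. simpl. lra. }
    assert (O2 : lam0p a v <= 0 <= lam0m a v /\ lam1m a v <= 0 <= lam1p a v /\ lam0p a v = - lam0m a v /\ lam1m a v = - lam1p a v).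
    { unfold lam0p, lam1m, lam1p, lam0m. assert (T1 := sqrt_pos (v ^ 2 + (a + 1) ^ 2)).
      assert (T2 := sqrt_pos (v ^ 2 + (a - 1) ^ 2)). lra. }
    destruct Hc as [Hc|[Hc|Hc]].
    + exists (lam0p a v - x). split; [lra|]. intros w Hw [_ Hs].
      assert (T := real_interval_near x (x - (lam0p a v - x)) (lam0p a v) w _ Hw ltac:(lra) ltac:(lra)). lra.
    + exists (Rmin (x - lam1m a v) (lam1p a v - x)). split; [apply Rmin_pos; lra|]. intros w Hw [_ Hs].
      assert (T := real_interval_near x (lam1m a v) (lam1p a v) w _ Hw (Rmin_l _ _) (Rmin_r _ _)). lra.
    + exists (x - lam0m a v). split; [lra|]. intros w Hw [_ Hs].
      assert (T := real_interval_near x (lam0m a v) (x + (x - lam0m a v)) w _ Hw ltac:(lra) ltac:(lra)). lra.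
  - exists (Rabs y). split; [now apply Rabs_pos_lt|]. intros w Hw. apply nonac_nonreal. intros E.
    assert (T := snd_le_Cmod (w - (x, y))). simpl in T. rewrite E in T.
    replace (0 + - y) with (- y) in T by ring. rewrite Rabs_Ropp in T. lra.
Qed.

(** The cut plane is connected by polygons through one real point [hub] to the right of all bands:
    from a nonreal point the segment to [hub] meets the real axis only at its end, and a real point
    off the bands is first moved vertically. The gap between the bands is not crossed, so it may be
    closed. *)
Lemma nonac_identity a v (S : C -> Prop) (f : C -> C) (A B : C) : locfin (nonac a v) S ->
  (forall z, nonac a v z -> ~ S z -> holo f z) -> nonac a v A -> nonac a v B ->
  zero_off S f A -> zero_off S f B.
Proof.
  intros HS Hf HA HB.
  assert (Step : forall P Q : C, (forall t, 0 <= t <= 1 -> nonac a v (seg P Q t)) -> zero_off S f P -> zero_off S f Q).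
  { intros P Q. now apply identity_segment; [apply nonac_open| |]. }
  set (hub := (lam0m a v + lam1p a v + 1, 0) : C).
  assert (Hhub : nonac a v hub).
  { intros [_ Hs]. unfold hub in Hs. simpl in Hs. unfold lam0p, lam1m, lam1p, lam0m in Hs.
    assert (T1 := sqrt_pos (v ^ 2 + (a + 1) ^ 2)). assert (T2 := sqrt_pos (v ^ 2 + (a - 1) ^ 2)). lra. }
  assert (Far : forall P Q : C, nonac a v P -> snd Q <> 0 -> snd P = 0 -> forall t, 0 <= t <= 1 -> nonac a v (seg P Q t) /\ nonac a v (seg Q P t)).
  { intros P Q HP HQ E t Ht. split.
    - destruct (Req_dec t 0) as [->|N]; [replace (seg P Q 0) with P by (unfold seg; ring); auto|].
      apply nonac_nonreal. unfold seg. simpl. rewrite E.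
      replace (0 + (t * (snd Q + - 0) + 0 * (fst Q + - fst P))) with (t * snd Q) by ring.
      now apply Rmult_integral_contrapositive.
    - destruct (Req_dec t 1) as [->|N]; [replace (seg Q P 1) with P by (unfold seg; ring); auto|].
      apply nonac_nonreal. unfold seg. simpl. rewrite E.
      replace (snd Q + (t * (0 + - snd Q) + 0 * (fst P + - fst Q))) with ((1 - t) * snd Q) by ring.
      apply Rmult_integral_contrapositive. split; auto. lra. }
  assert (Hup : forall P : C, nonac a v P -> (zero_off S f P -> zero_off S f hub) /\ (zero_off S f hub -> zero_off S f P)).
  { intros P HP.
    assert (N : exists Q, snd Q <> 0 /\ (zero_off S f P -> zero_off S f Q) /\ (zero_off S f Q -> zero_off S f P)).
    { destruct (Req_dec (snd P) 0) as [E|E]; [|now exists P].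
      exists (fst P, 1). assert (H1 : snd (fst P, 1) <> 0) by (simpl; lra). split; [auto|].
      split; apply Step; intros t Ht; now apply (Far P (fst P, 1)). }
    destruct N as [Q [HQ [Q1 Q2]]]. split; intros H.
    - apply (Step Q hub); auto. intros t Ht. now apply (Far hub Q).
    - apply Q2, (Step hub Q); auto. intros t Ht. now apply (Far hub Q). }
  intros H. now apply (Hup B HB), (Hup A HA).
Qed.

(** Two numbers inside the unit circle have a product away from 1:
    [|mu z mu w - 1| >= 1 - |mu z|]. *)
Lemma inner_branch_holo a v (mu : C -> C) z : 0 < a ->
  (forall w, nonac a v w -> mroot a v w (mu w) /\ Cmod (mu w) < 1) -> nonac a v z -> holo mu z.
Proof.
  intros Ha Hmu Hz. destruct (nonac_open a v z Hz) as [r [Hr HO]].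
  destruct (Hmu z Hz) as [_ M1].
  apply (mroot_branch_holo a v mu z r (1 - Cmod (mu z))); auto; [lra| |].
  - intros w Hw. now apply Hmu, HO.
  - intros w Hw. destruct (Hmu w (HO w Hw)) as [_ M2].
    assert (T := Cmod_triangle (- (mu z * mu w - 1)) (mu z * mu w)).
    replace (- (mu z * mu w - 1) + mu z * mu w)%C with (RtoC 1) in T by ring.
    rewrite Cmod_opp, Cmod_1, (Cmod_mult (mu z) (mu w)) in T.
    assert (P1 := Cmod_ge_0 (mu z)). assert (P2 := Cmod_ge_0 (mu w)). nra.
Qed.

Lemma fin_supp_l2 f : fin_supp f -> l2 f.
Proof.
  intros [N HN]. exists (sqnorm f N). intros e He. exists N. intros n Hn.
  change (R_dist (sqnorm f n) (sqnorm f N) < e).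
  replace (sqnorm f n) with (sqnorm f N); [unfold R_dist; rewrite Rminus_diag, Rabs_R0; auto|].
  induction Hn as [|n Hn IH]; auto. rewrite sqnorm_S, <- IH, HN by lia.
  change (Cmod (0, 0)) with (Cmod (RtoC 0)). rewrite Cmod_0. ring.
Qed.

Lemma resolv_val_exists a v q f g z : fin_supp f -> fin_supp g -> res_set a v q z ->
  exists w, resolv_val a v q f g z w.
Proof.
  intros Hf [N HN] Hz. destruct (Hz f (fin_supp_l2 f Hf)) as [[u [H1 H2]] _].
  exists (csum (fun n => u n * Cconj (g n))%C N). split; auto. exists u. split; auto. split; auto.
  apply (Cseries_finite (fun n => u n * Cconj (g n))%C N); auto.
  intros k Hk. rewrite HN by lia. apply Cext; simpl; ring.
Qed.

(* In a disc around a point of the right-hand band the two branches of the multiplier are told apart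
   by the sign of the imaginary part: the branch with [snd m < 0] lies inside the unit circle above
   the band and outside it below, so it continues the physical branch across the band. *)
Lemma band_branch a v z : 0 < a -> lam1p a v < fst z < lam0m a v ->
  exists m, mroot a v z m /\ snd m < 0.
Proof.
  intros Ha Hz. destruct (mroot_exists a v z Ha) as [m Hm].
  destruct (mroot_real a v z m Hm) as [Hn [E1 E2]].
  destruct (Rtotal_order (snd m) 0) as [L|[E|L]].
  - now exists m.
  (* A real multiplier [p] forces [z] to be real, and then [|z^2 - v^2 - 1 - a^2| = a |p + 1/p| >= 2
     a], which puts [z] outside the open band. *)
  - exfalso. rewrite E in *. set (x := fst z) in *. set (y := snd z) in *. set (p := fst m) in *.
    unfold lam1p, lam0m in Hz.
    assert (S1 := sqrt_pos (v ^ 2 + (a - 1) ^ 2)).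
    assert (Q1 : 0 <= v ^ 2 + (a - 1) ^ 2) by (assert (T := pow2_ge_0 v); assert (T' := pow2_ge_0 (a - 1)); lra).
    assert (Q2 : 0 <= v ^ 2 + (a + 1) ^ 2) by (assert (T := pow2_ge_0 v); assert (T' := pow2_ge_0 (a + 1)); lra).
    assert (X1 : v ^ 2 + (a - 1) ^ 2 < x ^ 2).
    { rewrite <- (sqrt_sqrt _ Q1). nra. }
    assert (X2 : x ^ 2 < v ^ 2 + (a + 1) ^ 2).
    { rewrite <- (sqrt_sqrt _ Q2). nra. }
    assert (Hy : y = 0).
    { assert (F : x * (p ^ 2 + 0 ^ 2) * y = 0) by lra. apply Rmult_integral in F. destruct F as [F|]; auto.
      assert (0 < x * (p ^ 2 + 0 ^ 2)) by (apply Rmult_lt_0_compat; lra). lra. }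
    rewrite Hy in E1. set (k := x ^ 2 - (v ^ 2 + 1 + a ^ 2)).
    assert (K1 : - (2 * a) < k < 2 * a) by (unfold k; nra).
    assert (Hp : p <> 0) by (intros F; rewrite F in Hn; lra).
    assert (E3 : k * p = a * (p ^ 2 + 1)).
    { apply (Rmult_eq_reg_r p); auto. unfold k. lra. }
    assert (SQ1 := pow2_ge_0 (p - 1)). assert (SQ2 := pow2_ge_0 (p + 1)).
    destruct (Rdichotomy _ _ Hp); nra.
  - exists (/ m)%C. split; [now apply mroot_inv|]. rewrite snd_Cinv.
    apply Ropp_lt_cancel. rewrite Ropp_0. unfold Rdiv. rewrite Ropp_mult_distr_l, Ropp_involutive.
    apply Rmult_lt_0_compat; auto. now apply Rinv_0_lt_compat.
Qed.

Lemma band_branch_size a v z m : 0 < a -> 0 < fst z -> mroot a v z m -> snd m < 0 ->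
  (0 < snd z -> Cmod m < 1) /\ (snd z < 0 -> 1 < Cmod m).
Proof.
  intros Ha Hx Hm Hs. destruct (mroot_real a v z m Hm) as [Hn [_ E]].
  rewrite <- Cmod_sq in *. assert (P := Cmod_ge_0 m). set (c := Cmod m) in *.
  assert (K : 0 < a * - snd m) by (apply Rmult_lt_0_compat; lra).
  split; intros Hy; apply Rnot_le_lt; intros L.
  - assert (0 < 2 * fst z * snd z * c ^ 2) by (apply Rmult_lt_0_compat; [nra|exact Hn]).
    assert (0 <= a * - snd m * (c ^ 2 - 1)) by (apply Rmult_le_pos; [lra|nra]). nra.
  - assert (0 < 2 * fst z * - snd z * c ^ 2) by (apply Rmult_lt_0_compat; [nra|exact Hn]).
    assert (0 <= a * - snd m * (1 - c ^ 2)) by (apply Rmult_le_pos; [lra|nra]). nra.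
Qed.

(** The competing root [1 / M z] has imaginary part [i > 0] while [snd (M w) < 0], so they stay at
    least [i] apart. This remains valid on the band itself, where both roots have modulus 1. *)
Lemma band_branch_holo a v (M : C -> C) z r : 0 < a -> 0 < r ->
  (forall w, Cmod (w - z) < r -> mroot a v w (M w) /\ snd (M w) < 0) -> holo M z.
Proof.
  intros Ha Hr HM.
  destruct (HM z) as [[Mz Hz] Sz].
  { replace (z - z)%C with (RtoC 0) by ring. now rewrite Cmod_0. }
  set (i := (- snd (M z) / (fst (M z) ^ 2 + snd (M z) ^ 2))).
  assert (Hp : 0 < Cmod (M z)) by now apply Cmod_gt_0.
  assert (Hi : 0 < i).
  { unfold i. rewrite <- Cmod_sq. apply Rdiv_lt_0_compat; [lra|now apply pow_lt]. }
  apply (mroot_branch_holo a v M z r (Cmod (M z) * i)); auto.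
  - now apply Rmult_lt_0_compat.
  - intros w Hw. now apply HM.
  - intros w Hw. destruct (HM w Hw) as [_ Sw].
    replace (M z * M w - 1)%C with (M z * (M w - / M z))%C by (field; auto).
    rewrite Cmod_mult. apply Rmult_le_compat_l; [lra|].
    eapply Rle_trans; [|apply snd_le_Cmod].
    change (snd (M w - / M z)%C) with (snd (M w) + - snd (/ M z)%C). rewrite snd_Cinv. fold i.
    rewrite Rabs_left; lra.
Qed.

(** The multiplier of the second sheet is [1 / mu]. A point arbitrarily near [z0] is all that can be
    asked, since [Fm] is arbitrary at exceptional points and [z0] may be one; it suffices because a
    pole makes [Fm] large on a punctured neighbourhood. *)
Lemma second_sheet_identity a v p q (psi0 num : C -> C -> C) (f g : nat -> C) (Fp Fm mu : C -> C) (z0 : C) d :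
  0 < a -> (forall n, (p < n)%nat -> q n = 0) -> fin_supp f -> fin_supp g ->
  poly2 psi0 -> poly2 num ->
  (forall z m w, mroot a v z m -> Cmod m <= 1 -> z <> RtoC (vcoef v (S p)) ->
     resolv_val a v q f g z w -> (psi0 z m * w)%C = num z m) ->
  ext_Lambda a v q f g Fp Fm ->
  (forall w, nonac a v w -> mroot a v w (mu w) /\ Cmod (mu w) < 1) ->
  nonac a v z0 -> 0 < d ->
  exists w, nonac a v w /\ 0 < Cmod (w - z0) < d /\ (psi0 w (/ mu w) * Fm w)%C = num w (/ mu w)%C.
Proof.
  intros Ha Hq Hf Hg Hpsi Hnum Hgreen [Sp [Sm [[HSp HFp] [[HSm HFm] [Hres Hband]]]]] Hmu Hz0 Hd.
  assert (Hmuh : forall z, nonac a v z -> holo mu z) by (intros z Hz; now apply (inner_branch_holo a v mu z)).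
  set (E := fun (M F : C -> C) z => (psi0 z (M z) * F z + (- (1)) * num z (M z))%C).
  assert (HE : forall M F z, holo M z -> holo F z -> holo (E M F) z).
  { intros M F z HM HF. unfold E. apply holo_plus.
    - apply holo_mult; auto. now apply poly2_holo.
    - apply holo_mult; [apply holo_const|]. now apply poly2_holo. }
  assert (E0 : forall M F z, E M F z = 0 <-> (psi0 z (M z) * F z)%C = num z (M z)).
  { intros M F z. unfold E. split; intros H.
    - apply Cminus_eq0. rewrite <- H. ring.
    - rewrite H. ring. }
  assert (Phys : forall z, nonac a v z -> zero_off Sp (E mu Fp) z).
  { destruct (res_set_large a v q p Hq) as [L [HL HR]].
    assert (PL := sqrt_pos (v ^ 2 + (a + 1) ^ 2)). assert (PL' := sqrt_pos (v ^ 2 + (a - 1) ^ 2)).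
    assert (Pv := Rabs_pos v).
    (* To the right of the bands, and so far out that in a disc of radius 1 the resolvent exists and
       the point [vcoef v (S p)], excluded in the Green identity, is avoided. *)
    set (X := L + lam0m a v + lam1p a v + Rabs v + 2).
    assert (HX : nonac a v (X, 0)).
    { intros [_ Hs]. unfold X in Hs. simpl in Hs. unfold lam0p, lam1m, lam1p, lam0m in Hs. lra. }
    intros z Hz. apply (nonac_identity a v Sp (E mu Fp) (X, 0) z); auto.
    { intros w Hw Sw. apply HE; auto. apply Cdiff_holo. now apply HFp. }
    destruct (nonac_open a v _ HX) as [r [Hr HO]].
    exists (Rmin r 1). split; [apply Rmin_pos; lra|]. intros w Hw _.
    assert (W1 := Rlt_le_trans _ _ _ Hw (Rmin_l _ _)). assert (W2 := Rlt_le_trans _ _ _ Hw (Rmin_r _ _)).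
    assert (Hwn := HO w W1).
    assert (Hbig : L + Rabs v + 1 <= Cmod w).
    { assert (T := real_interval_near X (X - 1) (X + 1) w 1 W2 ltac:(lra) ltac:(lra)).
      eapply Rle_trans; [|apply fst_le_Cmod]. eapply Rle_trans; [|apply Rle_abs].
      unfold X, lam0m, lam1p in T. lra. }
    destruct (resolv_val_exists a v q f g w Hf Hg (HR w ltac:(lra))) as [y Hy].
    apply E0. rewrite (Hres w y Hwn Hy). destruct (Hmu w Hwn) as [M1 M2].
    apply Hgreen; auto; [lra|]. intros F. rewrite F, Cmod_R in Hbig.
    assert (Ev : Rabs (vcoef v (S p)) = Rabs v) by (unfold vcoef; destruct (Nat.even (S p)); rewrite ?Rabs_Ropp; auto).
    lra. }
  assert (Cross : exists B, nonac a v B /\ zero_off Sm (E (fun z => / mu z)%C Fm) B).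
  { set (x := (lam1p a v + lam0m a v) / 2).
    assert (Hlt : lam1p a v < lam0m a v).
    { unfold lam1p, lam0m. apply sqrt_lt_1_alt. assert (T := pow2_ge_0 v). assert (T' := pow2_ge_0 (a - 1)). nra. }
    assert (P1 : 0 <= lam1p a v) by apply sqrt_pos.
    destruct (Hband x) as [r [Hr [[H [S1 [[HS1 HH] HHF]]] _]]]; [right; unfold x; lra|].
    (* Within this radius real parts stay strictly between the band edges, which is where
       [band_branch] supplies a root with negative imaginary part. *)
    set (r' := Rmin r (lam0m a v - x)). assert (Hr' : 0 < r') by (apply Rmin_pos; unfold x; lra).
    set (O := fun w : C => Cmod (w - (x, 0)) < r').
    assert (HO1 : forall w, O w -> Defs.disc (x, 0) r w).
    { intros w Hw. unfold Defs.disc. change (Cmod (w - (x, 0)) < r). eapply Rlt_le_trans; [exact Hw|apply Rmin_l]. }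
    assert (HO2 : forall w, O w -> lam1p a v < fst w < lam0m a v).
    { intros w Hw. apply (real_interval_near x _ _ w r' Hw).
      - eapply Rle_trans; [apply Rmin_r|unfold x; lra].
      - apply Rmin_r. }
    assert (HOo : forall z, O z -> 0 < r' - Cmod (z - (x, 0)) /\ forall w, Cmod (w - z) < r' - Cmod (z - (x, 0)) -> O w).
    { intros z Hz. unfold O in *. split; [lra|]. intros w Hw.
      replace (w - (x, 0))%C with ((w - z) + (z - (x, 0)))%C by ring.
      eapply Rle_lt_trans; [apply Cmod_triangle|lra]. }
    assert (HOop : opn O). { intros z Hz. exists (r' - Cmod (z - (x, 0))). now apply HOo. }
    assert (HMex : forall w, exists m, O w -> mroot a v w m /\ snd m < 0).
    { intros w. destruct (classic (O w)) as [Hw|Hw]; [|now exists (RtoC 0)].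
      destruct (band_branch a v w Ha (HO2 w Hw)) as [m Hm]. now exists m. }
    destruct (choice _ HMex) as [M HM].
    set (S2 := fun w => O w /\ S1 w).
    assert (HS2 : locfin O S2).
    { split; [intros s [? _]; auto|]. intros z Hz. destruct HS1 as [_ HS1]. destruct (HS1 z (HO1 z Hz)) as [e [He [l Hl]]].
      exists e. split; auto. exists l. intros s [_ Hs]. now apply Hl. }
    assert (HMh : forall z, O z -> holo M z).
    { intros z Hz. destruct (HOo z Hz) as [Q1 Q2]. apply (band_branch_holo a v M z _ Ha Q1).
      intros w Hw. now apply HM, Q2. }
    set (up := (x, r' / 2) : C). set (dn := (x, - (r' / 2)) : C).
    assert (Hud : forall w y, Cmod (w - (x, y)) < r' / 2 -> Rabs y = r' / 2 -> O w /\ Rabs (snd w - y) < r' / 2).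
    { intros w y Hw Hy. split.
      - unfold O. replace (w - (x, 0))%C with ((w - (x, y)) + ((x, y) - (x, 0)))%C by ring.
        eapply Rle_lt_trans; [apply Cmod_triangle|]. rewrite Cmod_vertical, Rminus_0_r, Hy. lra.
      - eapply Rle_lt_trans; [apply (snd_le_Cmod (w - (x, y)))|exact Hw]. }
    assert (Hup : forall w, Cmod (w - up) < r' / 2 -> O w /\ 0 < snd w).
    { intros w Hw. destruct (Hud w (r' / 2) Hw) as [Q1 Q2]; [rewrite Rabs_pos_eq; lra|]. split; auto.
      apply Rabs_def2 in Q2. lra. }
    assert (Hdn : forall w, Cmod (w - dn) < r' / 2 -> O w /\ snd w < 0).
    { intros w Hw. destruct (Hud w (- (r' / 2)) Hw) as [Q1 Q2]; [rewrite Rabs_Ropp, Rabs_pos_eq; lra|]. split; auto.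
      apply Rabs_def2 in Q2. lra. }
    assert (Hself : forall w : C, Cmod (w - w) = 0).
    { intros w. replace (w - w)%C with (RtoC 0) by ring. apply Cmod_0. }
    assert (Oup : O up /\ 0 < snd up) by (apply Hup; rewrite Hself; lra).
    assert (Odn : O dn /\ snd dn < 0) by (apply Hdn; rewrite Hself; lra).
    assert (Nup : nonac a v up) by (apply nonac_nonreal; lra).
    destruct (Phys up Nup) as [e [He HZ]].
    (* [H] agrees with [Fp] only off [Sp], so the relation is transferred on a disc of the upper
       half plane that avoids [Sp]. *)
    destruct (locfin_avoid (nonac a v) Sp up (Rmin e (r' / 2)) HSp Nup) as [A [s [Hs HAv]]]; [apply Rmin_pos; lra|].
    assert (ZA : zero_off S2 (E M H) A).
    { exists s. split; auto. intros w Hw HSw. destruct (HAv w Hw) as [V1 [_ V3]].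
      destruct (Hup w) as [Ow Pw]; [eapply Rlt_le_trans; [exact V1|apply Rmin_r]|].
      assert (V4 : E mu Fp w = 0) by (apply HZ; auto; eapply Rlt_le_trans; [exact V1|apply Rmin_l]).
      assert (Nw : nonac a v w) by (apply nonac_nonreal; lra).
      destruct (HM w Ow) as [R1 R2]. destruct (Hmu w Nw) as [R3 R4].
      destruct (band_branch_size a v w (M w) Ha ltac:(specialize (HO2 w Ow); lra) R1 R2) as [R5 _].
      (* Above the band both have modulus below 1, so they cannot be the two different roots, whose
         product is 1. *)
      assert (EM : M w = mu w).
      { destruct (mroot_two a v w (mu w) (M w) Ha R3 R1) as [?|F]; auto. exfalso.
        apply (f_equal Cmod) in F. rewrite Cmod_mult, Cmod_1 in F. specialize (R5 Pw).
        assert (T1 := Cmod_ge_0 (mu w)). assert (T2 := Cmod_ge_0 (M w)). nra. }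
      apply E0. rewrite EM. apply E0 in V4. rewrite <- V4. f_equal.
      apply (HHF w (HO1 w Ow)); auto. intros F. apply HSw. split; auto. }
    assert (OA : O A).
    { apply Hup. destruct (HAv A) as [V1 _]; [rewrite Hself; auto|]. eapply Rlt_le_trans; [exact V1|apply Rmin_r]. }
    assert (ZD : zero_off S2 (E M H) dn).
    { apply (identity_segment O S2 (E M H) A dn HOop HS2); auto.
      - intros z Hz Hn. apply HE; auto. apply Cdiff_holo, HH; [now apply HO1|]. intros F. apply Hn. split; auto.
      - intros t Ht. apply seg_ball; auto. apply Odn. }
    destruct ZD as [e2 [He2 HZ2]].
    destruct (locfin_avoid O S2 dn (Rmin e2 (r' / 2)) HS2 (proj1 Odn)) as [B [s2 [Hs2 HBv]]]; [apply Rmin_pos; lra|].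
    exists B. split.
    - destruct (HBv B) as [V1 _]; [rewrite Hself; auto|]. apply nonac_nonreal.
      destruct (Hdn B) as [_ Q]; [eapply Rlt_le_trans; [exact V1|apply Rmin_r]|]. lra.
    - exists s2. split; auto. intros w Hw HSw. destruct (HBv w Hw) as [V1 [_ V3]].
      destruct (Hdn w) as [Ow Pw]; [eapply Rlt_le_trans; [exact V1|apply Rmin_r]|].
      assert (V4 : E M H w = 0) by (apply HZ2; auto; eapply Rlt_le_trans; [exact V1|apply Rmin_l]).
      assert (Nw : nonac a v w) by (apply nonac_nonreal; lra).
      destruct (HM w Ow) as [R1 R2]. destruct (Hmu w Nw) as [R3 R4].
      destruct (band_branch_size a v w (M w) Ha ltac:(specialize (HO2 w Ow); lra) R1 R2) as [_ R5].
      (* Below the band the same branch [M] has modulus above 1, hence is the other root. *)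
      assert (EM : M w = (/ mu w)%C).
      { destruct (mroot_two a v w (mu w) (M w) Ha R3 R1) as [F|F].
        - exfalso. rewrite F in R5. specialize (R5 Pw). lra.
        - assert (N : mu w <> 0) by apply R3. replace (M w) with (mu w * M w * / mu w)%C by (field; auto).
          rewrite F. ring. }
      apply E0. cbv beta. rewrite <- EM. apply E0 in V4. rewrite <- V4. f_equal. symmetry.
      assert (NS1 : ~ S1 w) by (intros F; apply V3; split; auto).
      destruct (HHF w (HO1 w Ow) NS1) as [_ Q]. apply Q; auto. }
  destruct Cross as [B [HB ZB]].
  destruct (nonac_identity a v Sm (E (fun z => / mu z)%C Fm) B z0 HSm) as [e [He HZ]]; auto.
  { intros w Hw Sw. apply HE.
    - apply (holo_comp Cinv mu); auto. apply holo_inv. apply (Hmu w Hw).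
    - apply Cdiff_holo. now apply HFm. }
  destruct (nonac_open a v z0 Hz0) as [r [Hr HO]].
  destruct (locfin_avoid (nonac a v) Sm z0 (Rmin e (Rmin d r)) HSm Hz0) as [A [s [Hs HAv]]].
  { repeat apply Rmin_pos; auto. }
  destruct (HAv A) as [V1 [V2 V3]].
  { replace (A - A)%C with (RtoC 0) by ring. now rewrite Cmod_0. }
  assert (V4 := Rlt_le_trans _ _ _ V1 (Rmin_l _ _)). assert (V5 := Rlt_le_trans _ _ _ V1 (Rmin_r _ _)).
  exists A. split; [|split; [split|]].
  - apply HO. eapply Rlt_le_trans; [exact V5|apply Rmin_r].
  - apply Cmod_gt_0. intros F. apply V2, Cminus_eq0, F.
  - eapply Rlt_le_trans; [exact V5|apply Rmin_l].
  - apply (E0 (fun z => / mu z)%C Fm A). now apply HZ.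
Qed.

(** * Exclusion of eigenvalues, resonances and virtual states away from the limit point *)

Import Defs.

Theorem theorem4 (v a : R) (p : nat) (q0 : nat -> R)
  (ha : 0 < a <= 2) (hp : (1 <= p)%nat)
  (hq : forall j, (1 <= j <= p)%nat -> q0 j <> 0) :
  forall Rb eps, 0 < Rb -> 0 < eps -> exists t0, 1 < t0 /\
    forall t, t0 < t -> forall z : Cx,
      state_proj a v (qt t p q0) z -> Cmod z <= Rb ->
      Cmod (Csub z (RtoC ((-1) ^ p * v))) < eps.
Proof.
  intros Rb eps HRb Heps.
  (* The enlarged radius and halved distance extend the lower bound to all points within
     [Rmin 1 (eps / 2)] of a state [z] with [|z| <= Rb] that is [eps] away from the limit. *)
  destruct (jost_lower v a p q0 ha hq (Rb + 1) (eps / 2)) as [t0 [Ht0 HJ]]; [lra|].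
  exists t0. split; auto. intros t Ht z Hst Hz. specialize (HJ t Ht).
  rewrite <- vcoef_limit. set (zi := RtoC (vcoef v (S p))).
  change Csub with Cminus. change Defs.Cmod with Complex.Cmod in *. change Defs.RtoC with Complex.RtoC in *.
  apply Rnot_le_lt. intros Hfar.
  assert (Ha : 0 < a) by lra.
  assert (Hq : forall n, (p < n)%nat -> qt t p q0 n = 0) by (intros; now apply qt_out).
  destruct (green_exists a v p (qt t p q0) Ha Hq) as [psi [P1 [P2 [P3 P4]]]].
  assert (Hlow : forall x m : C, mroot a v x m -> Complex.Cmod (x - z)%C < Rmin 1 (eps / 2) ->
     eps / 2 <= Complex.Cmod (psi 0%nat x m) /\ x <> zi /\ Complex.Cmod x <= Rb + 1).
  { intros x m Hm Hx. assert (X1 := Rlt_le_trans _ _ _ Hx (Rmin_l _ _)).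
    assert (X2 := Rlt_le_trans _ _ _ Hx (Rmin_r _ _)).
    assert (T1 := Cmod_triangle (x - z) z). replace (x - z + z)%C with x in T1 by ring.
    assert (T2 := Cmod_triangle (- (x - z)) (x - zi)).
    replace (- (x - z) + (x - zi))%C with (z - zi)%C in T2 by ring. rewrite Cmod_opp in T2.
    assert (X3 : eps / 2 <= Complex.Cmod (x - zi)%C) by lra.
    split; [|split; [|lra]].
    - apply (HJ psi x m); auto; try lra.
    - intros F. rewrite F in X3. replace (zi - zi)%C with (Complex.RtoC 0) in X3 by ring. rewrite Cmod_0 in X3. lra. }
  assert (Hmin : 0 < Rmin 1 (eps / 2)) by (apply Rmin_pos; lra).
  set (B := ((Rb + 1) ^ 2 + (v ^ 2 + 1 + a ^ 2)) / a + 1).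
  assert (HB : forall x m : C, mroot a v x m -> Complex.Cmod x <= Rb + 1 -> Complex.Cmod m <= B).
  { intros x m Hm Hx. eapply Rle_trans; [apply (mroot_bound a v x m Ha Hm)|]. unfold B.
    apply Rplus_le_compat_r. apply Rmult_le_compat_r; [left; apply Rinv_0_lt_compat; lra|].
    apply Rplus_le_compat_r. apply pow_incr. split; [apply Cmod_ge_0|auto]. }
  (* Near [z] every value [w] with [psi_0 w = num] is bounded, uniformly in [x] and for both roots
     [m]; this contradicts resonances and virtual states alike. *)
  assert (Hbound : forall num, poly2 num -> exists K, forall x m w : C, mroot a v x m ->
     Complex.Cmod (x - z)%C < Rmin 1 (eps / 2) -> (psi 0%nat x m * w)%C = num x m -> Complex.Cmod w <= K).
  { intros num Hn. destruct (poly2_bounded num Hn (Rb + 1) B) as [K [HK HK']].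
    exists (K / (eps / 2)). intros x m w Hm Hx E. destruct (Hlow x m Hm Hx) as [L1 [_ L3]].
    specialize (HK' x m L3 (HB x m Hm L3)). rewrite <- E, Cmod_mult in HK'.
    apply Rle_div_r; [lra|]. assert (T := Cmod_ge_0 w). nra. }
  assert (Hzz : Complex.Cmod (z - z)%C < Rmin 1 (eps / 2)).
  { replace (z - z)%C with (Complex.RtoC 0) by ring. now rewrite Cmod_0. }
  destruct Hst as [He|[Hr|[Hs Hv]]].
  (* An eigenvalue is not assumed to lie off the bands, so only [|m| <= 1] is available here. *)
  - destruct (mroot_le1 a v z Ha) as [m [Hm Hm1]]. destruct (Hlow z m Hm Hzz) as [L1 [L2 _]].
    assert (E : psi 0%nat z m = 0).
    { apply (eigenvalue_jost_zero a v p (qt t p q0) psi z m); auto. }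
    rewrite E, Cmod_0 in L1. lra.
  - destruct Hr as [Hnz [f [g [Fp [Fm [Hf [Hg [Hext Hpole]]]]]]]].
    destruct (P4 f g Hf Hg) as [num [Hn Hgr]]. destruct (Hbound num Hn) as [K HK].
    (* The bound [K] itself is the level at which the pole is tested: some point near [z] has both
       [|Fm| > K] and [|Fm| <= K]. *)
    destruct (Hpole K) as [d [Hd Hp]].
    assert (Hmuex : forall w, exists m, nonac a v w -> mroot a v w m /\ Complex.Cmod m < 1).
    { intros w. destruct (classic (nonac a v w)) as [Hw|Hw]; [|now exists (Complex.RtoC 0)].
      destruct (mroot_nonac a v w Ha Hw) as [m Hm]. now exists m. }
    destruct (choice _ Hmuex) as [mu Hmu].
    destruct (second_sheet_identity a v p (qt t p q0) (psi 0%nat) num f g Fp Fm mu z (Rmin d (Rmin 1 (eps / 2))))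
      as [w [W1 [[W2 W3] W4]]]; auto; [now apply Rmin_pos|].
    specialize (Hp w (conj W2 (Rlt_le_trans _ _ _ W3 (Rmin_l _ _)))).
    assert (T : Complex.Cmod (Fm w) <= K).
    { apply (HK w (/ mu w)%C); auto; [now apply mroot_inv, Hmu|]. eapply Rlt_le_trans; [exact W3|apply Rmin_r]. }
    change (K < Complex.Cmod (Fm w)) in Hp. lra.
  - destruct Hv as [_ [f [g [Hf [Hg Hv]]]]].
    destruct (P4 f g Hf Hg) as [num [Hn Hgr]]. destruct (Hbound num Hn) as [K HK].
    destruct (Hv K (Rmin 1 (eps / 2)) Hmin) as [x [w [X1 [X2 [X3 X4]]]]].
    assert (Ez : z = (fst z, 0)) by (apply Cext; auto).
    change (Complex.Cmod (x - (fst z, 0%R))%C < Rmin 1 (eps / 2)) in X2. rewrite <- Ez in X2.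
    destruct (mroot_nonac a v x Ha X1) as [m [Hm Hm1]]. destruct (Hlow x m Hm X2) as [_ [L2 _]].
    assert (T : Complex.Cmod w <= K).
    { apply (HK x m w); auto. apply Hgr; auto. lra. }
    change (K < Complex.Cmod w) in X4. lra.
Qed.
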